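(* Let $\mathcal{A}$ and $\mathcal{B}$ be abelian categories, where $\mathcal{A}$ has enough injectives, and let $F:\mathcal{A}\to\mathcal{B}$ be an additive left exact functor. Let $\mathcal{Q}$ be the category generated by a finite quiver $Q$, with $\mathcal{Q}(\mathcal{A})$ having enough injectives, and assume that the right derived functor $RF:D^+(\mathcal{A})\to D^+(\mathcal{B})$ is an equivalence of categories. Then the right derived functor $R(F_{\mathcal{Q}}):D^+(\mathcal{Q}(\mathcal{A}))\to D^+(\mathcal{Q}(\mathcal{B}))$ of the induced functor $F_{\mathcal{Q}}$ is also an equivalence of categories.
   Context: A quiver $Q=(Q_0,Q_1,t,h)$ consists of a set $Q_0$ of vertices, a set $Q_1$ of arrows, and maps $t,h:Q_1\to Q_0$ (tail and head); it is finite if $Q_0$ and $Q_1$ are finite. The category $\mathcal{Q}$ generated by $Q$ is the path category: its objects are the vertices, and its morphisms $i\to j$ are the paths (including trivial paths) from $i$ to $j$, composed by concatenation. For a small category $\mathcal{C}$ and a category $\mathcal{A}$, $\mathcal{C}(\mathcal{A})$ denotes the category of functors $\mathcal{C}\to\mathcal{A}$ with natural transformations as morphisms; it is abelian if $\mathcal{A}$ is. A functor $F:\mathcal{A}\to\mathcal{B}$ induces $F_{\mathcal{C}}:\mathcal{C}(\mathcal{A})\to\mathcal{C}(\mathcal{B})$, $G\mapsto F\circ G$, $(F_{\mathcal{C}}(\eta))_C=F(\eta_C)$; if $F$ is additive and left exact, so is $F_{\mathcal{C}}$. $D^+$ denotes the bounded-below derived category, and right derived functors are computed with bounded-below complexes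 of injectives. *)

(* Defs.v *)
From HB Require Import structures.
From mathcomp Require Import all_boot all_order all_algebra.
From mathcomp Require Import boolp.

Set Implicit Arguments.
Unset Strict Implicit.
Unset Printing Implicit Defensive.

Import Order.TTheory GRing.Theory Num.Theory.

Local Open Scope ring_scope.
Local Open Scope quotient_scope.

Declare Scope category_scope.
Delimit Scope category_scope with cat.
Local Open Scope category_scope.

Reserved Notation "g ∘ f" (at level 40, left associativity).

Record category := Category {
  ob :> Type;
  homset : ob -> ob -> Type;
  idm : forall x, homset x x;
  cmp : forall x y z, homset y z -> homset x y -> homset x z;
  cmp1m : forall x y (f : homset x y), cmp (idm y) f = f;
  cmpm1 : forall x y (f : homset x y), cmp f (idm x) = f;
  cmpA : forall x y z w (h : homset z w) (g : homset y z) (f : homset x y),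
    cmp h (cmp g f) = cmp (cmp h g) f
}.
Arguments homset {c} _ _.
Arguments idm {c} _.
Arguments cmp {c x y z} _ _.
Notation "g ∘ f" := (cmp g f) : category_scope.

Definition is_iso (C : category) (x y : C) (f : homset x y) : Prop :=
  exists g : homset y x, g ∘ f = idm x /\ f ∘ g = idm y.

Definition monic (C : category) (x y : C) (f : homset x y) : Prop :=
  forall (w : C) (g h : homset w x), f ∘ g = f ∘ h -> g = h.

Definition epic (C : category) (x y : C) (f : homset x y) : Prop :=
  forall (z : C) (g h : homset y z), g ∘ f = h ∘ f -> g = h.

Record functor (C D : category) := Functor {
  fob :> C -> D;
  fmap : forall x y : C, homset x y -> homset (fob x) (fob y);
  fmap1 : forall x : C, fmap (idm x) = idm (fob x);
  fmapM : forall (x y z : C) (g : homset y z) (f : homset x y),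
    fmap (g ∘ f) = fmap g ∘ fmap f
}.
Arguments fmap {C D} _ {x y} _.

Definition id_functor (C : category) : functor C C :=
  @Functor C C (fun x => x) (fun _ _ f => f)
    (fun _ => erefl) (fun _ _ _ _ _ => erefl).

Section FunctorComp.
Variables (C D E : category) (G : functor D E) (F : functor C D).

Fact fcomp1 (x : C) : fmap G (fmap F (idm x)) = idm (G (F x)).
Proof. by rewrite !fmap1. Qed.

Fact fcompM (x y z : C) (g : homset y z) (f : homset x y) :
  fmap G (fmap F (g ∘ f)) = fmap G (fmap F g) ∘ fmap G (fmap F f).
Proof. by rewrite !fmapM. Qed.

Definition fcomp : functor C E :=
  @Functor C E (fun x => G (F x)) (fun _ _ f => fmap G (fmap F f))
    fcomp1 fcompM.

End FunctorComp.

Record nat_trans (C D : category) (F G : functor C D) := NatTrans {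
  app :> forall x : C, homset (F x) (G x);
  naturality : forall (x y : C) (f : homset x y),
    app y ∘ fmap F f = fmap G f ∘ app x
}.

Lemma nat_transP (C D : category) (F G : functor C D) (s t : nat_trans F G) :
  (forall x, s x = t x) -> s = t.
Proof.
case: s t => [s sP] [t tP] /= est.
have {}est : s = t by apply: functional_extensionality_dep.
by case: _ / est tP => tP; congr NatTrans; apply: Prop_irrelevance.
Qed.

Definition is_equivalence (C D : category) (F : functor C D) : Prop :=
  exists G : functor D C,
    (exists u : nat_trans (id_functor C) (fcomp G F), forall x, is_iso (u x)) /\
    (exists v : nat_trans (fcomp F G) (id_functor D), forall y, is_iso (v y)).

Section FunctorCategory.
Variables C D : category.

Definition nat_id (F : functor C D) : nat_trans F F.
Proof.
by exists (fun x => idm (F x)) => x y f; rewrite cmp1m cmpm1.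
Defined.

Definition nat_cmp (F G H : functor C D) (t : nat_trans G H)
  (s : nat_trans F G) : nat_trans F H.
Proof.
exists (fun x => t x ∘ s x) => x y f.
by rewrite -cmpA naturality cmpA naturality cmpA.
Defined.

Definition functor_category : category.
Proof.
refine (@Category (functor C D) (@nat_trans C D) nat_id nat_cmp _ _ _).
- by move=> F G s; apply: nat_transP => x /=; rewrite cmp1m.
- by move=> F G s; apply: nat_transP => x /=; rewrite cmpm1.
- by move=> F G H K u t s; apply: nat_transP => x /=; rewrite cmpA.
Defined.

End FunctorCategory.

Record preadditive := Preadditive {
  pcat :> category;
  zerom : forall x y : pcat, homset x y;
  oppm : forall x y : pcat, homset x y -> homset x y;
  addm : forall x y : pcat, homset x y -> homset x y -> homset x y;
  addmA : forall x y : pcat, associative (@addm x y);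
  addmC : forall x y : pcat, commutative (@addm x y);
  add0m : forall x y : pcat, left_id (zerom x y) (@addm x y);
  addNm : forall x y : pcat, left_inverse (zerom x y) (@oppm x y) (@addm x y);
  addm_cmpl : forall (x y z : pcat) (g g' : homset y z) (f : homset x y),
    addm g g' ∘ f = addm (g ∘ f) (g' ∘ f);
  addm_cmpr : forall (x y z : pcat) (g : homset y z) (f f' : homset x y),
    g ∘ addm f f' = addm (g ∘ f) (g ∘ f')
}.

HB.instance Definition _ (C : category) (x y : C) := gen_eqMixin (homset x y).
HB.instance Definition _ (C : category) (x y : C) := gen_choiceMixin (homset x y).
HB.instance Definition _ (A : preadditive) (x y : A) :=
  GRing.isZmodule.Build (homset x y)
    (@addmA A x y) (@addmC A x y) (@add0m A x y) (@addNm A x y).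

Section PreadditiveTheory.
Variables (A : preadditive) (x y z : A).

Lemma cmpDl (g g' : homset y z) (f : homset x y) : (g + g') ∘ f = g ∘ f + g' ∘ f.
Proof. exact: addm_cmpl. Qed.

Lemma cmpDr (g : homset y z) (f f' : homset x y) : g ∘ (f + f') = g ∘ f + g ∘ f'.
Proof. exact: addm_cmpr. Qed.

Lemma cmp0m (f : homset x y) : (0 : homset y z) ∘ f = 0.
Proof. by apply: (addrI (0 ∘ f)); rewrite -cmpDl !addr0. Qed.

Lemma cmpm0 (g : homset y z) : g ∘ (0 : homset x y) = 0.
Proof. by apply: (addrI (g ∘ 0)); rewrite -cmpDr !addr0. Qed.

Lemma cmpNm (g : homset y z) (f : homset x y) : (- g) ∘ f = - (g ∘ f).
Proof. by apply: (addrI (g ∘ f)); rewrite -cmpDl !subrr cmp0m. Qed.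

Lemma cmpmN (g : homset y z) (f : homset x y) : g ∘ (- f) = - (g ∘ f).
Proof. by apply: (addrI (g ∘ f)); rewrite -cmpDr !subrr cmpm0. Qed.

End PreadditiveTheory.

Section Abelian.
Variable A : preadditive.

Definition is_zero_object (z : A) : Prop :=
  forall x : A, (forall f : homset x z, f = 0) /\ (forall f : homset z x, f = 0).

Definition is_biproduct (x y p : A) (i1 : homset x p) (i2 : homset y p)
    (p1 : homset p x) (p2 : homset p y) : Prop :=
  [/\ p1 ∘ i1 = idm x, p2 ∘ i2 = idm y, p1 ∘ i2 = 0, p2 ∘ i1 = 0
    & i1 ∘ p1 + i2 ∘ p2 = idm p].

Definition is_kernel (x y : A) (f : homset x y) (k : A) (i : homset k x) : Prop :=
  f ∘ i = 0 /\
  forall (w : A) (g : homset w x), f ∘ g = 0 -> exists! h : homset w k, i ∘ h = g.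

Definition is_cokernel (x y : A) (f : homset x y) (c : A) (p : homset y c) : Prop :=
  p ∘ f = 0 /\
  forall (w : A) (g : homset y w), g ∘ f = 0 -> exists! h : homset c w, h ∘ p = g.

Record is_abelian : Prop := IsAbelian {
  abelian_zero : exists z : A, is_zero_object z;
  abelian_biproduct : forall x y : A, exists (p : A) (i1 : homset x p)
    (i2 : homset y p) (p1 : homset p x) (p2 : homset p y), is_biproduct i1 i2 p1 p2;
  abelian_kernel : forall (x y : A) (f : homset x y),
    exists (k : A) (i : homset k x), is_kernel f i;
  abelian_cokernel : forall (x y : A) (f : homset x y),
    exists (c : A) (p : homset y c), is_cokernel f p;
  abelian_monic : forall (x y : A) (f : homset x y), monic f ->
    exists (z : A) (g : homset y z), is_kernel g f;
  abelian_epic : forall (x y : A) (f : homset x y), epic f ->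
    exists (z : A) (g : homset z x), is_cokernel g f
}.

Definition injective_object (i : A) : Prop :=
  forall (x y : A) (m : homset x y), monic m ->
  forall f : homset x i, exists g : homset y i, g ∘ m = f.

Definition enough_injectives : Prop :=
  forall x : A, exists (i : A) (m : homset x i), injective_object i /\ monic m.

End Abelian.

Record additive_functor (A B : preadditive) := AdditiveFunctor {
  addf :> functor A B;
  fmapD : forall (x y : A) (f g : homset x y),
    fmap addf (f + g) = fmap addf f + fmap addf g
}.

(* [0 -> k -> x -> y] is exact iff [k -> x] is a kernel of [x -> y]. *)
Definition left_exact (A B : preadditive) (F : additive_functor A B) : Prop :=
  forall (x y k : A) (f : homset x y) (i : homset k x),
    is_kernel f i -> is_kernel (fmap F f) (fmap F i).

Section AdditiveFunctorTheory.
Variables (A B : preadditive) (F : additive_functor A B).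

Lemma fmap0 (x y : A) : fmap F (0 : homset x y) = 0.
Proof. by apply: (addrI (fmap F 0)); rewrite -fmapD !addr0. Qed.

Lemma fob_zero (z : A) : is_zero_object z -> is_zero_object (F z).
Proof.
move=> z0; have id0 : idm (F z) = 0.
  by rewrite -fmap1 (proj1 (z0 z) (idm z)) fmap0.
move=> x; split=> f.
- by rewrite -[f]cmp1m id0 cmp0m.
- by rewrite -[f]cmpm1 id0 cmpm0.
Qed.

End AdditiveFunctorTheory.

Section FunctorPreadditive.
Variables (C : category) (A : preadditive).

Definition nat_zero (F G : functor C A) : nat_trans F G.
Proof. by exists (fun x => 0) => x y f; rewrite cmp0m cmpm0. Defined.

Definition nat_add (F G : functor C A) (s t : nat_trans F G) : nat_trans F G.
Proof.
by exists (fun x => s x + t x) => x y f; rewrite cmpDl cmpDr !naturality.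
Defined.

Definition nat_opp (F G : functor C A) (s : nat_trans F G) : nat_trans F G.
Proof.
by exists (fun x => - s x) => x y f; rewrite cmpNm cmpmN naturality.
Defined.

Definition functor_preadditive : preadditive.
Proof.
refine (@Preadditive (functor_category C A) nat_zero nat_opp nat_add
          _ _ _ _ _ _).
- by move=> F G s t u; apply: nat_transP => x /=; rewrite addrA.
- by move=> F G s t; apply: nat_transP => x /=; rewrite addrC.
- by move=> F G s; apply: nat_transP => x /=; rewrite add0r.
- by move=> F G s; apply: nat_transP => x /=; rewrite addNr.
- by move=> F G H t t' s; apply: nat_transP => x /=; rewrite cmpDl.
- by move=> F G H t s s'; apply: nat_transP => x /=; rewrite cmpDr.
Defined.

End FunctorPreadditive.

Section InducedFunctor.
Variables (C : category) (A B : preadditive) (F : additive_functor A B).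

Definition whisker (G H : functor C A) (s : nat_trans G H) :
  nat_trans (fcomp F G) (fcomp F H).
Proof.
by exists (fun x => fmap F (s x)) => x y f /=; rewrite -!fmapM naturality.
Defined.

Definition induced_functor :
  additive_functor (functor_preadditive C A) (functor_preadditive C B).
Proof.
unshelve refine (@AdditiveFunctor _ _ (@Functor (functor_preadditive C A)
  (functor_preadditive C B) (fcomp F) whisker _ _) _).
- by move=> G; apply: nat_transP => x /=; rewrite fmap1.
- by move=> G H K t s; apply: nat_transP => x /=; rewrite fmapM.
- by move=> G H s t; apply: nat_transP => x /=; rewrite fmapD.
Defined.

End InducedFunctor.

Record finite_quiver := FiniteQuiver {
  vertex : finType;
  arrow : finType;
  qtail : arrow -> vertex;
  qhead : arrow -> vertex
}.

Section PathCategory.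
Variable Q : finite_quiver.

Inductive qpath (i : vertex Q) : vertex Q -> Type :=
| path_nil : qpath i i
| path_snoc (a : arrow Q) : qpath i (qtail a) -> qpath i (qhead a).

Fixpoint path_cat (i j k : vertex Q) (q : qpath j k) (p : qpath i j) :
    qpath i k :=
  match q in qpath _ k return qpath i k with
  | path_nil => p
  | path_snoc a q' => path_snoc (path_cat q' p)
  end.

Definition path_category : category.
Proof.
refine (@Category (vertex Q) qpath path_nil path_cat _ _ _).
- by [].
- by move=> i j; elim=> //= a q ->.
- by move=> i j k l r q p; elim: r => //= a r ->.
Defined.

End PathCategory.

Record complex (A : preadditive) := Complex {
  cob :> int -> A;
  cdiff : forall n : int, homset (cob n) (cob (n + 1));
  cdiffK : forall n : int, cdiff (n + 1) ∘ cdiff n = 0;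
  bounded_below : exists N : int, forall n : int, n < N -> is_zero_object (cob n)
}.

Record chain_map (A : preadditive) (X Y : complex A) := ChainMap {
  cmap :> forall n : int, homset (X n) (Y n);
  cmap_diff : forall n : int, cmap (n + 1) ∘ cdiff X n = cdiff Y n ∘ cmap n
}.

Lemma chain_mapP (A : preadditive) (X Y : complex A) (s t : chain_map X Y) :
  (forall n, s n = t n) -> s = t.
Proof.
case: s t => [s sP] [t tP] /= est.
have {}est : s = t by apply: functional_extensionality_dep.
by case: _ / est tP => tP; congr ChainMap; apply: Prop_irrelevance.
Qed.

Section ComplexCategory.
Variable A : preadditive.

Definition chain_id (X : complex A) : chain_map X X.
Proof. by exists (fun n => idm (X n)) => n; rewrite cmp1m cmpm1. Defined.

Definition chain_cmp (X Y Z : complex A) (g : chain_map Y Z)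
  (f : chain_map X Y) : chain_map X Z.
Proof.
exists (fun n => g n ∘ f n) => n.
by rewrite -cmpA cmap_diff cmpA cmap_diff cmpA.
Defined.

Definition complex_category : category.
Proof.
refine (@Category (complex A) (@chain_map A) chain_id chain_cmp _ _ _).
- by move=> X Y f; apply: chain_mapP => n /=; rewrite cmp1m.
- by move=> X Y f; apply: chain_mapP => n /=; rewrite cmpm1.
- by move=> X Y Z W h g f; apply: chain_mapP => n /=; rewrite cmpA.
Defined.

(* A presentation of [H^(n+1)(X)]: [cocycles] is a kernel of [d^(n+1)], and
   [cohom] is the cokernel of the map [X^n -> cocycles] induced by [d^n]. *)
Record cohomology (X : complex A) (n : int) := Cohomology {
  cocycles : A;
  incl : homset cocycles (X (n + 1));
  cobound : homset (X n) cocycles;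
  cohom : A;
  proj : homset cocycles cohom;
  inclP : is_kernel (cdiff X (n + 1)) incl;
  coboundP : incl ∘ cobound = cdiff X n;
  projP : is_cokernel cobound proj
}.

Definition induced_on_cohomology (X Y : complex A) (f : chain_map X Y) (n : int)
    (HX : cohomology X n) (HY : cohomology Y n)
    (h : homset (cohom HX) (cohom HY)) : Prop :=
  exists z : homset (cocycles HX) (cocycles HY),
    incl HY ∘ z = f (n + 1) ∘ incl HX /\ h ∘ proj HX = proj HY ∘ z.

Definition quasi_iso (X Y : complex_category) (f : homset X Y) : Prop :=
  forall (n : int) (HX : cohomology X n) (HY : cohomology Y n)
    (h : homset (cohom HX) (cohom HY)),
    induced_on_cohomology f h -> is_iso h.

End ComplexCategory.

Section ComplexFunctor.
Variables (A B : preadditive) (F : additive_functor A B).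

Definition complex_fob (X : complex A) : complex B.
Proof.
exists (fun n => F (X n)) (fun n => fmap F (cdiff X n)).
- by move=> n; rewrite -fmapM cdiffK fmap0.
- by have [N XN] := bounded_below X; exists N => n /XN; apply: fob_zero.
Defined.

Definition complex_fmap (X Y : complex A) (f : chain_map X Y) :
  chain_map (complex_fob X) (complex_fob Y).
Proof.
by exists (fun n => fmap F (f n)) => n /=; rewrite -!fmapM cmap_diff.
Defined.

Definition complex_functor : functor (complex_category A) (complex_category B).
Proof.
refine (@Functor (complex_category A) (complex_category B)
          complex_fob complex_fmap _ _).
- by move=> X; apply: chain_mapP => n /=; rewrite fmap1.
- by move=> X Y Z g f; apply: chain_mapP => n /=; rewrite fmapM.
Defined.

End ComplexFunctor.

Section Localization.
Variables (C : category) (W : forall x y : C, homset x y -> Prop).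

(* The localization C[W^-1] is built from zigzags: formal composites of
   morphisms of [C] and of formal inverses of morphisms in [W]. It makes sense
   for every [W], without a calculus of fractions. *)
Inductive zigzag (x : C) : C -> Type :=
| zz_nil : zigzag x x
| zz_fwd (y z : C) (f : homset y z) : zigzag x y -> zigzag x z
| zz_bwd (y z : C) (s : homset z y) : W s -> zigzag x y -> zigzag x z.

Inductive zz_eq (x : C) : forall y : C, zigzag x y -> zigzag x y -> Prop :=
| zz_refl (y : C) (p : zigzag x y) : zz_eq p p
| zz_sym (y : C) (p q : zigzag x y) : zz_eq p q -> zz_eq q p
| zz_trans (y : C) (p q r : zigzag x y) : zz_eq p q -> zz_eq q r -> zz_eq p r
| zz_congf (y z : C) (f : homset y z) (p q : zigzag x y) :
    zz_eq p q -> zz_eq (zz_fwd f p) (zz_fwd f q)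
| zz_congb (y z : C) (s : homset z y) (Ws : W s) (p q : zigzag x y) :
    zz_eq p q -> zz_eq (zz_bwd Ws p) (zz_bwd Ws q)
| zz_id (y : C) (p : zigzag x y) : zz_eq (zz_fwd (idm y) p) p
| zz_cmp (y z w : C) (g : homset z w) (f : homset y z) (p : zigzag x y) :
    zz_eq (zz_fwd (g ∘ f) p) (zz_fwd g (zz_fwd f p))
| zz_bwdK (y z : C) (s : homset z y) (Ws : W s) (p : zigzag x y) :
    zz_eq (zz_fwd s (zz_bwd Ws p)) p
| zz_fwdK (y z : C) (s : homset z y) (Ws : W s) (p : zigzag x z) :
    zz_eq (zz_bwd Ws (zz_fwd s p)) p.

HB.instance Definition _ (x y : C) := gen_eqMixin (zigzag x y).
HB.instance Definition _ (x y : C) := gen_choiceMixin (zigzag x y).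

Definition zz_rel (x y : C) : rel (zigzag x y) := fun p q => `[< zz_eq p q >].

Fact zz_rel_equiv (x y : C) : equiv_class_of (@zz_rel x y).
Proof.
split=> [p|p q|q p r].
- exact/asboolP/zz_refl.
- by apply/asboolP/asboolP; apply: zz_sym.
- by move=> /asboolP pq /asboolP qr; apply/asboolP; apply: zz_trans pq qr.
Qed.

Canonical zz_equiv (x y : C) := EquivRelPack (@zz_rel_equiv x y).

Definition loc_hom (x y : C) : Type := {eq_quot (zz_equiv x y)}.

Definition loc_class (x y : C) (p : zigzag x y) : loc_hom x y :=
  \pi_({eq_quot (zz_equiv x y)}) p.

Lemma loc_classP (x y : C) (p q : zigzag x y) :
  loc_class p = loc_class q <-> zz_eq p q.
Proof. by split=> [/eqmodP /asboolP|pq]; [|apply/eqmodP/asboolP]. Qed.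

Lemma loc_class_repr (x y : C) (u : loc_hom x y) : loc_class (repr u) = u.
Proof. exact: reprK. Qed.

Fixpoint zz_cat (x y z : C) (q : zigzag y z) (p : zigzag x y) : zigzag x z :=
  match q in zigzag _ z return zigzag x z with
  | zz_nil => p
  | zz_fwd _ _ f q' => zz_fwd f (zz_cat q' p)
  | zz_bwd _ _ _ Ws q' => zz_bwd Ws (zz_cat q' p)
  end.

Lemma zz_cat_eq (x y z : C) (q q' : zigzag y z) (p p' : zigzag x y) :
  zz_eq q q' -> zz_eq p p' -> zz_eq (zz_cat q p) (zz_cat q' p').
Proof.
move=> qq' pp'; apply: (@zz_trans _ _ _ (zz_cat q p')).
  by elim: q {q' qq'} => //= *; [apply: zz_congf|apply: zz_congb].
elim: qq' => /= *; by [apply: zz_refl | apply: zz_sym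
  | apply: zz_trans; eassumption | apply: zz_congf | apply: zz_congb
  | apply: zz_id | apply: zz_cmp | apply: zz_bwdK | apply: zz_fwdK].
Qed.

Lemma zz_catA (x y z w : C) (r : zigzag z w) (q : zigzag y z)
  (p : zigzag x y) : zz_cat r (zz_cat q p) = zz_cat (zz_cat r q) p.
Proof. by elim: r => //= [? ? ? r ->|? ? ? ? r ->]. Qed.

Lemma zz_catm1 (x y : C) (p : zigzag x y) : zz_cat p (zz_nil x) = p.
Proof. by elim: p => //= [? ? ? p ->|? ? ? ? p ->]. Qed.

Definition loc_cmp (x y z : C) (v : loc_hom y z) (u : loc_hom x y) :
  loc_hom x z := loc_class (zz_cat (repr v) (repr u)).

Lemma loc_cmpE (x y z : C) (q : zigzag y z) (p : zigzag x y) :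
  loc_cmp (loc_class q) (loc_class p) = loc_class (zz_cat q p).
Proof.
by apply/loc_classP; apply: zz_cat_eq; apply/loc_classP; apply: loc_class_repr.
Qed.

Definition localization : category.
Proof.
refine (@Category C loc_hom (fun x => loc_class (zz_nil x)) loc_cmp _ _ _).
- by move=> x y u; rewrite -[u]loc_class_repr loc_cmpE.
- by move=> x y u; rewrite -[u]loc_class_repr loc_cmpE zz_catm1.
- move=> x y z w t v u.
  rewrite -[t]loc_class_repr -[v]loc_class_repr -[u]loc_class_repr.
  by rewrite !loc_cmpE zz_catA.
Defined.

Definition loc_functor : functor C localization.
Proof.
refine (@Functor C localization (fun x => x)
  (fun x y f => loc_class (zz_fwd f (zz_nil x))) _ _).
- by move=> x; apply/loc_classP/zz_id.
- by move=> x y z g f /=; rewrite loc_cmpE; apply/loc_classP/zz_cmp.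
Defined.

End Localization.

(* Localizing bounded-below complexes directly, rather than their homotopy
   category, gives the same category: chain-homotopic maps become equal as soon
   as quasi-isomorphisms are inverted. *)
Definition Dplus (A : preadditive) : category := localization (@quasi_iso A).

Definition Dplus_functor (A : preadditive) :
  functor (complex_category A) (Dplus A) := loc_functor (@quasi_iso A).

Record right_derived (A B : preadditive) (F : additive_functor A B) :=
    RightDerived {
  rderived :> functor (Dplus A) (Dplus B);
  rd_unit : nat_trans (fcomp (Dplus_functor B) (complex_functor F))
                      (fcomp rderived (Dplus_functor A));
  rd_universal : forall (G : functor (Dplus A) (Dplus B))
      (c : nat_trans (fcomp (Dplus_functor B) (complex_functor F))
                     (fcomp G (Dplus_functor A))),
    exists! t : nat_trans rderived G,
      forall X : complex A, c X = t (Dplus_functor A X) ∘ rd_unit X;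
  (* If X is a complex of injectives, RF(X) is F applied degreewise to X. This
     determines RF when A has enough injectives, and then amounts to the
     universal property above. *)
  rd_injective : forall X : complex A,
    (forall n : int, injective_object (X n)) -> is_iso (rd_unit X)
}.

(* Main.v *)
From HB Require Import structures.
From mathcomp Require Import all_boot all_order all_algebra.
From mathcomp Require Import boolp zify ring.
Require Import Defs.

(* Let Y be the class of objects M of B with Ext^m(M, F j) = 0 for all m > 0 and
   all injective j of A. Since RF is an equivalence, F is fully faithful from
   bounded-below complexes of injectives up to homotopy to D^+(B), and every
   object of D^+(B) is isomorphic to some F I. Applied to a complex with zero
   differential and arbitrary terms, this bounds the Ext dimension of B against
   the F j. Hence, if F I is isomorphic to M placed in degree 0, the 0-cocycles
   of F I belong to Y and map onto M; and every object of Y embeds in some F j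
   with cokernel in Y. Conversely, a class Y with these properties suffices to
   compute D^+(B) by complexes with terms F j, up to homotopy.
   The properties of Y pass to representations of Q, because the path category
   is free: maps given at the vertices extend to representations one arrow at a
   time, an injective representation is injective at each vertex, and every
   extension of a representation by an injective one splits, which corrects
   families of maps at the vertices into morphisms. So F_Q is fully faithful on
   injectives and complexes with terms F_Q J compute D^+(Q(B)), which makes
   R(F_Q) an equivalence. *)

(** The category [D^+(Q(B))] is not the category of representations of [Q] in [D^+(B)], so an
    equivalence [RF] cannot be applied vertex by vertex. It is translated into properties of objects
    of [B] because these can be tested at each vertex. [B] is not assumed to have enough injectives.
    The objects [F j] stand in for them, but maps into [F j] are only known to extend along
    monomorphisms whose cokernel lies in Y, so cokernels and cocycles have to be kept in Y
    throughout. In an acyclic complex that is bounded below only, there is no right end from which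
    to control the cocycles. The uniform bound on dimension replaces it: all cocycles satisfy the
    bound at once, and each short exact sequence linking consecutive cocycles lowers it by one. The
    same bound makes left resolutions by objects of Y finite, so that they remain bounded below. *)

Set Implicit Arguments.
Unset Strict Implicit.
Unset Printing Implicit Defensive.

Import Order.TTheory GRing.Theory Num.Theory.

Local Open Scope ring_scope.
Local Open Scope category_scope.

(* The square-zero extension of [int] by an abelian group embeds the latter in
   a commutative ring, which makes [ring] decide identities of abelian groups. *)
Section SquareZero.
Variable V : zmodType.

Definition sqz : Type := (int * V)%type.
HB.instance Definition _ := GRing.Zmodule.copy sqz (int * V)%type.

Definition sqz_one : sqz := (1, 0).
Definition sqz_mul (x y : sqz) : sqz := (x.1 * y.1, x.2 *~ y.1 + y.2 *~ x.1).

Fact sqz_mulA : associative sqz_mul.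
Proof.
move=> [a u] [b v] [c w]; rewrite /sqz_mul /= mulrA; congr pair.
by rewrite !mulrzDl -!mulrzA addrA [(b * a)%R]mulrC [(c * a)%R]mulrC.
Qed.

Fact sqz_mulC : commutative sqz_mul.
Proof. by move=> x y; rewrite /sqz_mul mulrC addrC. Qed.

Fact sqz_mul1 : left_id sqz_one sqz_mul.
Proof. by move=> [a u]; rewrite /sqz_mul /= mul1r mul0rz mulr1z add0r. Qed.

Fact sqz_mulD : left_distributive sqz_mul +%R.
Proof.
move=> [a u] [b v] [c w]; rewrite /sqz_mul /= mulrDl; congr pair.
by rewrite mulrzDl mulrzDr addrACA.
Qed.

Fact sqz_one_neq0 : sqz_one != 0.
Proof. by []. Qed.

HB.instance Definition _ := GRing.Zmodule_isComNzRing.Build sqz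
  sqz_mulA sqz_mulC sqz_mul1 sqz_mulD sqz_one_neq0.

Definition sqz_in (x : V) : sqz := (0, x).

Fact sqz_in_is_additive : zmod_morphism sqz_in.
Proof. by move=> x y; congr pair; rewrite /= subr0. Qed.

HB.instance Definition _ := GRing.isZmodMorphism.Build V sqz sqz_in
  sqz_in_is_additive.

Lemma sqz_in_inj : injective sqz_in.
Proof. by move=> x y []. Qed.

End SquareZero.

Ltac zmod := apply: sqz_in_inj; ring.

Lemma dep_choice (T : Type) (P : T -> Type) (R : forall x, P x -> Prop) :
  (forall x, exists y, R x y) -> exists f : forall x, P x, forall x, R x (f x).
Proof. by move=> RP; exists (fun x => sval (cid (RP x))) => x; apply: svalP. Qed.

Lemma zmod_combine (V : zmodType) (a b c c' : V) : a - b = c - c' -> c = c' -> a = b.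
Proof. by move=> e cc'; apply: subr0_eq; rewrite e cc' subrr. Qed.

Lemma zmod_combine2 (V : zmodType) (a b c c' d d' : V) :
  a - b = (c' - c) + (d - d') -> c = c' -> d = d' -> a = b.
Proof. by move=> e cc' dd'; apply: subr0_eq; rewrite e cc' dd' !subrr addr0. Qed.

Record abcat := AbCat { abp :> preadditive; abpP : is_abelian abp }.

(** * Dependent choice along the integers *)

Section IntChoice.
Variable P : int -> Type.

Definition icast (m n : int) (e : m = n) (x : P m) : P n := eq_rect m P x n e.

Lemma icast_id (n : int) (e : n = n) (x : P n) : icast e x = x.
Proof. by rewrite (eq_irrelevance e erefl). Qed.

Lemma icast_icast (m n k : int) (e : m = n) (e' : n = k) (x : P m) :
  icast e' (icast e x) = icast (etrans e e') x.
Proof. by case: _ / e'. Qed.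

(** An equation [m + 1 = n + 1] cannot be eliminated as it stands, neither side being a variable;
    cancelling [1] gives one that can. *)
Lemma icast_succ (m n : int) (e : m + 1 = n + 1) (x : forall k : int, P (k + 1)) :
  icast e (x m) = x n.
Proof. by have emn := addIr _ e; case: _ / emn e => e; apply: icast_id. Qed.

(* Every integer is a successor, so no term of [y] is left free. *)
Lemma succ_family (x : forall n : int, P (n + 1)) :
  exists y : forall n, P n, forall n : int, y (n + 1) = x n.
Proof.
exists (fun n => icast (subrK 1 n) (x (n - 1))) => n.
exact: icast_succ.
Qed.

Variables (good : forall n, P n -> Prop)
  (R : forall n : int, P n -> P (n + 1) -> Prop).

(** Recursion runs upwards over [nat], while complexes are indexed by all of [int]: [t] prescribes
    the terms up to [N], where the complexes in question vanish, and [step] continues from there. *)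
Lemma int_dependent_choice (N : int) (t : forall n, P n) :
  (forall n, n <= N -> good (t n)) ->
  (forall n, n < N -> R (t n) (t (n + 1))) ->
  (forall n (x : P n), N <= n -> good x -> exists y, good y /\ R x y) ->
  exists s : forall n, P n,
    forall n, good (s n) /\ R (s n) (s (n + 1)).
Proof.
move=> goodt Rt step.
(* [step] is made total so that it can be iterated; the default [t (n + 1)] is never reached, since
   all iterates are good. *)
have stepT n (x : P n) : {y : P (n + 1) | N <= n -> good x -> good y /\ R x y}.
  apply: cid; case: (pselect (N <= n /\ good x)) => [[Nn gx]|bad].
    by have [y yP] := step n x Nn gx; exists y.
  by exists (t (n + 1)) => Nn gx; case: bad.
have e0 : N = N + 0%:Z by rewrite addr0.
have eS k : N + k%:Z + 1 = N + k.+1%:Z by rewrite -addrA -[k.+1]addn1 PoszD.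
pose u := fix u k : P (N + k%:Z) := match k return P (N + k%:Z) with
  | 0%N => icast e0 (t N) | k.+1 => icast (eS k) (sval (stepT _ (u k))) end.
have icastg m n (e : m = n) (x : P m) : good x -> good (icast e x).
  by case: _ / e.
have ugood k : good (u k).
  elim: k => [|k IH] /=; apply: icastg; first exact: goodt.
  by case: (stepT _ _) => y /= /(_ _ IH) []//; rewrite lerDl.
have uR k : R (u k) (icast (esym (eS k)) (u k.+1)).
  rewrite /= /icast -/icast; case: (stepT _ _) => y /= /(_ _ (ugood k)) [].
    by rewrite lerDl.
  by move=> _; case: _ / (eS k) => /=.
have ne n : N <= n -> N + `|n - N|%N%:Z = n.
  by move=> Nn; rewrite gez0_abs ?subr_ge0// addrCA subrr addr0.
pose s n : P n := match boolP (N <= n) with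
  | AltTrue Nn => icast (ne n Nn) (u `|n - N|%N) | AltFalse _ => t n end.
have sE k n (e : N + k%:Z = n) : s n = icast e (u k).
  rewrite /s; case: {-}_ / boolP => [Nn|]; last by move=> bad; exfalso; move: bad; rewrite -[X in _ <= X]e lerDl.
  have ek : k = `|n - N|%N by rewrite -e addrC addKr.
  by case: _ / ek (ne n Nn) => e'; rewrite (eq_irrelevance e' e).
have sN : s N = t N.
  by rewrite (sE 0%N N (esym e0)) /= icast_icast icast_id.
have sT n : n <= N -> s n = t n.
  rewrite le_eqVlt => /orP[/eqP -> //|nN].
  rewrite /s; case: {-}_ / boolP => // Nn.
  by have := lt_le_trans nN Nn; rewrite ltxx.
exists s => n; case: (ltP n N) => nN.
  rewrite (sT _ (ltW nN)) sT ?lezD1//.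
  by split; [apply/goodt/ltW|apply: Rt].
pose k := `|n - N|%N; have ek : N + k.+1%:Z = n + 1 by rewrite -eS ne.
rewrite (sE k n (ne n nN)) (sE k.+1 _ ek); split; first exact/icastg/ugood.
have Ricast m l (e : m = l) (e' : m + 1 = l + 1) x y :
    R x y -> R (icast e x) (icast e' y).
  by case: _ / e e' => e'; rewrite !icast_id.
rewrite (_ : ek = etrans (esym (eS k)) (etrans (eS k) ek)); last first.
  exact: eq_irrelevance.
by rewrite -icast_icast; apply/Ricast/uR.
Qed.

End IntChoice.

(** * Abelian categories *)

Section PreadditiveLemmas.
Variable A : preadditive.

Lemma cmpBl (x y z : A) (g g' : homset y z) (f : homset x y) :
  (g - g') ∘ f = g ∘ f - g' ∘ f.
Proof. by rewrite cmpDl cmpNm. Qed.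

Lemma cmpBr (x y z : A) (g : homset y z) (f f' : homset x y) :
  g ∘ (f - f') = g ∘ f - g ∘ f'.
Proof. by rewrite cmpDr cmpmN. Qed.

Lemma monicP (x y : A) (f : homset x y) :
  monic f <-> forall (w : A) (g : homset w x), f ∘ g = 0 -> g = 0.
Proof.
split=> [fm w g fg0|f0 w g h fgh]; first by apply: fm; rewrite cmpm0.
by apply/subr0_eq/f0; rewrite cmpBr fgh subrr.
Qed.

Lemma epicP (x y : A) (f : homset x y) :
  epic f <-> forall (w : A) (g : homset y w), g ∘ f = 0 -> g = 0.
Proof.
split=> [fm w g fg0|f0 w g h fgh]; first by apply: fm; rewrite cmp0m.
by apply/subr0_eq/f0; rewrite cmpBl fgh subrr.
Qed.

Lemma epic_cmp (x y z : A) (g : homset y z) (f : homset x y) :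
  epic g -> epic f -> epic (g ∘ f).
Proof. by move=> ge fe w a b; rewrite !cmpA => /fe /ge. Qed.

Lemma epic_cmpl (x y z : A) (g : homset y z) (f : homset x y) :
  epic (g ∘ f) -> epic g.
Proof. by move=> gfe w a b e; apply: gfe; rewrite !cmpA e. Qed.

Lemma monic_cmpr (x y z : A) (g : homset y z) (f : homset x y) :
  monic (g ∘ f) -> monic f.
Proof. by move=> gfm w a b e; apply: gfm; rewrite -!cmpA e. Qed.

Lemma monic_cmp (x y z : A) (g : homset y z) (f : homset x y) :
  monic g -> monic f -> monic (g ∘ f).
Proof. by move=> gm fm w a b; rewrite -!cmpA => /gm /fm. Qed.

Lemma epic_id (x : A) : epic (idm x).
Proof. by move=> w a b; rewrite !cmpm1. Qed.

Lemma kernel_monic (x y : A) (f : homset x y) (k : A) (i : homset k x) :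
  is_kernel f i -> monic i.
Proof.
move=> [fi0 fiP] w a b iab.
have fib : f ∘ (i ∘ b) = 0 by rewrite cmpA fi0 cmp0m.
have [c [_ cP]] := fiP _ _ fib.
by rewrite -(cP a iab) (cP b).
Qed.

Lemma cokernel_epic (x y : A) (f : homset x y) (c : A) (p : homset y c) :
  is_cokernel f p -> epic p.
Proof.
move=> [pf0 pfP] w a b pab.
have pfb : b ∘ p ∘ f = 0 by rewrite -cmpA pf0 cmpm0.
have [d [_ dP]] := pfP _ _ pfb.
by rewrite -(dP a pab) (dP b).
Qed.

Lemma kernel_lift (x y : A) (f : homset x y) (k : A) (i : homset k x) (w : A)
    (g : homset w x) :
  is_kernel f i -> f ∘ g = 0 -> exists h, i ∘ h = g.
Proof. by move=> [_ fiP] /fiP [h [hP _]]; exists h. Qed.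

Lemma cokernel_lift (x y : A) (f : homset x y) (c : A) (p : homset y c) (w : A)
    (g : homset y w) :
  is_cokernel f p -> g ∘ f = 0 -> exists h, h ∘ p = g.
Proof. by move=> [_ fiP] /fiP [h [hP _]]; exists h. Qed.

Lemma kernelP (x y : A) (f : homset x y) (k : A) (i : homset k x) :
  f ∘ i = 0 -> monic i ->
  (forall (w : A) (g : homset w x), f ∘ g = 0 -> exists h, i ∘ h = g) ->
  is_kernel f i.
Proof.
move=> fi0 im il; split=> // w g /il [h ih]; exists h; split=> // h' ih'.
by apply: im; rewrite ih ih'.
Qed.

Lemma cokernelP (x y : A) (f : homset x y) (c : A) (p : homset y c) :
  p ∘ f = 0 -> epic p ->
  (forall (w : A) (g : homset y w), g ∘ f = 0 -> exists h, h ∘ p = g) ->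
  is_cokernel f p.
Proof.
move=> fi0 im il; split=> // w g /il [h ih]; exists h; split=> // h' ih'.
by apply: im; rewrite ih ih'.
Qed.

Definition short_exact (x y z : A) (i : homset x y) (p : homset y z) :=
  is_kernel p i /\ epic p.

Lemma zero_id (z : A) : is_zero_object z <-> idm z = 0.
Proof.
split=> [z0|e x]; first exact: (proj1 (z0 z)).
by split=> f; [rewrite -[f]cmp1m e cmp0m|rewrite -[f]cmpm1 e cmpm0].
Qed.

Lemma zero_from (z x : A) (f : homset z x) : is_zero_object z -> f = 0.
Proof. by move=> z0; have [_ /(_ f)] := z0 x. Qed.

Lemma zero_to (z x : A) (f : homset x z) : is_zero_object z -> f = 0.
Proof. by move=> z0; have [/(_ f)] := z0 x. Qed.

Lemma is_iso_id (x : A) : is_iso (idm x).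
Proof. by exists (idm x); rewrite cmp1m. Qed.

End PreadditiveLemmas.

Section Choices.
Variable A : abcat.

Definition zob : A := sval (cid (abelian_zero (abpP A))).
Lemma zobP : is_zero_object zob.
Proof. exact: svalP. Qed.

Record biproduct (x y : A) := Biproduct {
  bsum_ob : A;
  inl_ : homset x bsum_ob;
  inr_ : homset y bsum_ob;
  fst_ : homset bsum_ob x;
  snd_ : homset bsum_ob y;
  biproductP : is_biproduct inl_ inr_ fst_ snd_
}.

Fact some_biproduct (x y : A) : exists _ : biproduct x y, True.
Proof.
have [p [i1 [i2 [p1 [p2 P]]]]] := abelian_biproduct (abpP A) x y.
by exists (Biproduct P).
Qed.

Definition the_biproduct (x y : A) : biproduct x y := sval (cid (some_biproduct x y)).

Definition bsum (x y : A) : A := bsum_ob (the_biproduct x y).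

Variables x y : A.
Definition binl : homset x (bsum x y) := inl_ (the_biproduct x y).
Definition binr : homset y (bsum x y) := inr_ (the_biproduct x y).
Definition bfst : homset (bsum x y) x := fst_ (the_biproduct x y).
Definition bsnd : homset (bsum x y) y := snd_ (the_biproduct x y).

Lemma fst_inl : bfst ∘ binl = idm x. Proof. by case: (biproductP (the_biproduct x y)). Qed.
Lemma snd_inr : bsnd ∘ binr = idm y. Proof. by case: (biproductP (the_biproduct x y)). Qed.
Lemma fst_inr : bfst ∘ binr = 0. Proof. by case: (biproductP (the_biproduct x y)). Qed.
Lemma snd_inl : bsnd ∘ binl = 0. Proof. by case: (biproductP (the_biproduct x y)). Qed.
Lemma bsum_id : binl ∘ bfst + binr ∘ bsnd = idm (bsum x y).
Proof. by case: (biproductP (the_biproduct x y)). Qed.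

Variable w : A.
Lemma fst_inlK (f : homset w x) : bfst ∘ (binl ∘ f) = f.
Proof. by rewrite cmpA fst_inl cmp1m. Qed.
Lemma snd_inrK (f : homset w y) : bsnd ∘ (binr ∘ f) = f.
Proof. by rewrite cmpA snd_inr cmp1m. Qed.
Lemma fst_inr0 (f : homset w y) : bfst ∘ (binr ∘ f) = 0.
Proof. by rewrite cmpA fst_inr cmp0m. Qed.
Lemma snd_inl0 (f : homset w x) : bsnd ∘ (binl ∘ f) = 0.
Proof. by rewrite cmpA snd_inl cmp0m. Qed.

Lemma bsum_mapP (f g : homset w (bsum x y)) :
  bfst ∘ f = bfst ∘ g -> bsnd ∘ f = bsnd ∘ g -> f = g.
Proof.
by move=> e1 e2; rewrite -[f]cmp1m -[g]cmp1m -bsum_id !cmpDl -!cmpA e1 e2.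
Qed.

Lemma bsum_zero : is_zero_object x -> is_zero_object y -> is_zero_object (bsum x y).
Proof.
move=> x0 y0; apply/zero_id; rewrite -bsum_id.
by rewrite (zero_from binl x0) (zero_from binr y0) !cmp0m addr0.
Qed.

Lemma bsum_short_exact : short_exact binl bsnd.
Proof.
split; last by move=> z a b e; rewrite -[a]cmpm1 -[b]cmpm1 -snd_inr !cmpA e.
apply: kernelP; first exact: snd_inl.
  by move=> z a b e; rewrite -[a]cmp1m -[b]cmp1m -fst_inl -!cmpA e.
move=> z g g0; exists (bfst ∘ g); rewrite -[RHS]cmp1m -bsum_id cmpDl -!cmpA g0.
by rewrite cmpm0 addr0.
Qed.

End Choices.
Arguments binl {A x y}.
Arguments binr {A x y}.
Arguments bfst {A x y}.
Arguments bsnd {A x y}.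

Definition cmpE := (cmpDl, cmpDr, cmpBl, cmpBr, cmpNm, cmpmN, cmp0m, cmpm0, cmp1m, cmpm1).
Definition bsumE := (fst_inl, snd_inr, fst_inr, snd_inl,
  fst_inlK, snd_inrK, fst_inr0, snd_inl0).

Ltac cmp_norm := rewrite ?(cmpE, bsumE); rewrite -?cmpA; rewrite ?(cmpE, bsumE).

Section KernelChoice.
Variable A : abcat.
Variables (x y : A) (f : homset x y).

Definition ker : A := sval (cid (abelian_kernel (abpP A) f)).
Definition kin : homset ker x := sval (cid (svalP (cid (abelian_kernel (abpP A) f)))).
Lemma kinP : is_kernel f kin.
Proof. exact: svalP. Qed.

Definition coker : A := sval (cid (abelian_cokernel (abpP A) f)).
Definition kout : homset y coker :=
  sval (cid (svalP (cid (abelian_cokernel (abpP A) f)))).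
Lemma koutP : is_cokernel f kout.
Proof. exact: svalP. Qed.

End KernelChoice.

Section Abelian.
Variable A : abcat.
Implicit Types x y z t w : A.

(** The axiom makes [f] a kernel of some [g]; this [g] factors through [p], so whatever [p] kills is
    killed by [g] and lifts through [f]. *)
Lemma monic_kernel x y (f : homset x y) c (p : homset y c) :
  monic f -> is_cokernel f p -> is_kernel p f.
Proof.
move=> fm fp; have [z [g [gf0 gP]]] := abelian_monic (abpP A) fm.
apply: kernelP => //; first by case: fp.
move=> w h ph0; have [q qp] := cokernel_lift fp gf0.
by apply: (@kernel_lift _ _ _ g) => //; rewrite -qp -cmpA ph0 cmpm0.
Qed.

Lemma epic_cokernel x y (f : homset x y) k (i : homset k x) :
  epic f -> is_kernel f i -> is_cokernel i f.
Proof.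
move=> fe fi; have [z [g [gf0 gP]]] := abelian_epic (abpP A) fe.
apply: cokernelP => //; first by case: fi.
move=> w h ph0; have [q qp] := kernel_lift fi gf0.
by apply: (@cokernel_lift _ _ _ g) => //; rewrite -qp cmpA ph0 cmp0m.
Qed.

Lemma monic_epic_iso x y (f : homset x y) : monic f -> epic f -> is_iso f.
Proof.
move=> fm fe; have fP := monic_kernel fm (koutP f).
have p0 : kout f = 0 by apply/(epicP f).1 => //; case: (koutP f).
have [g fg] : exists g, f ∘ g = idm y.
  by apply: (kernel_lift fP); rewrite p0 cmp0m.
by exists g; split=> //; apply: fm; rewrite cmpA fg cmp1m cmpm1.
Qed.

Lemma short_exact_cokernel x y z (i : homset x y) (p : homset y z) :
  short_exact i p -> is_cokernel i p.
Proof. by move=> [ip pe]; apply: epic_cokernel. Qed.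

Lemma kout_short_exact x y (f : homset x y) : monic f -> short_exact f (kout f).
Proof.
move=> fm; split; first exact: monic_kernel (koutP f).
exact: cokernel_epic (koutP f).
Qed.

(* Generalised elements: a map [t -> y] lifts through an epimorphism
   [x -> y] after passing to a cover, i.e. an epimorphism [t' -> t]. *)
Lemma epic_cover x y t (e : homset x y) (a : homset t y) : epic e ->
  exists t' (c : homset t' t) (b : homset t' x), epic c /\ e ∘ b = a ∘ c.
Proof.
(* [ker u] is the pullback of [e] and [a]. Its projection to [t] is epic: if [g] kills it, then
   [g ∘ bsnd] factors through the epimorphism [u] as [h ∘ u], and restriction to the summand [x]
   gives [h = 0]. *)
move=> ee; pose u := e ∘ bfst - a ∘ bsnd : homset (bsum x t) y.
have ui : u ∘ binl = e by rewrite /u; cmp_norm; rewrite subr0.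
have ue : epic u by apply: (@epic_cmpl _ _ _ _ u binl); rewrite ui.
exists (ker u), (bsnd ∘ kin u), (bfst ∘ kin u); split; last first.
  apply/subr0_eq; have [<- _] := kinP u; rewrite /u.
  by cmp_norm.
apply/epicP => w g g0.
have [h hu] : exists h, h ∘ u = g ∘ bsnd.
  by apply: (cokernel_lift (epic_cokernel ue (kinP u))); rewrite -cmpA.
have : h = 0.
  apply: ((epicP e).1 ee); rewrite -ui cmpA hu; by cmp_norm.
move=> h0; move: hu; rewrite h0 cmp0m => /(congr1 (fun k => k ∘ binr)).
by cmp_norm.
Qed.

(* Only [ker g <= im f]: [g ∘ f = 0] is not part of the definition. *)
Definition exact x y z (f : homset x y) (g : homset y z) :=
  forall t (b : homset t y), g ∘ b = 0 ->
  exists t' (c : homset t' t) (a : homset t' x), epic c /\ f ∘ a = b ∘ c.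

(** The factor [e] of [f] through [ker p] has to be epic. If [g] kills [e], then [f] factors through
    the monomorphism [m] from [ker g], so the cokernel of [m] factors through [p]; hence [m]
    contains [ker p], [kin g] has a right inverse and [g = 0]. *)
Lemma cokernel_exact x y z (f : homset x y) (p : homset y z) :
  is_cokernel f p -> exact f p.
Proof.
move=> fp t b pb0.
have [e ke] : exists e, kin p ∘ e = f by apply: (kernel_lift (kinP p)); case: fp.
have [b' kb'] := kernel_lift (kinP p) pb0.
suff ee : epic e.
  have [t' [c [a [ce ea]]]] := epic_cover b' ee.
  by exists t', c, a; split=> //; rewrite -ke -cmpA ea cmpA kb'.
apply/epicP => w g ge0.
have [e' e'P] := kernel_lift (kinP g) ge0.
pose m := kin p ∘ kin g.
have mm : monic m.
  by apply: monic_cmp; [exact: kernel_monic (kinP p)|exact: kernel_monic (kinP g)].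
have mP := monic_kernel mm (koutP m).
have [u uP] : exists u, u ∘ p = kout m.
  apply: (cokernel_lift fp); rewrite -ke -e'P cmpA cmpA -[_ ∘ _ ∘ kin g]cmpA -/m.
  by case: (koutP m) => -> _; rewrite cmp0m.
have [v vP] : exists v, m ∘ v = kin p.
  by apply: (kernel_lift mP); rewrite -uP -cmpA; case: (kinP p) => -> _; rewrite cmpm0.
have gv : kin g ∘ v = idm (ker p).
  by have pm := kernel_monic (kinP p); apply: pm; rewrite cmpm1 -{2}vP /m cmpA.
by rewrite -[g]cmpm1 -gv cmpA; case: (kinP g) => -> _; rewrite cmp0m.
Qed.

Lemma epic_covers x y (f : homset x y) :
  (exists t' (c : homset t' y) (a : homset t' x), epic c /\ f ∘ a = c) -> epic f.
Proof. by move=> [t' [c [a [ce fa]]]]; apply: (@epic_cmpl _ _ _ _ f a); rewrite fa. Qed.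

Lemma epic_factor x y z (e : homset x y) (f : homset x z) : epic e ->
  (forall t (a : homset t x), e ∘ a = 0 -> f ∘ a = 0) -> exists g, g ∘ e = f.
Proof.
move=> ee ef; apply: (cokernel_lift (epic_cokernel ee (kinP e))).
by apply: ef; case: (kinP e).
Qed.

(** A lift that exists only on a cover [c] descends: since [i] is monic, the lift [a] kills whatever
    [c] kills. *)
Lemma short_exactP x y z (i : homset x y) (p : homset y z) :
  p ∘ i = 0 -> monic i -> epic p -> exact i p -> short_exact i p.
Proof.
move=> pi0 im pe ip; split=> //; apply: kernelP => // w g g0.
have [t [c [a [ce ia]]]] := ip _ _ g0.
have [h hc] : exists h, h ∘ c = a.
  apply: epic_factor => // s b cb0; apply: (im); rewrite cmpA ia -cmpA cb0.
  by rewrite !cmpm0.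
by exists h; apply: ce; rewrite -cmpA hc.
Qed.

End Abelian.

(** * Functor categories and quiver representations *)

Section FunctorAbelian.
Variables (C : category) (A : abcat).
Local Notation FC := (functor_preadditive C A).

Lemma app_eq (F G : FC) (s t : homset F G) : s = t -> forall x, app s x = app t x.
Proof. by move=> ->. Qed.

Section Pointwise.
Variables (F G H : FC) (s : homset F G) (t : homset G H).

Lemma pointwise_kernel : (forall x, is_kernel (app t x) (app s x)) -> is_kernel t s.
Proof.
move=> sP; apply: kernelP.
- by apply: nat_transP => x /=; case: (sP x).
- move=> K g h gh; apply: nat_transP => x; apply: (kernel_monic (sP x)).
  exact: (app_eq gh x).
move=> K g tg0.
have hP x : exists h, app s x ∘ h = app g x.
  apply: (kernel_lift (sP x)).
  exact: (app_eq tg0 x).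
have [h hE] := dep_choice hP; unshelve eexists (@NatTrans C A K F h _).
  move=> x y f; apply: (kernel_monic (sP y)).
  by rewrite cmpA hE naturality [RHS]cmpA naturality -cmpA hE.
exact: nat_transP.
Qed.

Lemma pointwise_cokernel :
  (forall x, is_cokernel (app s x) (app t x)) -> is_cokernel s t.
Proof.
move=> tP; apply: cokernelP.
- by apply: nat_transP => x /=; case: (tP x).
- move=> K g h gh; apply: nat_transP => x; apply: (cokernel_epic (tP x)).
  exact: (app_eq gh x).
move=> K g tg0.
have hP x : exists h, h ∘ app t x = app g x.
  apply: (cokernel_lift (tP x)).
  exact: (app_eq tg0 x).
have [h hE] := dep_choice hP; unshelve eexists (@NatTrans C A H K h _).
  move=> x y f; apply: (cokernel_epic (tP x)).
  by rewrite -cmpA -naturality cmpA hE -[RHS]cmpA hE naturality.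
exact: nat_transP.
Qed.

End Pointwise.

Section KernelFunctor.
Variables (F G : FC) (s : homset F G).

Fact ker_map_ex (x y : C) (f : homset x y) :
  exists h, kin (app s y) ∘ h = fmap F f ∘ kin (app s x).
Proof.
apply: (kernel_lift (kinP _)).
by rewrite cmpA naturality -cmpA; case: (kinP (app s x)) => -> _; rewrite cmpm0.
Qed.

Fact coker_map_ex (x y : C) (f : homset x y) :
  exists h, h ∘ kout (app s x) = kout (app s y) ∘ fmap G f.
Proof.
apply: (cokernel_lift (koutP _)).
by rewrite -cmpA -naturality cmpA; case: (koutP (app s y)) => -> _; rewrite cmp0m.
Qed.

Lemma pointwise_kernel_ex : exists (K : FC) (i : homset K F),
  forall x, is_kernel (app s x) (app i x).
Proof.
pose m x y (f : homset x y) := sval (cid (ker_map_ex f)).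
have mE x y f : kin (app s y) ∘ @m x y f = fmap F f ∘ kin (app s x).
  exact: svalP (cid (ker_map_ex f)).
have kinI x := kernel_monic (kinP (app s x)).
have m1 x : m x x (idm x) = idm _.
  by apply: (kinI x); rewrite mE fmap1 cmp1m cmpm1.
have mM x y z (g : homset y z) (f : homset x y) : m x z (g ∘ f) = m y z g ∘ m x y f.
  by apply: (kinI z); rewrite mE fmapM cmpA mE -!cmpA mE.
exists (Functor m1 mM).
unshelve eexists (@NatTrans C A (Functor m1 mM) F (fun x => kin (app s x)) _).
  by move=> x y f /=; rewrite mE.
by move=> x; apply: kinP.
Qed.

Lemma pointwise_cokernel_ex : exists (K : FC) (p : homset G K),
  forall x, is_cokernel (app s x) (app p x).
Proof.
pose m x y (f : homset x y) := sval (cid (coker_map_ex f)).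
have mE x y f : @m x y f ∘ kout (app s x) = kout (app s y) ∘ fmap G f.
  exact: svalP (cid (coker_map_ex f)).
have koutI x := cokernel_epic (koutP (app s x)).
have m1 x : m x x (idm x) = idm _.
  by apply: (koutI x); rewrite mE fmap1 cmp1m cmpm1.
have mM x y z (g : homset y z) (f : homset x y) : m x z (g ∘ f) = m y z g ∘ m x y f.
  by apply: (koutI x); rewrite mE fmapM -cmpA mE !cmpA mE.
exists (Functor m1 mM).
unshelve eexists (@NatTrans C A G (Functor m1 mM) (fun x => kout (app s x)) _).
  by move=> x y f /=; rewrite mE.
by move=> x; apply: koutP.
Qed.

(** The pointwise kernel is itself a functor with a map [i] to [F], and [s ∘ i = 0]; cancelling [s]
    shows that [i] vanishes at every object. *)
Lemma pointwise_monic : monic s -> forall x, monic (app s x).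
Proof.
move=> sm x; have [K [i iP]] := pointwise_kernel_ex.
have i0 : i = 0.
  apply: (monicP s).1 => //; apply: nat_transP => y /=.
  by case: (iP y).
apply/monicP => w g sg0.
by have [h <-] := kernel_lift (iP x) sg0; rewrite i0 cmp0m.
Qed.

Lemma pointwise_epic : epic s -> forall x, epic (app s x).
Proof.
move=> se x; have [K [p pP]] := pointwise_cokernel_ex.
have p0 : p = 0.
  apply: (epicP s).1 => //; apply: nat_transP => y /=.
  by case: (pP y).
apply/epicP => w g gs0.
by have [h <-] := cokernel_lift (pP x) gs0; rewrite p0 cmpm0.
Qed.

Lemma monic_pointwise : (forall x, monic (app s x)) -> monic s.
Proof.
move=> sm K g h gh; apply: nat_transP => x; apply: (sm x).
exact: (app_eq gh x).
Qed.

Lemma epic_pointwise : (forall x, epic (app s x)) -> epic s.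
Proof.
move=> sm K g h gh; apply: nat_transP => x; apply: (sm x).
exact: (app_eq gh x).
Qed.

End KernelFunctor.

Lemma functor_abelian : is_abelian FC.
Proof.
split.
- have z1 (x : C) : 0 = idm (zob A) by apply/esym/zero_to/zobP.
  have zM (x y z : C) (g : homset y z) (f : homset x y) :
    0 = (0 : homset (zob A) (zob A)) ∘ (0 : homset (zob A) (zob A)) by rewrite cmpm0.
  exists (@Functor C A (fun=> zob A) (fun _ _ _ => 0) z1 zM).
  apply/zero_id; apply: nat_transP => x /=; exact/zero_to/zobP.
- move=> F G.
  pose m x y (f : homset x y) := binl ∘ (fmap F f ∘ bfst) + binr ∘ (fmap G f ∘ bsnd).
  have m1 x : m x x (idm x) = idm _ by rewrite /m !fmap1 !cmp1m bsum_id.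
  have mM x y z (g : homset y z) (f : homset x y) : m x z (g ∘ f) = m y z g ∘ m x y f.
    rewrite /m !fmapM; apply: bsum_mapP;
      by do 3!rewrite -?cmpA ?(cmpE, bsumE) ?addr0 ?add0r.
  exists (Functor m1 mM).
  unshelve eexists (@NatTrans C A F (Functor m1 mM) (fun x => binl) _).
    by move=> x y f; rewrite /= /m; cmp_norm; rewrite ?addr0 ?cmpm1.
  unshelve eexists (@NatTrans C A G (Functor m1 mM) (fun x => binr) _).
    by move=> x y f; rewrite /= /m; cmp_norm; rewrite ?add0r ?cmpm1.
  unshelve eexists (@NatTrans C A (Functor m1 mM) F (fun x => bfst) _).
    by move=> x y f; rewrite /= /m; cmp_norm; rewrite ?addr0.
  unshelve eexists (@NatTrans C A (Functor m1 mM) G (fun x => bsnd) _).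
    by move=> x y f; rewrite /= /m; cmp_norm; rewrite ?add0r.
  split; apply: nat_transP => x /=;
    by rewrite ?fst_inl ?snd_inr ?fst_inr ?snd_inl ?bsum_id.
- move=> F G s; have [K [i iP]] := pointwise_kernel_ex s.
  by exists K, i; apply: pointwise_kernel.
- move=> F G s; have [K [i iP]] := pointwise_cokernel_ex s.
  by exists K, i; apply: pointwise_cokernel.
- move=> F G s sm; have [K [i iP]] := pointwise_cokernel_ex s.
  exists K, i; apply: pointwise_kernel => x.
  exact/monic_kernel/iP/pointwise_monic.
- move=> F G s sm; have [K [i iP]] := pointwise_kernel_ex s.
  exists K, i; apply: pointwise_cokernel => x.
  exact/epic_cokernel/iP/pointwise_epic.
Qed.

Canonical fun_abcat : abcat := AbCat functor_abelian.

Lemma kernel_pointwise (F G H : FC) (s : homset F G) (t : homset G H) :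
  is_kernel t s -> forall x, is_kernel (app t x) (app s x).
Proof.
move=> sP x; have [K [i iP]] := pointwise_kernel_ex t.
have ti0 : t ∘ i = 0 by have [] := pointwise_kernel iP.
have [h hE] := kernel_lift sP ti0.
apply: kernelP.
- exact: (app_eq (proj1 sP) x).
- exact/pointwise_monic/kernel_monic/sP.
move=> w g /(kernel_lift (iP x)) [l <-]; exists (app h x ∘ l).
by rewrite cmpA -[app s x ∘ _]/(app (s ∘ h : homset K G) x) hE.
Qed.

Lemma short_exact_pointwise (F G H : FC) (s : homset F G) (t : homset G H) :
  short_exact s t -> forall x, short_exact (app s x) (app t x).
Proof. by move=> [st te] x; split; [apply: kernel_pointwise|apply: pointwise_epic]. Qed.

End FunctorAbelian.

Section QuiverRep.
Variables (Q : finite_quiver) (A : preadditive).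

Definition arrow_path (a : arrow Q) :
  homset (qtail a : path_category Q) (qhead a : path_category Q) :=
  path_snoc (path_nil (qtail a)).

Section Build.
Variables (o : vertex Q -> A)
  (m : forall a : arrow Q, homset (o (qtail a)) (o (qhead a))).

Fixpoint path_map (i j : vertex Q) (p : qpath i j) : homset (o i) (o j) :=
  match p with
  | path_nil => idm (o i)
  | path_snoc a p' => m a ∘ path_map p'
  end.

(* The path category is free: a representation is given by its arrows. *)
Definition quiver_rep : functor (path_category Q) A.
Proof.
refine (@Functor (path_category Q) A o path_map (fun=> erefl) _).
move=> i j k q p; elim: q => /= [|a q IH]; first by rewrite cmp1m.
by rewrite IH cmpA.
Defined.

Lemma quiver_rep_arrow (a : arrow Q) : fmap quiver_rep (arrow_path a) = m a.
Proof. by rewrite /= cmpm1. Qed.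

End Build.

Lemma quiver_naturality (F G : functor (path_category Q) A)
    (s : forall i : path_category Q, homset (F i) (G i)) :
  (forall a, s (qhead a) ∘ fmap F (arrow_path a) = fmap G (arrow_path a) ∘ s (qtail a)) ->
  forall (i j : path_category Q) (p : homset i j), s j ∘ fmap F p = fmap G p ∘ s i.
Proof.
move=> sP i j; elim=> [|a p IH].
  by rewrite -[path_nil i]/(@idm (path_category Q) i) !fmap1 cmpm1 cmp1m.
rewrite -[path_snoc p]/(@cmp (path_category Q) _ _ _ (arrow_path a) p).
by rewrite !fmapM cmpA sP -cmpA IH cmpA.
Qed.

Definition quiver_nat (F G : functor (path_category Q) A)
    (s : forall i : path_category Q, homset (F i) (G i))
    (sP : forall a,
       s (qhead a) ∘ fmap F (arrow_path a) = fmap G (arrow_path a) ∘ s (qtail a)) :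
  nat_trans F G := NatTrans (quiver_naturality sP).

End QuiverRep.

(** * Localization by left fractions *)

Section Localization.
Variables (C : category) (W : forall x y : C, homset x y -> Prop).
Local Notation qL := (fmap (loc_functor W)).

(** The case of a formal inverse is stated through the composite [qL s ∘ a], so that no name for the
    inverse of [qL s] is needed. *)
Lemma loc_ind (x : C) (P : forall y : C, homset (x : localization W) y -> Prop) :
  P x (idm _) ->
  (forall (y z : C) (f : homset y z) a, P y a -> P z (qL f ∘ a)) ->
  (forall (y z : C) (s : homset z y) (a : homset (x : localization W) z),
     W s -> P y (qL s ∘ a) -> P z a) ->
  forall y a, P y a.
Proof.
move=> P0 Pf Pb y a; rewrite -[a]loc_class_repr; elim: (repr a) => {y a}//.
  move=> y z f p IH; have -> : loc_class (zz_fwd f p) = qL f ∘ (loc_class p).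
    by rewrite /= loc_cmpE.
  exact: Pf.
move=> y z s Ws p IH; apply: (Pb _ _ s) => //.
suff -> : qL s ∘ loc_class (zz_bwd Ws p) = loc_class p by [].
by rewrite /= loc_cmpE; apply/loc_classP/zz_bwdK.
Qed.

Lemma loc_iso (x y : C) (s : homset x y) : W s -> is_iso (qL s).
Proof.
move=> Ws; exists (loc_class (zz_bwd Ws (zz_nil W y))); split=> /=.
  by rewrite loc_cmpE; apply/loc_classP/zz_fwdK.
by rewrite loc_cmpE; apply/loc_classP/zz_bwdK.
Qed.

Section Lift.
Variables (E : category) (G : functor C E).
Hypothesis GW : forall (x y : C) (s : homset x y), W s -> is_iso (fmap G s).

Fixpoint zz_eval (x y : C) (p : zigzag W x y) : homset (G x) (G y) :=
  match p with
  | zz_nil => idm (G x)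
  | zz_fwd _ _ f p' => fmap G f ∘ zz_eval p'
  | zz_bwd _ _ _ Ws p' => sval (cid (GW Ws)) ∘ zz_eval p'
  end.

Lemma zz_eval_eq (x y : C) (p q : zigzag W x y) : zz_eq p q -> zz_eval p = zz_eval q.
Proof.
elim=> //= {y p q}.
- by move=> y p q r _ -> _ ->.
- by move=> y z f p q _ ->.
- by move=> y z f Ws p q _ ->.
- by move=> y p; rewrite fmap1 cmp1m.
- by move=> y z w g f p; rewrite fmapM cmpA.
- by move=> y z s Ws p; case: (cid _) => t [_ st] /=; rewrite cmpA st cmp1m.
- by move=> y z s Ws p; case: (cid _) => t [ts _] /=; rewrite cmpA ts cmp1m.
Qed.

Lemma zz_eval_cat (x y z : C) (q : zigzag W y z) (p : zigzag W x y) :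
  zz_eval (zz_cat q p) = zz_eval q ∘ zz_eval p.
Proof.
elim: q => /= [|w z' f q ->|w z' f Ws q ->]; first by rewrite cmp1m.
all: by rewrite cmpA.
Qed.

Lemma loc_class_eval (x y : C) (p : zigzag W x y) :
  zz_eval (repr (loc_class p)) = zz_eval p.
Proof. by apply: zz_eval_eq; apply/loc_classP; rewrite loc_class_repr. Qed.

Definition loc_lift : functor (localization W) E.
Proof.
refine (@Functor (localization W) E G (fun _ _ a => zz_eval (repr a)) _ _).
- by move=> x; rewrite loc_class_eval.
- by move=> x y z g f; rewrite loc_class_eval zz_eval_cat.
Defined.

Lemma loc_liftE (x y : C) (f : homset x y) : fmap loc_lift (qL f) = fmap G f.
Proof. by rewrite /= loc_class_eval /= cmpm1. Qed.

End Lift.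

Section LeftFractions.
(* The calculus of left fractions holds for complexes only up to a congruence,
   namely chain homotopy. *)
Variable eqv : forall x y : C, homset x y -> homset x y -> Prop.
Local Notation "f ~ g" := (eqv f g) (at level 70).
Hypothesis eqv_refl : forall (x y : C) (f : homset x y), f ~ f.
Hypothesis eqv_sym : forall (x y : C) (f g : homset x y), f ~ g -> g ~ f.
Hypothesis eqv_trans : forall (x y : C) (f g h : homset x y), f ~ g -> g ~ h -> f ~ h.
Hypothesis eqvl : forall (x y z : C) (f f' : homset x y) (g : homset y z),
  f ~ f' -> (g ∘ f) ~ (g ∘ f').
Hypothesis eqvr : forall (x y z : C) (f : homset x y) (g g' : homset y z),
  g ~ g' -> (g ∘ f) ~ (g' ∘ f).
Hypothesis W_id : forall x : C, W (idm x).
Hypothesis W_cmp : forall (x y z : C) (g : homset y z) (f : homset x y),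
  W g -> W f -> W (g ∘ f).
Hypothesis W_eqv : forall (x y : C) (f g : homset x y), f ~ g -> W f -> W g.
Hypothesis ore : forall (x y v : C) (s : homset x y) (g : homset x v), W s ->
  exists (u : C) (g' : homset y u) (s' : homset v u), W s' /\ (g' ∘ s) ~ (s' ∘ g).
Hypothesis cancel : forall (x y z : C) (s : homset x y) (f g : homset y z), W s ->
  (f ∘ s) ~ (g ∘ s) -> exists (u : C) (t : homset z u), W t /\ (t ∘ f) ~ (t ∘ g).
Hypothesis eqv_loc : forall (x y : C) (f g : homset x y), f ~ g -> qL f = qL g.

Record roof (x y : C) := Roof {
  apex : C;
  rnum : homset x apex;
  rden : homset y apex;
  rdenW : W rden
}.

Definition roof_eq (x y : C) (r r' : roof x y) : Prop :=
  exists (u : C) (a : homset (apex r) u) (a' : homset (apex r') u),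
    [/\ W (a ∘ rden r), (a ∘ rden r) ~ (a' ∘ rden r') & (a ∘ rnum r) ~ (a' ∘ rnum r')].

(** A roof stands for the fraction [rden^-1 ∘ rnum], and [r'] then represents its composite with
    [f]. This is a relation because the Ore square behind it is merely chosen. *)
Definition completes (x y z : C) (r : roof x y) (f : homset y z) (r' : roof x z) : Prop :=
  exists a : homset (apex r) (apex r'),
    (a ∘ rden r) ~ (rden r' ∘ f) /\ (a ∘ rnum r) ~ rnum r'.

Lemma roof_eq_refl (x y : C) (r : roof x y) : roof_eq r r.
Proof.
exists (apex r), (idm _), (idm _); split=> //.
by rewrite cmp1m; apply: rdenW.
Qed.

Lemma roof_eq_sym (x y : C) (r r' : roof x y) : roof_eq r r' -> roof_eq r' r.
Proof.
move=> [u [a [a' [Wa e1 e2]]]]; exists u, a', a.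
by split; [apply: W_eqv Wa|apply: eqv_sym|apply: eqv_sym].
Qed.

(** The Ore square joins the two common refinements only after precomposition with [rden r2];
    [cancel] removes this at the price of the extra map [t]. *)
Lemma roof_eq_trans (x y : C) (r2 r1 r3 : roof x y) :
  roof_eq r1 r2 -> roof_eq r2 r3 -> roof_eq r1 r3.
Proof.
move=> [u [a [a' [Wa e1 e2]]]] [v [b [b' [Wb f1 f2]]]].
have Wa' := W_eqv e1 Wa.
have [s [c [c' [Wc' e]]]] := ore (b ∘ rden r2) Wa'.
have := e; rewrite !cmpA => /(cancel (rdenW r2)) [s' [t [Wt te]]].
have Wb' := W_eqv f1 Wb.
have E z (m1 : homset z _) (m2 : homset z _) (m3 : homset z _) :
    (a ∘ m1) ~ (a' ∘ m2) -> (b ∘ m2) ~ (b' ∘ m3) -> (t ∘ c ∘ a ∘ m1) ~ (t ∘ c' ∘ b' ∘ m3).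
  move=> l1 l2.
  have k1 : (t ∘ (c ∘ (a ∘ m1))) ~ (t ∘ (c ∘ (a' ∘ m2))) by do 2!apply: eqvl.
  have k2 : (t ∘ (c ∘ a') ∘ m2) ~ (t ∘ (c' ∘ b) ∘ m2) by apply: eqvr.
  have k3 : (t ∘ (c' ∘ (b ∘ m2))) ~ (t ∘ (c' ∘ (b' ∘ m3))) by do 2!apply: eqvl.
  by rewrite !cmpA in k1 k2 k3 *; apply: eqv_trans k1 (eqv_trans k2 k3).
exists s', (t ∘ c ∘ a), (t ∘ c' ∘ b'); split; [|exact: E e1 f1|exact: E e2 f2].
apply: (W_eqv (eqv_sym (E _ _ _ _ e1 f1))).
by rewrite -!cmpA; do 2!apply: (W_cmp) => //.
Qed.

Lemma completes_eq (x y z : C) (r r' : roof x y) (f : homset y z) (q q' : roof x z) :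
  roof_eq r r' -> completes r f q -> completes r' f q' -> roof_eq q q'.
Proof.
move=> [S [a [a' [Wa e1 e2]]]] [f1 [d1 n1]] [f1' [d1' n1']].
have [Q [c [c' [Wc' ec]]]] := ore (rden q') (rdenW q).
have [Q2 [e [w [Ww ew]]]] := ore (c ∘ rden q ∘ f) Wa.
have h1 : (e ∘ a ∘ rden r) ~ (w ∘ c ∘ f1 ∘ rden r).
  have k : (w ∘ c ∘ (f1 ∘ rden r)) ~ (w ∘ c ∘ (rden q ∘ f)) by apply: eqvl.
  by rewrite !cmpA in ew k *; apply: eqv_trans ew (eqv_sym k).
have h2 : (e ∘ a' ∘ rden r') ~ (w ∘ c' ∘ f1' ∘ rden r').
  have k : (w ∘ c' ∘ (f1' ∘ rden r')) ~ (w ∘ c' ∘ (rden q' ∘ f)) by apply: eqvl.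
  have k' : (w ∘ (c ∘ rden q) ∘ f) ~ (w ∘ (c' ∘ rden q') ∘ f) by apply/eqvr/eqvl.
  have k'' : (e ∘ (a ∘ rden r)) ~ (e ∘ (a' ∘ rden r')) by apply: eqvl.
  rewrite !cmpA in ew k k' k'' *.
  exact: eqv_trans (eqv_sym k'') (eqv_trans ew (eqv_trans k' (eqv_sym k))).
(* So far the comparisons hold only after precomposition with [rden r] and [rden r']; [w2] and [w3]
   cancel these in turn. *)
have [Q3 [w2 [Ww2 g1]]] := cancel (rdenW r) h1.
have [Q4 [w3 [Ww3 g2]]] : exists Q4 (w3 : homset Q3 Q4), W w3 /\
    (w3 ∘ (w2 ∘ (e ∘ a'))) ~ (w3 ∘ (w2 ∘ (w ∘ c' ∘ f1'))).
  by apply: (cancel (rdenW r')); rewrite -!(cmpA w2); apply: eqvl.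
pose W3 := w3 ∘ w2 ∘ w.
have ed : (W3 ∘ c ∘ rden q) ~ (W3 ∘ c' ∘ rden q').
  by rewrite -!cmpA; do 3!apply: eqvl.
exists Q4, (W3 ∘ c), (W3 ∘ c'); split=> //.
  apply: (W_eqv (eqv_sym ed)); rewrite /W3 -!cmpA.
  by do 4!apply: (W_cmp) => //; apply: rdenW.
have k0 : (W3 ∘ c ∘ (f1 ∘ rnum r)) ~ (W3 ∘ c ∘ rnum q) by apply: eqvl.
have k4 : (W3 ∘ c' ∘ (f1' ∘ rnum r')) ~ (W3 ∘ c' ∘ rnum q') by apply: eqvl.
have k1 : (w3 ∘ (w2 ∘ (w ∘ c ∘ f1)) ∘ rnum r) ~ (w3 ∘ (w2 ∘ (e ∘ a)) ∘ rnum r).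
  by apply/eqvr/eqvl/eqv_sym.
have k2 : (w3 ∘ (w2 ∘ (e ∘ a')) ∘ rnum r') ~ (w3 ∘ (w2 ∘ (w ∘ c' ∘ f1')) ∘ rnum r').
  exact: eqvr.
have k3 : (w3 ∘ (w2 ∘ (e ∘ a)) ∘ rnum r) ~ (w3 ∘ (w2 ∘ (e ∘ a')) ∘ rnum r').
  by rewrite -!cmpA; do 3!apply: eqvl.
rewrite /W3 !cmpA in k0 k1 k2 k3 k4 *.
exact: eqv_trans (eqv_sym k0) (eqv_trans k1 (eqv_trans k3 (eqv_trans k2 k4))).
Qed.

Lemma completes_ex (x y z : C) (r : roof x y) (f : homset y z) :
  exists r', completes r f r'.
Proof.
have [u [g' [s' [Ws' e]]]] := ore f (rdenW r).
by exists (Roof (g' ∘ rnum r) Ws'), g'.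
Qed.

Definition complete (x y z : C) (r : roof x y) (f : homset y z) : roof x z :=
  sval (cid (completes_ex r f)).
Lemma completeP (x y z : C) (r : roof x y) (f : homset y z) :
  completes r f (complete r f).
Proof. exact: svalP. Qed.

Fixpoint zz_roof (x y : C) (p : zigzag W x y) : roof x y :=
  match p with
  | zz_nil => Roof (idm x) (W_id x)
  | zz_fwd _ _ f p' => complete (zz_roof p') f
  | zz_bwd _ _ _ Ws p' => Roof (rnum (zz_roof p')) (W_cmp (rdenW (zz_roof p')) Ws)
  end.

(** One case for each generating relation of [zz_eq]. Thus an equality in the localization becomes
    an equality of roofs, from which [fraction_eq] reads off an actual morphism [t] of [C]. *)
Lemma zz_roof_eq (x y : C) (p q : zigzag W x y) :
  zz_eq p q -> roof_eq (zz_roof p) (zz_roof q).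
Proof.
elim=> {y p q} /=.
- by move=> y p; apply: roof_eq_refl.
- by move=> y p q _ /roof_eq_sym.
- by move=> y p q r _ /roof_eq_trans pq _ /pq.
- by move=> y z f p q _ pq; apply: completes_eq pq _ _; apply: completeP.
- move=> y z s Ws p q _ [u [a [a' [Wa e1 e2]]]]; exists u, a, a'; split=> //=.
    by rewrite cmpA; apply: W_cmp.
  by rewrite !cmpA; apply: eqvr.
- move=> y p; apply: (completes_eq (roof_eq_refl _) (completeP _ _)).
  by exists (idm _); rewrite !cmp1m cmpm1; split.
- move=> y z w g f p; apply: (completes_eq (roof_eq_refl _) (completeP _ _)).
  have [a [a1 a2]] := completeP (zz_roof p) f.
  have [b [b1 b2]] := completeP (complete (zz_roof p) f) g.
  exists (b ∘ a); rewrite -!cmpA; split.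
    have k1 : (b ∘ (a ∘ rden (zz_roof p))) ~ (b ∘ (rden (complete (zz_roof p) f) ∘ f)).
      exact: eqvl.
    apply: eqv_trans k1 _; rewrite !cmpA; exact: eqvr.
  have k2 : (b ∘ (a ∘ rnum (zz_roof p))) ~ (b ∘ rnum (complete (zz_roof p) f)).
    exact: eqvl.
  exact: eqv_trans k2 b2.
- move=> y z s Ws p; apply: (completes_eq (roof_eq_refl _) (completeP _ _)).
  by exists (idm _); rewrite !cmp1m /=; split.
- move=> y z s Ws p; apply: roof_eq_sym; have [a [a1 a2]] := completeP (zz_roof p) s.
  exists (apex (complete (zz_roof p) s)), a, (idm _); split=> /=.
  + by apply: (W_eqv (eqv_sym a1)); apply: W_cmp => //; apply: rdenW.
  + by rewrite cmp1m.
  + by rewrite cmp1m.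
Qed.

Lemma fraction_eq (x y : C) (f g : homset x y) : qL f = qL g ->
  exists (u : C) (t : homset y u), W t /\ (t ∘ f) ~ (t ∘ g).
Proof.
move=> /loc_classP /zz_roof_eq /= e.
have fP (h : homset x y) : roof_eq (Roof h (W_id y)) (complete (Roof (idm x) (W_id x)) h).
  apply: (completes_eq (roof_eq_refl _) _ (completeP _ _)).
  by exists h; rewrite /= !cmpm1 cmp1m.
have [u [a [a' [/= Wa e1 e2]]]] :=
  roof_eq_trans (fP f) (roof_eq_trans e (roof_eq_sym (fP g))).
rewrite cmpm1 in Wa; exists u, a; split=> //; apply: eqv_trans e2 _; apply: eqvr.
by move: e1; rewrite !cmpm1 => /eqv_sym.
Qed.

Lemma fraction_ex (x y : C) (a : homset (x : localization W) y) :
  exists (v : C) (f : homset x v) (t : homset y v), W t /\ qL t ∘ a = qL f.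
Proof.
elim/loc_ind: y / a => [|y z f a [v [g [t [Wt ta]]]]|y z s a Ws [v [g [t [Wt ta]]]]].
- by exists x, (idm x), (idm x); split; rewrite // fmap1 cmp1m.
- have [u [f' [t' [Wt' e]]]] := ore f Wt.
  exists u, (f' ∘ g), t'; split=> //.
  by rewrite cmpA -fmapM -(eqv_loc e) !fmapM -cmpA ta.
- by exists v, g, (t ∘ s); split; [apply: W_cmp|rewrite fmapM -cmpA ta].
Qed.

End LeftFractions.
End Localization.

(** * Complexes and the derived category *)

Section Cohomology.
Variable A : abcat.
Implicit Types (X Y Z : complex A) (n : int).

Lemma int_succ (P : int -> Prop) : (forall n : int, P (n + 1)) -> forall n, P n.
Proof. by move=> PS n; rewrite -(subrK 1 n). Qed.

Lemma cdiff0 X n (t : A) (a : homset t (X n)) :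
  cdiff X (n + 1) ∘ (cdiff X n ∘ a) = 0.
Proof. by rewrite cmpA cdiffK cmp0m. Qed.

Lemma cmap_cdiff X Y (f : chain_map X Y) n (t : A) (a : homset t (X n)) :
  f (n + 1) ∘ (cdiff X n ∘ a) = cdiff Y n ∘ (f n ∘ a).
Proof. by rewrite cmpA cmap_diff cmpA. Qed.

(* [a] is the class of the cocycle [x] in a presentation of cohomology. *)
Definition coh_class X n (H : cohomology X n) (t : A)
    (x : homset t (X (n + 1))) (a : homset t (cohom H)) : Prop :=
  exists z, incl H ∘ z = x /\ proj H ∘ z = a.

Arguments coh_class {X n} H {t} x a.

Section Classes.
Variables (X : complex A) (n : int) (H : cohomology X n).

Lemma coh_class_cocycle (t : A) (x : homset t (X (n + 1))) a :
  coh_class H x a -> cdiff X (n + 1) ∘ x = 0.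
Proof. by move=> [z [<- _]]; rewrite cmpA (proj1 (inclP H)) cmp0m. Qed.

Lemma coh_class_ex (t : A) (x : homset t (X (n + 1))) :
  cdiff X (n + 1) ∘ x = 0 -> exists a : homset t (cohom H), coh_class H x a.
Proof. by move=> /(kernel_lift (inclP H)) [z zx]; exists (proj H ∘ z), z. Qed.

Lemma coh_class_fun (t : A) (x : homset t (X (n + 1))) a b :
  coh_class H x a -> coh_class H x b -> a = b.
Proof.
move=> [z [<- <-]] [z' [zz' <-]]; congr (_ ∘ _).
by have im := kernel_monic (inclP H); apply: im.
Qed.

Lemma coh_class_cmp (t t' : A) (c : homset t' t) (x : homset t (X (n + 1))) a :
  coh_class H x a -> coh_class H (x ∘ c) (a ∘ c).
Proof. by move=> [z [<- <-]]; exists (z ∘ c); rewrite !cmpA. Qed.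

Lemma coh_class_cover (t : A) (a : homset t (cohom H)) :
  exists t' (c : homset t' t) x, epic c /\ coh_class H x (a ∘ c).
Proof.
have [t' [c [z [ce zc]]]] := epic_cover a (cokernel_epic (projP H)).
by exists t', c, (incl H ∘ z); split=> //; exists z.
Qed.

Lemma coh_class_bound (t : A) (y : homset t (X n)) : coh_class H (cdiff X n ∘ y) 0.
Proof.
exists (cobound H ∘ y); split; first by rewrite cmpA coboundP.
by rewrite cmpA (proj1 (projP H)) cmp0m.
Qed.

Lemma coh_class_zero (t : A) (x : homset t (X (n + 1))) : coh_class H x 0 ->
  exists t' (c : homset t' t) y, epic c /\ cdiff X n ∘ y = x ∘ c.
Proof.
move=> [z [<- /(cokernel_exact (projP H)) [t' [c [y [ce yz]]]]]].
by exists t', c, y; split=> //; rewrite -(coboundP H) -!cmpA yz.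
Qed.

Lemma coh_class_sub (t : A) (x x' : homset t (X (n + 1))) a a' :
  coh_class H x a -> coh_class H x' a' -> coh_class H (x - x') (a - a').
Proof. by move=> [z [<- <-]] [z' [<- <-]]; exists (z - z'); rewrite !cmpBr. Qed.

Lemma coh_class_ext (w : A) (h h' : homset (cohom H) w) :
  (forall t (x : homset t (X (n + 1))) a, coh_class H x a -> h ∘ a = h' ∘ a) -> h = h'.
Proof.
move=> hh'; have [t [c [x [ce]]]] := coh_class_cover (idm (cohom H)).
by rewrite cmp1m => /hh'; apply: ce.
Qed.

End Classes.

Definition coh_induces X Y (f : chain_map X Y) n (HX : cohomology X n)
    (HY : cohomology Y n) (h : homset (cohom HX) (cohom HY)) : Prop :=
  forall (t : A) (x : homset t (X (n + 1))) a,
    coh_class HX x a -> coh_class HY (f (n + 1) ∘ x) (h ∘ a).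
Arguments coh_induces {X Y} f {n} HX HY h.

Lemma induced_coh X Y (f : chain_map X Y) n (HX : cohomology X n)
    (HY : cohomology Y n) h : induced_on_cohomology f h -> coh_induces f HX HY h.
Proof.
move=> [z [z1 z2]] t x a [u [<- <-]]; exists (z ∘ u).
by rewrite cmpA z1 -cmpA; split=> //; rewrite !cmpA z2.
Qed.

Lemma induced_ex X Y (f : chain_map X Y) n (HX : cohomology X n)
    (HY : cohomology Y n) : exists h, @induced_on_cohomology _ _ _ f n HX HY h.
Proof.
have [z zP] : exists z, incl HY ∘ z = f (n + 1) ∘ incl HX.
  apply: (kernel_lift (inclP HY)); rewrite cmpA -cmap_diff -cmpA.
  by rewrite (proj1 (inclP HX)) cmpm0.
have [h hP] : exists h, h ∘ proj HX = proj HY ∘ z.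
  apply: (cokernel_lift (projP HX)).
  suff -> : proj HY ∘ z ∘ cobound HX = proj HY ∘ (cobound HY ∘ f n).
    by rewrite cmpA (proj1 (projP HY)) cmp0m.
  rewrite -cmpA; congr (_ ∘ _); have im := kernel_monic (inclP HY); apply: im.
  by rewrite !cmpA zP coboundP -cmpA coboundP cmap_diff.
by exists h, z.
Qed.

Lemma cohomology_ex X n : exists _ : cohomology X n, True.
Proof.
have [b bP] : exists b, kin (cdiff X (n + 1)) ∘ b = cdiff X n.
  exact: (kernel_lift (kinP _) (cdiffK X n)).
by exists (Cohomology (kinP _) bP (koutP b)).
Qed.

Definition coh X n : cohomology X n := sval (cid (cohomology_ex X n)).
Definition coh_map X Y (f : chain_map X Y) n : homset (cohom (coh X n)) (cohom (coh Y n)) :=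
  sval (cid (induced_ex f (coh X n) (coh Y n))).
Lemma coh_map_induced X Y (f : chain_map X Y) n : induced_on_cohomology f (coh_map f n).
Proof. exact: svalP (cid (induced_ex f (coh X n) (coh Y n))). Qed.
Lemma coh_mapP X Y (f : chain_map X Y) n : coh_induces f (coh X n) (coh Y n) (coh_map f n).
Proof. exact/induced_coh/coh_map_induced. Qed.

Definition coh_functor n : functor (complex_category A) A.
Proof.
refine (@Functor (complex_category A) A (fun X => cohom (coh X n))
  (fun X Y f => coh_map f n) _ _).
- move=> X; apply: coh_class_ext => t x a xa.
  have := coh_mapP (chain_id X) xa; rewrite /= cmp1m => xb.
  by rewrite cmp1m -(coh_class_fun xa xb).
- move=> X Y Z g f; apply: coh_class_ext => t x a xa.
  have := coh_mapP g (coh_mapP f xa); rewrite cmpA => /coh_class_fun xb.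
  by rewrite -cmpA; apply/esym/xb/(coh_mapP (chain_cmp g f)).
Defined.

(** Injectivity on cohomology in degree [n + 1], and likewise surjectivity in [qis_surj], for
    generalised elements. No presentation of the cohomology occurs, which leaves quasi-isomorphisms
    open to diagram chases. *)
Definition qis_inj X Y (f : chain_map X Y) n : Prop :=
  forall (t : A) (x : homset t (X (n + 1))) (y : homset t (Y n)),
    cdiff X (n + 1) ∘ x = 0 -> f (n + 1) ∘ x = cdiff Y n ∘ y ->
    exists t' (c : homset t' t) x', epic c /\ cdiff X n ∘ x' = x ∘ c.

Definition qis_surj X Y (f : chain_map X Y) n : Prop :=
  forall (t : A) (y : homset t (Y (n + 1))), cdiff Y (n + 1) ∘ y = 0 ->
    exists t' (c : homset t' t) x y',
      [/\ epic c, cdiff X (n + 1) ∘ x = 0 & y ∘ c = f (n + 1) ∘ x + cdiff Y n ∘ y'].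

Definition qis X Y (f : chain_map X Y) : Prop := forall n, qis_inj f n /\ qis_surj f n.

Lemma qis_induced X Y (f : chain_map X Y) n (HX : cohomology X n)
    (HY : cohomology Y n) h :
  qis_inj f n -> qis_surj f n -> coh_induces f HX HY h -> is_iso h.
Proof.
move=> fi fs hP; apply: monic_epic_iso.
  apply/monicP => w a ha0; have [t [c [x [ce xa]]]] := coh_class_cover a.
  have := hP _ _ _ xa; rewrite cmpA ha0 cmp0m => /coh_class_zero [t' [c' [y [c'e yx]]]].
  have [||t2 [c2 [x' [c2e x'x]]]] := fi t' (x ∘ c') y.
  - by rewrite cmpA (coh_class_cocycle xa) cmp0m.
  - by rewrite yx cmpA.
  have := coh_class_cmp c2 (coh_class_cmp c' xa); rewrite -x'x.
  move=> /(coh_class_fun (coh_class_bound HX x')) /esym; rewrite -!cmpA => e.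
  by have ce' := epic_cmp ce (epic_cmp c'e c2e); apply: ce'; rewrite e cmp0m.
apply: epic_covers; have [t [c [y [ce ya]]]] := coh_class_cover (idm (cohom HY)).
have [t' [c' [x [y' [c'e dx yE]]]]] := fs t y (coh_class_cocycle ya).
have [a xa] := coh_class_ex HX dx.
exists t', (c ∘ c'), a; split; first exact: epic_cmp.
have := coh_class_sub (coh_class_cmp c' ya) (hP _ _ _ xa).
rewrite yE [_ + _ - _]addrC addKr => /(coh_class_fun (coh_class_bound HY y')) /esym/subr0_eq.
by rewrite cmp1m.
Qed.

Lemma qis_of_iso X Y (f : chain_map X Y) : (forall n, is_iso (coh_map f n)) -> qis f.
Proof.
move=> fiso n; have [g [gf fg]] := fiso n; split.
  move=> t x y dx fx; have [a xa] := coh_class_ex (coh X n) dx.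
  have := coh_mapP f xa; rewrite fx => /(coh_class_fun (coh_class_bound _ y)) fa.
  by apply: (@coh_class_zero _ _ (coh X n)); rewrite (_ : 0 = a)// -[a]cmp1m -gf -cmpA -fa cmpm0.
move=> t y dy; have [b yb] := coh_class_ex (coh Y n) dy.
have [t' [c [x [ce xa]]]] := coh_class_cover (g ∘ b).
have := coh_class_sub (coh_class_cmp c yb) (coh_mapP f xa).
rewrite !cmpA fg cmp1m subrr => /coh_class_zero [t2 [c2 [y' [c2e y'E]]]].
exists t2, (c ∘ c2), (x ∘ c2), y'; split; first exact: epic_cmp.
  by rewrite cmpA (coh_class_cocycle xa) cmp0m.
by rewrite y'E cmpBl !cmpA; zmod.
Qed.

Lemma quasi_iso_coh X Y (f : chain_map X Y) :
  quasi_iso (f : homset (X : complex_category A) Y) <-> forall n, is_iso (coh_map f n).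
Proof.
split=> [fq n|/qis_of_iso fq n HX HY h /induced_coh hP]; first exact/fq/coh_map_induced.
by have [fi fs] := fq n; apply: qis_induced hP.
Qed.

Lemma quasi_isoP X Y (f : chain_map X Y) :
  quasi_iso (f : homset (X : complex_category A) Y) <-> qis f.
Proof.
split=> [/quasi_iso_coh /qis_of_iso //|fq n HX HY h /induced_coh hP].
by have [fi fs] := fq n; apply: qis_induced hP.
Qed.

Definition acyclic X : Prop := forall n, exact (cdiff X n) (cdiff X (n + 1)).

End Cohomology.
Arguments coh_class {A X n} H {t} x a.
Arguments coh_induces {A X Y} f {n} HX HY h.

(** * Chain homotopy *)

Section Homotopy.
Variable A : preadditive.
Implicit Types (X Y Z : complex A) (n : int).

(** Indexing by [n + 1] avoids the degree [n - 1], from which one would return only by a transport;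
    every integer being a successor, no degree is missed. *)
Definition homotopic X Y (f g : chain_map X Y) : Prop :=
  exists h : forall n, homset (X (n + 1)) (Y n),
    forall n, f (n + 1) - g (n + 1) = cdiff Y n ∘ h n + h (n + 1) ∘ cdiff X (n + 1).

Definition chain_zero X Y : chain_map X Y.
Proof. by exists (fun=> 0) => n; rewrite cmpm0 cmp0m. Defined.

Definition chain_sub X Y (f g : chain_map X Y) : chain_map X Y.
Proof. by exists (fun n => f n - g n) => n; rewrite cmpBl cmpBr !cmap_diff. Defined.

Lemma homotopic_refl X Y (f : chain_map X Y) : homotopic f f.
Proof. by exists (fun=> 0) => n; rewrite subrr cmpm0 cmp0m addr0. Qed.

Lemma homotopic_sym X Y (f g : chain_map X Y) : homotopic f g -> homotopic g f.
Proof.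
move=> [h hP]; exists (fun n => - h n) => n.
by rewrite cmpmN cmpNm -opprD -hP opprB.
Qed.

Lemma homotopic_trans X Y (f g k : chain_map X Y) :
  homotopic f g -> homotopic g k -> homotopic f k.
Proof.
move=> [h hP] [h' hP']; exists (fun n => h n + h' n) => n.
by rewrite cmpDr cmpDl addrACA -hP -hP' addrA subrK.
Qed.

Lemma homotopic_cmpl X Y Z (f f' : chain_map X Y) (g : chain_map Y Z) :
  homotopic f f' -> homotopic (chain_cmp g f) (chain_cmp g f').
Proof.
move=> [h hP]; exists (fun n => g n ∘ h n) => n /=.
by rewrite -cmpBr hP cmpDr !cmpA cmap_diff.
Qed.

Lemma homotopic_cmpr X Y Z (f : chain_map X Y) (g g' : chain_map Y Z) :
  homotopic g g' -> homotopic (chain_cmp g f) (chain_cmp g' f).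
Proof.
move=> [h hP]; exists (fun n => h n ∘ f (n + 1)) => n /=.
by rewrite -cmpBl hP cmpDl -!cmpA cmap_diff.
Qed.

Lemma homotopic_sub X Y (f g : chain_map X Y) :
  homotopic f g <-> homotopic (chain_sub f g) (chain_zero X Y).
Proof.
by split=> -[h hP]; exists h => n; have := hP n; rewrite /= subr0.
Qed.

End Homotopy.

(** * Twisted extensions and mapping cones *)

Section Twist.
Variable A : abcat.
Variables (V E : complex A) (tau : forall n : int, homset (E n) (V (n + 1))).
Hypothesis tauP : forall n : int, cdiff V (n + 1) ∘ tau n + tau (n + 1) ∘ cdiff E n = 0.

Definition tw_diff (n : int) : homset (bsum (V n) (E n)) (bsum (V (n + 1)) (E (n + 1))) :=
  binl ∘ (cdiff V n ∘ bfst + tau n ∘ bsnd) + binr ∘ (cdiff E n ∘ bsnd).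

Lemma fst_tw_diff (n : int) (t : A) (x : homset t (bsum (V n) (E n))) :
  bfst ∘ (tw_diff n ∘ x) = cdiff V n ∘ (bfst ∘ x) + tau n ∘ (bsnd ∘ x).
Proof. by rewrite /tw_diff; cmp_norm; rewrite addr0. Qed.

Lemma snd_tw_diff (n : int) (t : A) (x : homset t (bsum (V n) (E n))) :
  bsnd ∘ (tw_diff n ∘ x) = cdiff E n ∘ (bsnd ∘ x).
Proof. by rewrite /tw_diff; cmp_norm; rewrite ?add0r ?addr0. Qed.

Lemma tau_cdiff (n : int) (t : A) (x : homset t (E n)) :
  tau (n + 1) ∘ (cdiff E n ∘ x) = - (cdiff V (n + 1) ∘ (tau n ∘ x)).
Proof. by apply/eqP; rewrite !cmpA -addr_eq0 [eqbLHS]addrC -cmpDl tauP cmp0m. Qed.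

(* The extension of [E] by [V] with differential [[d_V, tau], [0, d_E]]. *)
Definition tw : complex A.
Proof.
exists (fun n => bsum (V n) (E n)) tw_diff.
- move=> n; apply: bsum_mapP; rewrite ?fst_tw_diff ?snd_tw_diff.
    rewrite -[tw_diff n]cmpm1 fst_tw_diff snd_tw_diff tau_cdiff.
    by rewrite cmpDr cdiff0 add0r subrr cmpm0.
  by rewrite -[tw_diff n]cmpm1 snd_tw_diff cdiff0 cmpm0.
- have [N VN] := bounded_below V; have [M EM] := bounded_below E.
  exists (Num.min N M) => n; rewrite lt_min => /andP[/VN V0 /EM E0].
  exact: bsum_zero.
Defined.

Lemma fst_tw (n : int) (t : A) (x : homset t (tw n)) :
  bfst ∘ (cdiff tw n ∘ x) = cdiff V n ∘ (bfst ∘ x) + tau n ∘ (bsnd ∘ x).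
Proof. exact: fst_tw_diff. Qed.

Lemma snd_tw (n : int) (t : A) (x : homset t (tw n)) :
  bsnd ∘ (cdiff tw n ∘ x) = cdiff E n ∘ (bsnd ∘ x).
Proof. exact: snd_tw_diff. Qed.

Definition tw_in : chain_map V tw.
Proof.
exists (fun n => binl) => n; apply: bsum_mapP.
  by rewrite -[binl in LHS]cmpm1 fst_tw cmpm1; cmp_norm; rewrite ?addr0 ?cmpm1.
by rewrite -[binl in LHS]cmpm1 snd_tw cmpm1; cmp_norm.
Defined.

Definition tw_out : chain_map tw E.
Proof. by exists (fun n => bsnd) => n; rewrite -[cdiff tw n]cmpm1 snd_tw cmpm1. Defined.

Section Maps.
Variable Z : complex A.

Fact tw_desc_comm (u : chain_map V Z) (k : forall n, homset (E n) (Z n)) :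
  (forall n : int, k (n + 1) ∘ cdiff E n + u (n + 1) ∘ tau n = cdiff Z n ∘ k n) ->
  forall n : int, (u (n + 1) ∘ bfst + k (n + 1) ∘ bsnd) ∘ cdiff tw n =
    cdiff Z n ∘ (u n ∘ bfst + k n ∘ bsnd).
Proof.
move=> kP n; rewrite -[cdiff tw n]cmpm1 cmpDl -!cmpA fst_tw snd_tw !cmpm1.
rewrite !cmpDr cmap_cdiff [_ ∘ (k n ∘ _)]cmpA -kP cmpDl -!cmpA.
zmod.
Qed.

Definition tw_desc (u : chain_map V Z) k kP : chain_map tw Z :=
  @ChainMap _ tw Z (fun n => u n ∘ bfst + k n ∘ bsnd) (@tw_desc_comm u k kP).

Fact tw_lift_comm (a : forall n, homset (Z n) (V n)) (e : chain_map Z E) :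
  (forall n : int, a (n + 1) ∘ cdiff Z n = cdiff V n ∘ a n + tau n ∘ e n) ->
  forall n : int, (binl ∘ a (n + 1) + binr ∘ e (n + 1)) ∘ cdiff Z n =
    cdiff tw n ∘ (binl ∘ a n + binr ∘ e n).
Proof.
move=> aP n; apply: bsum_mapP; rewrite ?fst_tw ?snd_tw; cmp_norm;
  rewrite ?addr0 ?add0r; [exact: aP|exact: cmap_diff].
Qed.

Definition tw_lift a (e : chain_map Z E) aP : chain_map Z tw :=
  @ChainMap _ Z tw (fun n => binl ∘ a n + binr ∘ e n) (@tw_lift_comm a e aP).

End Maps.

Lemma tw_in_qis : acyclic E -> qis tw_in.
Proof.
move=> Eac n; split.
  (* The element [y] lies in degree [n], and [acyclic] states exactness only at degrees written as
     successors. *)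
  move: n; apply: int_succ => n t x y dx xy.
  have e0 : cdiff E (n + 1) ∘ (bsnd ∘ y) = 0.
    by rewrite -snd_tw -xy /= snd_inl0.
  have [t' [c [e [ce eE]]]] := Eac _ _ _ e0.
  exists t', c, (bfst ∘ y ∘ c - tau n ∘ e); split=> //.
  have -> : x = cdiff V (n + 1) ∘ (bfst ∘ y) + tau (n + 1) ∘ (bsnd ∘ y).
    by rewrite -fst_tw -xy /= fst_inlK.
  rewrite cmpBr cmpDl -!cmpA; congr (_ + _).
  by rewrite [bsnd ∘ _]cmpA -eE tau_cdiff.
move=> t y dy.
have e0 : cdiff E (n + 1) ∘ (bsnd ∘ y) = 0 by rewrite -snd_tw dy cmpm0.
have [t' [c [e [ce eE]]]] := Eac _ _ _ e0.
exists t', c, (bfst ∘ y ∘ c - tau n ∘ e), (binr ∘ e); split=> //=.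
  have e1 : bfst ∘ (cdiff tw (n + 1) ∘ y) ∘ c = 0 by rewrite dy cmpm0 cmp0m.
  move: e1; rewrite fst_tw cmpDl -!cmpA [bsnd ∘ _]cmpA -eE tau_cdiff => e1.
  by rewrite cmpBr.
apply: bsum_mapP; rewrite cmpDr ?fst_tw ?snd_tw; cmp_norm.
  by rewrite add0r subrK.
by rewrite add0r eE cmpA.
Qed.

Lemma tw_out_qis : acyclic V -> qis tw_out.
Proof.
move=> Vac n; split.
  move=> t x y dx; rewrite /= => xy.
  pose v := bfst ∘ x - tau n ∘ y.
  have v0 : cdiff V (n + 1) ∘ v = 0.
    rewrite cmpBr -(opprK (cdiff V _ ∘ (tau _ ∘ _))) -tau_cdiff -xy opprK.
    by rewrite -fst_tw dx cmpm0.
  have [t' [c [w [ce wv]]]] := Vac _ _ _ v0.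
  exists t', c, (binl ∘ w + binr ∘ (y ∘ c)); split=> //.
  apply: bsum_mapP; rewrite ?fst_tw ?snd_tw; cmp_norm; rewrite ?addr0 ?add0r.
    by rewrite wv /v cmpBl -!cmpA subrK.
  by rewrite !cmpA -xy.
move=> t y dy; have v0 : cdiff V (n + 1 + 1) ∘ (tau (n + 1) ∘ y) = 0.
  by apply: oppr_inj; rewrite -tau_cdiff dy cmpm0 oppr0.
have [t' [c [w [ce wv]]]] := Vac _ _ _ v0.
exists t', c, (binr ∘ (y ∘ c) - binl ∘ w), 0; split=> //=.
  apply: bsum_mapP; rewrite ?fst_tw ?snd_tw; cmp_norm; rewrite ?sub0r ?subr0.
    by rewrite ?cmpmN wv cmpA addNr.
  by rewrite cmpA dy cmp0m.
by cmp_norm; rewrite subr0 addr0.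
Qed.

End Twist.
Arguments tw {A V E tau} tauP.
Arguments tw_in {A V E tau} tauP.
Arguments tw_out {A V E tau} tauP.

Section Cone.
Variable A : abcat.
Implicit Types (X Y Z : complex A) (n : int).

Definition sh X : complex A.
Proof.
exists (fun n => X (n + 1)) (fun n => - cdiff X (n + 1)).
- by move=> n; rewrite cmpNm cmpmN opprK cdiffK.
- have [N XN] := bounded_below X; exists (N - 1) => n nN.
  by apply: XN; rewrite -ltrBrDr.
Defined.

Definition sh_map X Y (f : chain_map X Y) : chain_map (sh X) (sh Y).
Proof. by exists (fun n => f (n + 1)) => n /=; rewrite cmpmN cmpNm cmap_diff. Defined.

Lemma sh_acyclic X : acyclic X -> acyclic (sh X).
Proof.
move=> Xac n t b /=; rewrite cmpNm => /eqP; rewrite oppr_eq0 => /eqP /Xac.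
move=> [t' [c [a [ce ab]]]]; exists t', c, (- a); split=> //.
by rewrite cmpNm cmpmN opprK.
Qed.

Fact cone_tau X Y (f : chain_map X Y) n :
  cdiff Y (n + 1) ∘ f (n + 1) + f (n + 1 + 1) ∘ cdiff (sh X) n = 0.
Proof. by rewrite /= cmpmN cmap_diff subrr. Qed.

Definition cone X Y (f : chain_map X Y) : complex A :=
  @tw A Y (sh X) (fun n => f (n + 1)) (cone_tau f).
Definition cone_in X Y (f : chain_map X Y) : chain_map Y (cone f) :=
  @tw_in A Y (sh X) (fun n => f (n + 1)) (cone_tau f).
Definition cone_out X Y (f : chain_map X Y) : chain_map (cone f) (sh X) :=
  @tw_out A Y (sh X) (fun n => f (n + 1)) (cone_tau f).

Lemma fst_cone X Y (f : chain_map X Y) n (t : A) (x : homset t (cone f n)) :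
  bfst ∘ (cdiff (cone f) n ∘ x) = cdiff Y n ∘ (bfst ∘ x) + f (n + 1) ∘ (bsnd ∘ x).
Proof. exact: fst_tw. Qed.

Lemma snd_cone X Y (f : chain_map X Y) n (t : A) (x : homset t (cone f n)) :
  bsnd ∘ (cdiff (cone f) n ∘ x) = - (cdiff X (n + 1) ∘ (bsnd ∘ x)).
Proof. by rewrite /cone snd_tw /= cmpNm. Qed.

Lemma snd_cone_diff X Y (f : chain_map X Y) n :
  bsnd ∘ cdiff (cone f) n = - (cdiff X (n + 1) ∘ bsnd).
Proof. by rewrite -[cdiff (cone f) n]cmpm1 snd_cone cmpm1. Qed.

Lemma cone_diff_inl X Y (f : chain_map X Y) n :
  cdiff (cone f) n ∘ binl = binl ∘ cdiff Y n.
Proof.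
by apply: bsum_mapP; rewrite ?fst_cone ?snd_cone; cmp_norm;
  rewrite ?addr0 ?oppr0 ?cmpm1.
Qed.

Lemma cone_diff_inr X Y (f : chain_map X Y) n :
  cdiff (cone f) n ∘ binr = binl ∘ f (n + 1) - binr ∘ cdiff X (n + 1).
Proof.
by apply: bsum_mapP; rewrite ?fst_cone ?snd_cone; cmp_norm;
  rewrite ?add0r ?subr0 ?sub0r ?cmpm1.
Qed.

Lemma cone_acyclic X Y (f : chain_map X Y) : qis f -> acyclic (cone f).
Proof.
move=> fq n t y dy.
have dx : cdiff X (n + 1 + 1) ∘ (bsnd ∘ y) = 0.
  by apply: oppr_inj; rewrite -snd_cone dy cmpm0 oppr0.
have fx : f (n + 1 + 1) ∘ (bsnd ∘ y) = cdiff Y (n + 1) ∘ (- (bfst ∘ y)).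
  by apply/eqP; rewrite cmpmN -addr_eq0 [eqbLHS]addrC -fst_cone dy cmpm0.
have [t1 [c1 [x [c1e xE]]]] := (fq (n + 1)).1 _ _ _ dx fx.
have dz : cdiff Y (n + 1) ∘ (bfst ∘ y ∘ c1 + f (n + 1) ∘ x) = 0.
  by rewrite cmpDr -cmap_cdiff xE [f _ ∘ _]cmpA fx cmpmN cmpNm -!cmpA subrr.
have [t2 [c2 [x' [y' [c2e dx' zE]]]]] := (fq n).2 _ _ dz.
exists t2, (c1 ∘ c2), (binl ∘ y' + binr ∘ (x' - x ∘ c2)); split; first exact: epic_cmp.
apply: bsum_mapP; rewrite ?fst_cone ?snd_cone; cmp_norm; rewrite ?addr0 ?add0r.
  move: zE; cmp_norm => zE; apply: (addIr (f (n + 1) ∘ (x ∘ c2))).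
  by rewrite zE; zmod.
by rewrite dx' sub0r opprK !cmpA xE.
Qed.

Fact cone_desc_tau X Y Z (s : chain_map X Y) (u : chain_map Y Z)
    (h : forall n, homset (X (n + 1)) (Z n)) :
  (forall n, u (n + 1) ∘ s (n + 1) = cdiff Z n ∘ h n + h (n + 1) ∘ cdiff X (n + 1)) ->
  forall n, h (n + 1) ∘ cdiff (sh X) n + u (n + 1) ∘ s (n + 1) = cdiff Z n ∘ h n.
Proof. by move=> hP n; rewrite hP /= cmpmN; zmod. Qed.

Definition cone_desc X Y Z s u h hP : chain_map (cone s) Z :=
  @tw_desc A Y (sh X) (fun n => s (n + 1)) (cone_tau s) Z u h (@cone_desc_tau X Y Z s u h hP).

Lemma cone_desc_in X Y Z s u h hP n :
  (@cone_desc X Y Z s u h hP) n ∘ cone_in s n = u n.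
Proof. by rewrite /=; cmp_norm; rewrite ?addr0 ?cmpm1. Qed.

(* A homotopy [u s ~ 0] is the same as an extension of [u] to the cone of [s]. *)
Lemma null_cone_desc X Y Z (s : chain_map X Y) (u : chain_map Y Z) :
  homotopic (chain_cmp u s) (chain_zero X Z) ->
  exists k : chain_map (cone s) Z, chain_cmp k (cone_in s) = u.
Proof.
move=> [h hP].
have hP' n : u (n + 1) ∘ s (n + 1) = cdiff Z n ∘ h n + h (n + 1) ∘ cdiff X (n + 1).
  by rewrite -hP /= subr0.
by exists (cone_desc hP'); apply: chain_mapP => n; apply: cone_desc_in.
Qed.

Lemma cone_in_null X Y (s : chain_map X Y) :
  homotopic (chain_cmp (cone_in s) s) (chain_zero X (cone s)).
Proof.
exists (fun n => binr) => n; rewrite /= subr0.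
by apply: bsum_mapP; rewrite cmpDr ?fst_cone ?snd_cone; cmp_norm;
  rewrite ?add0r ?addr0 ?cmpm1 ?addNr.
Qed.

(** The null homotopy on the cone has two components: the one on [Y] is a chain map out of [sh Y],
    the one on [sh X] is the required homotopy. *)
Lemma null_cone_out X Y U (i : chain_map X Y) (k : chain_map (sh X) U) :
  homotopic (chain_cmp k (cone_out i)) (chain_zero (cone i) U) ->
  exists y : chain_map (sh Y) U, homotopic k (chain_cmp y (sh_map i)).
Proof.
move=> [h hP].
have hE n : k (n + 1) ∘ bsnd = cdiff U n ∘ h n + h (n + 1) ∘ cdiff (cone i) (n + 1).
  by rewrite -hP /= subr0.
have yP n : h (n + 1) ∘ binl ∘ cdiff (sh Y) n = cdiff U n ∘ (h n ∘ binl).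
  have e : k (n + 1) ∘ bsnd ∘ binl =
    (cdiff U n ∘ h n + h (n + 1) ∘ cdiff (cone i) (n + 1)) ∘ binl by rewrite hE.
  move: e; rewrite cmpDl -!cmpA cone_diff_inl snd_inl cmpm0 => e.
  by rewrite [cdiff (sh Y) n]/= !cmpmN; apply: (zmod_combine _ e); zmod.
exists (@ChainMap _ (sh Y) U (fun n => h n ∘ binl) yP).
exists (fun n => h n ∘ binr) => n.
have e : k (n + 1) ∘ @bsnd _ (Y (n + 1)) (sh X (n + 1)) ∘ binr =
  (cdiff U n ∘ h n + h (n + 1) ∘ cdiff (cone i) (n + 1)) ∘ binr by rewrite hE.
move: e; rewrite cmpDl -!cmpA cone_diff_inr snd_inr cmpm1 => -> /=.
by rewrite cmpBr -!cmpA !cmpmN; zmod.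
Qed.

End Cone.

Section IsoFacts.
Variables (C : category).

Lemma iso_cmp (x y z : C) (g : homset y z) (f : homset x y) :
  is_iso g -> is_iso f -> is_iso (g ∘ f).
Proof.
move=> [g' [g1 g2]] [f' [f1 f2]]; exists (f' ∘ g'); split.
  by rewrite cmpA -[f' ∘ g' ∘ g]cmpA g1 cmpm1.
by rewrite cmpA -[g ∘ f ∘ f']cmpA f2 cmpm1.
Qed.

Lemma iso_monic (x y : C) (f : homset x y) : is_iso f -> monic f.
Proof.
move=> [f' [f1 f2]] w g h e.
by rewrite -[g]cmp1m -f1 -cmpA e cmpA f1 cmp1m.
Qed.

Lemma iso_epic (x y : C) (f : homset x y) : is_iso f -> epic f.
Proof.
move=> [f' [f1 f2]] w g h e.
by rewrite -[g]cmpm1 -f2 cmpA e -cmpA f2 cmpm1.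
Qed.

Lemma fmap_iso (D : category) (F : functor C D) (x y : C) (f : homset x y) :
  is_iso f -> is_iso (fmap F f).
Proof. by move=> [g [g1 g2]]; exists (fmap F g); rewrite -!fmapM g1 g2 !fmap1. Qed.

End IsoFacts.

(** * Fractions in the derived category *)

Section DerivedCategory.
Variable A : abcat.
Implicit Types (X Y Z : complex A) (n : int).

Lemma qis_isoP X Y (f : chain_map X Y) : qis f <-> forall n, is_iso (coh_map f n).
Proof. by rewrite -quasi_iso_coh quasi_isoP. Qed.

Lemma coh_map_cmp X Y Z (g : chain_map Y Z) (f : chain_map X Y) n :
  coh_map (chain_cmp g f) n = coh_map g n ∘ coh_map f n.
Proof. exact: (@fmapM _ _ (coh_functor A n)). Qed.

Lemma coh_map_id X n : coh_map (chain_id X) n = idm _.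
Proof. exact: (@fmap1 _ _ (coh_functor A n)). Qed.

Lemma coh_map_homotopic X Y (f g : chain_map X Y) n :
  homotopic f g -> coh_map f n = coh_map g n.
Proof.
move=> [h hP]; apply: coh_class_ext => t x a xa.
have := coh_class_sub (coh_mapP f xa) (coh_mapP g xa).
rewrite -cmpBl hP cmpDl -!cmpA (coh_class_cocycle xa) cmpm0 addr0.
by move=> /(coh_class_fun (coh_class_bound _ _)) /esym/subr0_eq.
Qed.

Lemma qis_id X : qis (chain_id X).
Proof. by apply/qis_isoP => n; rewrite coh_map_id; apply: is_iso_id. Qed.

Lemma qis_cmp X Y Z (g : chain_map Y Z) (f : chain_map X Y) :
  qis g -> qis f -> qis (chain_cmp g f).
Proof.
move=> /qis_isoP gq /qis_isoP fq; apply/qis_isoP => n.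
by rewrite coh_map_cmp; apply: iso_cmp.
Qed.

Lemma qis_homotopic X Y (f g : chain_map X Y) : homotopic f g -> qis f -> qis g.
Proof.
by move=> fg /qis_isoP fq; apply/qis_isoP => n; rewrite -(coh_map_homotopic n fg).
Qed.

Definition dmap X Y (f : chain_map X Y) : homset (X : Dplus A) (Y : Dplus A) :=
  fmap (Dplus_functor A) f.

Lemma dmap_id X : dmap (chain_id X) = idm _.
Proof. exact: (fmap1 (Dplus_functor A)). Qed.

Lemma dmap_cmp X Y Z (g : chain_map Y Z) (f : chain_map X Y) :
  dmap (chain_cmp g f) = dmap g ∘ dmap f.
Proof. exact: (fmapM (Dplus_functor A)). Qed.

Lemma dmap_iso X Y (f : chain_map X Y) : qis f -> is_iso (dmap f).
Proof. by move=> /quasi_isoP fq; apply: loc_iso. Qed.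

(* [X + cone id] is a cylinder: both inclusions of [X] split its projection. *)
Lemma homotopic_dmap X Y (f g : chain_map X Y) : homotopic f g -> dmap f = dmap g.
Proof.
move=> fg; pose C := cone (chain_id X).
have tau0 n : cdiff X (n + 1) ∘ (0 : homset (C n) (X (n + 1))) + 0 ∘ cdiff C n = 0.
  by rewrite cmpm0 cmp0m addr0.
have [k kE] : exists k : chain_map C Y, chain_cmp k (cone_in _) = chain_sub f g.
  apply: null_cone_desc; move/homotopic_sub: fg.
  by congr (homotopic _ _); apply: chain_mapP => n /=; rewrite cmpm1.
have pP n : (0 : homset (C (n + 1)) (X (n + 1))) ∘ cdiff C n + chain_id X (n + 1) ∘ 0 =
    cdiff X n ∘ 0 by rewrite !cmpm0 cmp0m addr0.
pose p := tw_desc tau0 pP.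
(* [H] is [g + k] on the cylinder. It restricts to [g] along [tw_in] and, as [k] extends [f - g], to
   [f] along [i1]. *)
have HP n : k (n + 1) ∘ cdiff C n + g (n + 1) ∘ (0 : homset (C n) (X (n + 1))) =
    cdiff Y n ∘ k n by rewrite cmpm0 addr0 cmap_diff.
pose H := tw_desc tau0 HP.
have iP n : idm (X (n + 1)) ∘ cdiff X n =
    cdiff X n ∘ idm (X n) + (0 : homset (C n) (X (n + 1))) ∘ cone_in (chain_id X) n.
  by rewrite cmp1m cmpm1 cmp0m addr0.
pose i1 := tw_lift tau0 iP.
have pi0 : chain_cmp p (tw_in tau0) = chain_id X.
  by apply: chain_mapP => n /=; cmp_norm; rewrite ?addr0 ?cmp1m ?fst_inl.
have pi1 : chain_cmp p i1 = chain_id X.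
  by apply: chain_mapP => n /=; cmp_norm; rewrite ?addr0.
have i0q : is_iso (dmap (tw_in tau0)).
  by apply/dmap_iso/tw_in_qis/cone_acyclic/qis_id.
have i01 : dmap (tw_in tau0) = dmap i1.
  have [i0' [_ e]] := i0q; have pE : dmap p = i0'.
    by rewrite -[i0']cmp1m -dmap_id -pi0 dmap_cmp -cmpA e cmpm1.
  rewrite -[RHS]cmp1m -e -pE -cmpA -dmap_cmp pi1 dmap_id cmpm1.
  by [].
have -> : f = chain_cmp H i1.
  apply: chain_mapP => n /=; have := congr1 (fun u : chain_map X Y => u n) kE.
  rewrite /=; cmp_norm => ->; by rewrite ?cmpm1; zmod.
have -> : g = chain_cmp H (tw_in tau0).
  by apply: chain_mapP => n /=; cmp_norm; rewrite ?addr0 ?fst_inl ?cmpm1.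
by rewrite !dmap_cmp i01.
Qed.

(** [U] is the homotopy pushout of [s] and [g], written as an extension of [cone s] by [V]. Since
    [cone s] is acyclic, [tw_in_qis] applies to the leg from [V]; the homotopy is the inclusion of
    [X]. *)
Lemma homotopy_ore X Y V (s : chain_map X Y) (g : chain_map X V) : qis s ->
  exists U (g' : chain_map Y U) (s' : chain_map V U),
    qis s' /\ homotopic (chain_cmp g' s) (chain_cmp s' g).
Proof.
move=> sq; pose C := cone s.
have tauP n : cdiff V (n + 1) ∘ (- (g (n + 1) ∘ bsnd) : homset (C n) (V (n + 1))) +
    (- (g (n + 1 + 1) ∘ bsnd)) ∘ cdiff C n = 0.
  by rewrite cmpmN cmpNm -cmpA snd_cone_diff cmpmN cmap_cdiff opprK addNr.
have aP n : (0 : homset (Y (n + 1)) (V (n + 1))) ∘ cdiff Y n =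
    cdiff V n ∘ 0 + (- (g (n + 1) ∘ bsnd)) ∘ cone_in s n.
  by rewrite /=; cmp_norm; rewrite oppr0 addr0.
exists (tw tauP), (tw_lift tauP aP), (tw_in tauP); split.
  exact/tw_in_qis/cone_acyclic.
exists (fun n => binr ∘ binr) => n /=.
apply: bsum_mapP; rewrite cmpDr ?fst_tw ?snd_tw; cmp_norm.
  by zmod.
by zmod.
Qed.

(** The difference [f - g] extends to a map [k] on the acyclic [cone s]. The inclusion of [Z] in
    [cone k] makes [k] null, and is a quasi-isomorphism because the quotient [sh (cone s)] is
    acyclic. *)
Lemma homotopy_cancel X Y Z (s : chain_map X Y) (f g : chain_map Y Z) : qis s ->
  homotopic (chain_cmp f s) (chain_cmp g s) ->
  exists U (t : chain_map Z U), qis t /\ homotopic (chain_cmp t f) (chain_cmp t g).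
Proof.
move=> sq /homotopic_sub fg.
have [k kE] : exists k : chain_map (cone s) Z, chain_cmp k (cone_in s) = chain_sub f g.
  apply: null_cone_desc; move: fg; congr (homotopic _ _).
  by apply: chain_mapP => n /=; rewrite cmpBl.
exists (cone k), (cone_in k); split; first exact/tw_in_qis/sh_acyclic/cone_acyclic.
apply/homotopic_sub.
have := homotopic_cmpr (cone_in s) (cone_in_null k).
congr (homotopic _ _); apply: chain_mapP => n /=; last by rewrite cmp0m.
have := congr1 (fun u : chain_map Y Z => u n) kE.
by rewrite /= -cmpBr => <-; rewrite cmpA.
Qed.

Let homotopic_dmap' X Y (f g : homset (X : complex_category A) Y) :
  homotopic f g -> fmap (loc_functor (@quasi_iso A)) f = fmap (loc_functor (@quasi_iso A)) g.
Proof. exact: homotopic_dmap. Qed.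

Lemma dmap_eq X Y (f g : chain_map X Y) : dmap f = dmap g ->
  exists U (t : chain_map Y U), qis t /\ homotopic (chain_cmp t f) (chain_cmp t g).
Proof.
move=> fg; have := @fraction_eq (complex_category A) (@quasi_iso A) (@homotopic A).
case/(_ _ _ _ _ _ _ _ _ _ _ X Y f g fg).
- exact: homotopic_refl.
- exact: homotopic_sym.
- exact: homotopic_trans.
- by move=> *; apply: homotopic_cmpl.
- by move=> *; apply: homotopic_cmpr.
- by move=> x; apply/quasi_isoP/qis_id.
- by move=> x y z g' f' /quasi_isoP gq /quasi_isoP fq; apply/quasi_isoP/qis_cmp.
- by move=> x y f' g' e /quasi_isoP fq; apply/quasi_isoP/qis_homotopic/fq.
- move=> x y v s g' /quasi_isoP sq; have [U [g2 [s2 [s2q e]]]] := homotopy_ore g' sq.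
  by exists U, g2, s2; split=> //; apply/quasi_isoP.
- move=> x y z s f' g' /quasi_isoP sq /(homotopy_cancel sq) [U [t [tq e]]].
  by exists U, t; split=> //; apply/quasi_isoP.
- by move=> U [t [/quasi_isoP tq e]]; exists U, t.
Qed.

Lemma dmap_ex X Y (a : homset (X : Dplus A) (Y : Dplus A)) :
  exists V (f : chain_map X V) (t : chain_map Y V), qis t /\ dmap t ∘ a = dmap f.
Proof.
have := @fraction_ex (complex_category A) (@quasi_iso A) (@homotopic A).
case/(_ _ _ _ _ X Y a).
- by move=> x; apply/quasi_isoP/qis_id.
- by move=> x y z g' f' /quasi_isoP gq /quasi_isoP fq; apply/quasi_isoP/qis_cmp.
- move=> x y v s g' /quasi_isoP sq; have [U [g2 [s2 [s2q e]]]] := homotopy_ore g' sq.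
  by exists U, g2, s2; split=> //; apply/quasi_isoP.
- exact: homotopic_dmap'.
- by move=> V [f [t [/quasi_isoP tq e]]]; exists V, f, t.
Qed.

End DerivedCategory.

(** * The shift on complexes and on the derived category *)

Section Shift.
Variable A : abcat.
Implicit Types (X Y Z : complex A) (n m : int).

Lemma chain_iso_qis X Y (f : chain_map X Y) : (forall n, is_iso (f n)) -> qis f.
Proof.
move=> fiso n; split.
  move=> t x y _ fxy; have [g [_ fg]] := fiso n.
  exists t, (idm t), (g ∘ y); split; first exact: epic_id.
  have im := iso_monic (fiso (n + 1)); apply: im.
  by rewrite cmap_cdiff (cmpA (f n)) fg cmp1m cmpm1 fxy.
move=> t y dy; have [g [gf fg]] := fiso (n + 1).
exists t, (idm t), (g ∘ y), 0; split; first exact: epic_id.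
  have im := iso_monic (fiso (n + 1 + 1)); apply: im.
  by rewrite cmap_cdiff (cmpA (f (n + 1))) fg cmp1m dy !cmpm0.
by rewrite cmpA fg cmp1m cmpm1 cmpm0 addr0.
Qed.

Lemma sh_qis X Y (f : chain_map X Y) : qis f <-> qis (sh_map f).
Proof.
split=> fq; last first.
  apply: int_succ => n; split.
    move=> t x y dx fxy; have [||t' [c [x' [ce xE]]]] := (fq n).1 t x (- y).
    - by rewrite /= cmpNm dx oppr0.
    - by rewrite /= cmpNm cmpmN opprK.
    by exists t', c, (- x'); split; rewrite // -xE /= cmpNm cmpmN.
  move=> t y dy; have [|t' [c [x [y' [ce dx yE]]]]] := (fq n).2 t y.
    by rewrite /= cmpNm dy oppr0.
  exists t', c, x, (- y'); split=> //; last by rewrite yE /= cmpNm cmpmN.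
  by apply: oppr_inj; rewrite oppr0 -cmpNm.
move=> n; split.
  move=> t x y /= dx fxy; have [||t' [c [x' [ce xE]]]] := (fq (n + 1)).1 t x (- y).
  - by apply: oppr_inj; rewrite oppr0 -cmpNm.
  - by rewrite fxy cmpNm cmpmN.
  by exists t', c, (- x'); split; rewrite // -xE cmpNm cmpmN opprK.
move=> t y /= dy; have [|t' [c [x [y' [ce dx yE]]]]] := (fq (n + 1)).2 t y.
  by apply: oppr_inj; rewrite oppr0 -cmpNm.
exists t', c, x, (- y'); split; rewrite ?cmpNm ?dx ?oppr0//.
by rewrite yE cmpmN opprK.
Qed.

Lemma sh_homotopic_inv X Y (f g : chain_map X Y) :
  homotopic (sh_map f) (sh_map g) -> homotopic f g.
Proof.
move=> [h hP]; have [k kE] := succ_family (P := fun n => homset (X (n + 1)) (Y n))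
  (fun n => - h n).
exists k; apply: int_succ => n; rewrite !kE (hP n) /=.
by rewrite cmpNm cmpmN cmpmN cmpNm.
Qed.

Lemma sh_full X Y (f : chain_map (sh X) (sh Y)) : exists g : chain_map X Y, sh_map g = f.
Proof.
have [g gE] := succ_family (P := fun n => homset (X n) (Y n)) (fun n => f n).
have gP : forall n, g (n + 1) ∘ cdiff X n = cdiff Y n ∘ g n.
  apply: int_succ => n; rewrite !gE; apply: oppr_inj.
  by have := cmap_diff f n; rewrite /= cmpmN cmpNm.
by exists (ChainMap gP); apply: chain_mapP => n; apply: gE.
Qed.

Definition cast X n m (e : n = m) : homset (X n) (X m) :=
  eq_rect n (fun k => homset (X n) (X k)) (idm _) m e.

Lemma cast_iso X n m (e : n = m) : is_iso (cast X e).
Proof. by case: _ / e; apply: is_iso_id. Qed.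

Lemma cast_cdiff X n m (e : n = m) (e' : n + 1 = m + 1) :
  cdiff X m ∘ cast X e = cast X e' ∘ cdiff X n.
Proof. by case: _ / e e' => e'; rewrite (eq_irrelevance e' erefl) cmpm1 cmp1m. Qed.

Lemma cast_cmap X Y (f : chain_map X Y) n m (e : n = m) :
  f m ∘ cast X e = cast Y e ∘ f n.
Proof. by case: _ / e; rewrite cmpm1 cmp1m. Qed.

Lemma cast_cast X n m k (e : n = m) (e' : m = k) (e'' : n = k) :
  cast X e' ∘ cast X e = cast X e''.
Proof. by case: _ / e' e'' => e''; rewrite (eq_irrelevance e'' e) cmp1m. Qed.

Fact unsh_eq n : n - 1 + 1 = n + 1 - 1.
Proof. by rewrite addrAC. Qed.

(** The inverse shift serves to prove [sh_faithful]. The cast is forced: [n - 1 + 1] and [n + 1 - 1]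
    are equal but not convertible. *)
Definition unsh X : complex A.
Proof.
exists (fun n => X (n - 1)) (fun n => - (cast X (unsh_eq n) ∘ cdiff X (n - 1))).
- move=> n; rewrite cmpNm cmpmN opprK -cmpA (cmpA (cdiff X _)).
  rewrite (cast_cdiff X (unsh_eq n) (congr1 (+%R^~ 1) (unsh_eq n))).
  by rewrite -(cmpA _ (cdiff X _)) cdiffK !cmpm0.
- have [N XN] := bounded_below X; exists (N + 1) => n nN.
  by apply: XN; rewrite ltrBlDr.
Defined.

Definition unsh_map X Y (f : chain_map X Y) : chain_map (unsh X) (unsh Y).
Proof.
exists (fun n => f (n - 1)) => n /=.
by rewrite cmpNm cmpmN cmpA cast_cmap -!cmpA cmap_diff.
Defined.

Definition unsh_functor : functor (complex_category A) (complex_category A).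
Proof.
refine (@Functor (complex_category A) (complex_category A) unsh unsh_map _ _).
- by move=> X; apply: chain_mapP.
- by move=> X Y Z g f; apply: chain_mapP.
Defined.

Definition unsh_sh X : chain_map (unsh (sh X)) X.
Proof.
exists (fun n => cast X (subrK 1 n)) => n /=.
rewrite (cast_cdiff X (subrK 1 n) (congr1 (+%R^~ 1) (subrK 1 n))).
rewrite !cmpmN opprK cmpA; congr (_ ∘ _).
have -> : cast (sh X) (unsh_eq n) = cast X (congr1 (+%R^~ 1) (unsh_eq n)).
  by case: _ / (unsh_eq n).
exact: cast_cast.
Defined.

Definition sh_unsh X : chain_map (sh (unsh X)) X.
Proof.
exists (fun n => cast X (addrK 1 n)) => n /=.
rewrite opprK (cast_cdiff X (addrK 1 n) (congr1 (+%R^~ 1) (addrK 1 n))).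
by rewrite cmpA; congr (_ ∘ _); apply: cast_cast.
Defined.

Lemma unsh_sh_natural X Y (f : chain_map X Y) :
  chain_cmp f (unsh_sh X) = chain_cmp (unsh_sh Y) (unsh_map (sh_map f)).
Proof. by apply: chain_mapP => n; exact: (cast_cmap f (subrK 1 n)). Qed.

Lemma sh_unsh_natural X Y (f : chain_map X Y) :
  chain_cmp f (sh_unsh X) = chain_cmp (sh_unsh Y) (sh_map (unsh_map f)).
Proof. by apply: chain_mapP => n; exact: (cast_cmap f (addrK 1 n)). Qed.

Lemma dmap_unsh_sh_iso X : is_iso (dmap (unsh_sh X)).
Proof. by apply/dmap_iso/chain_iso_qis => n; apply: cast_iso. Qed.

Lemma unsh_qis X Y (f : chain_map X Y) : qis f -> qis (unsh_map f).
Proof.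
move=> fq; apply/sh_qis/qis_isoP => n.
have eX : is_iso (coh_map (sh_unsh X) n).
  by apply: (qis_isoP (sh_unsh X)).1; apply: chain_iso_qis => m; apply: cast_iso.
have eY : is_iso (coh_map (sh_unsh Y) n).
  by apply: (qis_isoP (sh_unsh Y)).1; apply: chain_iso_qis => m; apply: cast_iso.
have [g [gY Yg]] := eY.
have -> : coh_map (sh_map (unsh_map f)) n = g ∘ (coh_map f n ∘ coh_map (sh_unsh X) n).
  by rewrite -coh_map_cmp sh_unsh_natural coh_map_cmp cmpA gY cmp1m.
by do 2?apply: iso_cmp => //; [exists (coh_map (sh_unsh Y) n)|apply: (qis_isoP f).1].
Qed.

(** [unsh] preserves quasi-isomorphisms, so [loc_lift] lets it act on the given equation; the
    natural isomorphism [unsh_sh] then removes both shifts. *)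
Lemma sh_faithful X Y (f g : chain_map X Y) :
  dmap (sh_map f) = dmap (sh_map g) -> dmap f = dmap g.
Proof.
move=> fg.
have inv (V W : complex_category A) (s : homset V W) : quasi_iso s ->
    is_iso (fmap (fcomp (Dplus_functor A) unsh_functor) s).
  by move=> /quasi_isoP sq; apply/dmap_iso/unsh_qis.
have e : dmap (unsh_map (sh_map f)) = dmap (unsh_map (sh_map g)).
  have := congr1 (fmap (loc_lift inv)) fg.
  by rewrite /dmap /Dplus_functor !loc_liftE.
have ee := iso_epic (dmap_unsh_sh_iso X); apply: ee.
by rewrite -!dmap_cmp !unsh_sh_natural !dmap_cmp e.
Qed.

End Shift.

(** * Resolving classes *)

Section NullHomotopy.
Variable A : abcat.
Variables (E J : complex A).
Hypothesis Eac : acyclic E.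
Hypothesis EJ : forall (n k : int) (g : homset (E n) (J k)),
  (forall (t : A) (x : homset t (E n)), cdiff E n ∘ x = 0 -> g ∘ x = 0) ->
  exists g', g' ∘ cdiff E n = g.

(** Here [phi] is a cocycle of degree one in the complex of maps from [E] to [J]. The homotopy is
    built upwards: [good] says that the remaining error kills cocycles, so that [EJ] factors it
    through the differential, and acyclicity of [E] restores [good] one degree higher. *)
Lemma null_homotopy_deg1 (phi : forall n : int, homset (E n) (J (n + 1))) :
  (forall n : int, cdiff J (n + 1) ∘ phi n + phi (n + 1) ∘ cdiff E n = 0) ->
  exists h : forall n, homset (E n) (J n),
    forall n : int, phi n = h (n + 1) ∘ cdiff E n - cdiff J n ∘ h n.
Proof.
move=> phiP; have [N JN] := bounded_below J.
(* In degree [n] both conditions take values in [J (n + 1)], which vanishes for [n + 1 < N]; hence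
   the start at [N - 2]. *)
have J0 (n : int) (t : A) (x : homset t (J (n + 1))) : n <= N - 2 -> x = 0.
  move=> nN; apply/zero_to/JN; rewrite -(lerD2r 2) in nN.
  by rewrite -lezD1 -addrA (le_trans nN)// subrK.
pose good (n : int) (h : homset (E n) (J n)) := forall (t : A) (x : homset t (E n)),
  cdiff E n ∘ x = 0 -> (phi n + cdiff J n ∘ h) ∘ x = 0.
pose R (n : int) (h : homset (E n) (J n)) (h' : homset (E (n + 1)) (J (n + 1))) :=
  phi n = h' ∘ cdiff E n - cdiff J n ∘ h.
have [|||h hP] := @int_dependent_choice _ good R (N - 2) (fun=> 0).
- by move=> n nN t x _; apply: J0.
- by move=> n nN; rewrite /R [LHS](J0 _ _ _ (ltW nN)) cmp0m cmpm0 subr0.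
- move=> n h nN gh; have [h' h'P] := EJ gh; exists h'; split; last first.
    by rewrite /R h'P addrK.
  move=> t x /Eac [t' [c [y [ce yx]]]]; apply: ce; rewrite cmp0m -cmpA -yx.
  rewrite cmpDl -!cmpA [h' ∘ _]cmpA h'P cmpDl cmpDr -!cmpA cdiff0 addr0 !cmpA.
  by rewrite -cmpDl [X in X ∘ y]addrC phiP cmp0m.
by exists h => n; case: (hP n).
Qed.

End NullHomotopy.

Section Cocycles.
Variable A : abcat.

Lemma image_short_exact (E : complex A) (n : int) : exact (cdiff E n) (cdiff E (n + 1)) ->
  exists e : homset (E n) (ker (cdiff E (n + 1))),
    kin (cdiff E (n + 1)) ∘ e = cdiff E n /\ short_exact (kin (cdiff E n)) e.
Proof.
move=> ex; have [e eE] := kernel_lift (kinP (cdiff E (n + 1))) (cdiffK E n).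
have kd := proj1 (kinP (cdiff E (n + 1))).
have km := kernel_monic (kinP (cdiff E (n + 1))).
exists e; split=> //; split; last first.
  apply: epic_covers; have [t [c [a [ce aE]]]] := ex _ _ kd.
  by exists t, c, a; split=> //; apply: km; rewrite cmpA eE.
apply: kernelP.
- by apply: km; rewrite cmpA eE cmpm0 (proj1 (kinP (cdiff E n))).
- exact: kernel_monic (kinP _).
- by move=> w g eg; apply: (kernel_lift (kinP _)); rewrite -eE -cmpA eg cmpm0.
Qed.

(** Induction on the bound, for all cocycles simultaneously: [ker d^n -> E^n -> ker d^(n+1)] turns
    the bound [b + 1] in degree [n + 1] into [b] in degree [n]. Only syzygies and the bound are
    assumed, because the lemma also serves to find the generators that [resolving] demands. *)
Lemma dim0_cocycles (dim : nat -> A -> Prop) (E : complex A) (k : int) :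
  (forall q (x y z : A) (i : homset x y) (p : homset y z),
    short_exact i p -> dim 0 y -> dim q.+1 z -> dim q x) ->
  (exists n, forall x, dim n x) ->
  (forall n, dim 0 (E n)) ->
  (forall n, k <= n -> exact (cdiff E n) (cdiff E (n + 1))) ->
  forall n, k <= n -> dim 0 (ker (cdiff E n)).
Proof.
move=> syz [b bP] E0 ex.
have : forall n, k <= n -> dim b (ker (cdiff E n)) by move=> n _; apply: bP.
elim: b {bP} => // b IH Eb; apply: IH => n kn.
have [e [_ es]] := image_short_exact (ex n kn).
by apply: (syz _ _ _ _ _ _ es) => //; apply: Eb; rewrite (le_trans kn)// lerDl.
Qed.

End Cocycles.

Section Resolving.
Variable A : abcat.
Variables (dim : nat -> A -> Prop) (Jc : A -> Prop).

(* [dim 0] is a generating class of objects that are acyclic for maps to the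
   "injectives" [Jc], and [dim q] bounds the length of resolutions by it. *)
Record resolving : Prop := Resolving {
  rs_mono : forall q x, dim q x -> dim q.+1 x;
  rs_zero : forall z, is_zero_object z -> dim 0 z;
  rs_ext : forall (x y z : A) (i : homset x y) (p : homset y z),
    short_exact i p -> dim 0 x -> dim 0 z -> dim 0 y;
  rs_syz : forall q (x y z : A) (i : homset x y) (p : homset y z),
    short_exact i p -> dim 0 y -> dim q.+1 z -> dim q x;
  rs_bound : exists n, forall x, dim n x;
  rs_gen : forall x, exists (y : A) (e : homset y x), dim 0 y /\ epic e;
  rs_inj : forall (x y z j : A) (i : homset x y) (p : homset y z) (f : homset x j),
    short_exact i p -> dim 0 z -> Jc j -> exists g, g ∘ i = f;
  rs_sub : forall j, Jc j -> dim 0 j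
}.

Hypothesis rs : resolving.

Definition termwise (P : A -> Prop) (X : complex A) : Prop := forall n, P (X n).

Lemma dim0_bsum (x y : A) : dim 0 x -> dim 0 y -> dim 0 (bsum x y).
Proof. exact: (rs_ext rs (bsum_short_exact _ _)). Qed.

(** A map that kills the cocycles descends to the image, which is [ker d^(n+1)]. It extends from
    there to [E (n + 1)] because the quotient is [ker d^(n+2)], of dimension 0 by
    [dim0_cocycles]. *)
Lemma dim0_acyclic_extend (E : complex A) : termwise (dim 0) E -> acyclic E ->
  forall (n : int) (j : A) (g : homset (E n) j), Jc j ->
  (forall (t : A) (x : homset t (E n)), cdiff E n ∘ x = 0 -> g ∘ x = 0) ->
  exists g', g' ∘ cdiff E n = g.
Proof.
move=> E0 Eac n j g Jj gk.
have Z0 m : dim 0 (ker (cdiff E m)).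
  by apply: (@dim0_cocycles _ dim E m (rs_syz rs) (rs_bound rs)).
have [e [eE [_ ee]]] := image_short_exact (Eac n).
have [g1 g1E] : exists g1, g1 ∘ e = g.
  by apply: (epic_factor ee) => t x ex0; apply: gk; rewrite -eE -cmpA ex0 cmpm0.
have [e' [_ e's]] := image_short_exact (Eac (n + 1)).
have [g2 g2E] := rs_inj rs g1 e's (Z0 _) Jj.
by exists g2; rewrite -eE cmpA g2E.
Qed.

Section Cones.
Variables (V W J : complex A) (s : chain_map V W).
Hypotheses (V0 : termwise (dim 0) V) (W0 : termwise (dim 0) W).
Hypotheses (JJ : termwise Jc J) (sq : qis s).

Let cone0 : termwise (dim 0) (cone s).
Proof. by move=> n; exact: (dim0_bsum (W0 n) (V0 (n + 1))). Qed.

(** The map [g ∘ bsnd] is a cocycle of degree one on the acyclic [cone s]. A null homotopy of it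
    consists of a chain map on [W] and a homotopy on [V]. *)
Lemma extend_qis (g : chain_map V J) :
  exists f : chain_map W J, homotopic (chain_cmp f s) g.
Proof.
have [||h hP] := @null_homotopy_deg1 A (cone s) J (cone_acyclic sq) _
    (fun n => g (n + 1) ∘ bsnd).
- by move=> n k f; apply: dim0_acyclic_extend => //; apply: cone_acyclic.
- move=> n.
  by rewrite -[g (n + 1 + 1) ∘ _ ∘ _]cmpA snd_cone_diff cmpmN cmap_cdiff subrr.
have fP n : (h (n + 1) ∘ binl) ∘ cdiff W n = cdiff J n ∘ (h n ∘ binl).
  have := congr1 (fun u => u ∘ binl) (hP n); rewrite cmpBl -!cmpA snd_inl cmpm0 cone_diff_inl.
  by move=> /esym/subr0_eq.
exists (ChainMap fP); exists (fun n => h n ∘ binr) => n /=.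
have := congr1 (fun u => u ∘ binr) (hP n); rewrite cmpBl -!cmpA snd_inr cmpm1 cone_diff_inr => ->.
by rewrite cmpBr; zmod.
Qed.

(** The homotopy extends [f - g] to a chain map [k] on [cone s]. Read on the shifted cone, [k] has
    degree one, so [null_homotopy_deg1] makes it null, and with it its restriction [f - g]. *)
Lemma qis_homotopy_epic (f g : chain_map W J) :
  homotopic (chain_cmp f s) (chain_cmp g s) -> homotopic f g.
Proof.
move=> /homotopic_sub fg; apply/homotopic_sub.
have [k kE] : exists k : chain_map (cone s) J, chain_cmp k (cone_in s) = chain_sub f g.
  apply: null_cone_desc; move: fg; congr (homotopic _ _).
  by apply: chain_mapP => n /=; rewrite cmpBl.
have [||h hP] := @null_homotopy_deg1 A (sh (cone s)) J (sh_acyclic (cone_acyclic sq)) _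
    (fun n => k (n + 1)).
- move=> n m u uk.
  have [||||u' u'E] := @dim0_acyclic_extend (cone s) _ _ (n + 1) (J m) u => //.
  + exact: cone_acyclic.
  + by move=> t x dx; apply: uk; rewrite /= cmpNm dx oppr0.
  by exists (- u'); rewrite /= cmpmN cmpNm opprK.
- move=> n; have -> : cdiff (sh (cone s)) n = - cdiff (cone s) (n + 1) by [].
  by rewrite cmpmN; apply/eqP; rewrite subr_eq0; apply/eqP/esym/(cmap_diff k).
rewrite -kE.
have : homotopic k (chain_zero (cone s) J).
  exists (fun n => - h n) => n; rewrite [_ n]/= subr0 hP.
  have -> : cdiff (sh (cone s)) n = - cdiff (cone s) (n + 1) by [].
  by rewrite !cmpmN cmpNm; zmod.
move=> /(homotopic_cmpr (cone_in s)); congr (homotopic _ _).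
by apply: chain_mapP => n /=; rewrite cmp0m.
Qed.

End Cones.

End Resolving.

Section Resolution.
Variable A : abcat.

Definition zd_complex (G : int -> A)
    (Gb : exists N : int, forall n, n < N -> is_zero_object (G n)) : complex A.
Proof. by exists G (fun n => 0) => [n|]; [rewrite cmp0m|exact: Gb]. Defined.

Lemma kernel_complex (X Y : complex A) (f : chain_map X Y) :
  exists (K : complex A) (i : chain_map K X), forall n, is_kernel (f n) (i n).
Proof.
have km n := kernel_monic (kinP (f n)).
have [d dE] : exists d : forall n : int, homset (ker (f n)) (ker (f (n + 1))),
    forall n : int, kin (f (n + 1)) ∘ d n = cdiff X n ∘ kin (f n).
  apply: (@dep_choice int _ (fun n d => kin (f (n + 1)) ∘ d = cdiff X n ∘ kin (f n))) => n.
  apply: (kernel_lift (kinP _)); rewrite cmap_cdiff (proj1 (kinP (f n))).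
  exact: cmpm0.
have dd n : d (n + 1) ∘ d n = 0.
  by apply: (km (n + 1 + 1)); rewrite cmpA dE -cmpA dE cdiff0 cmpm0.
have bb : exists N : int, forall n, n < N -> is_zero_object (ker (f n)).
  have [N XN] := bounded_below X; exists N => n nN; apply/zero_id.
  by apply: (km n); rewrite cmpm0; apply: (zero_to _ (XN n nN)).
by exists (Complex dd bb), (@ChainMap A (Complex dd bb) X (fun n => kin (f n)) dE) => n;
  apply: kinP.
Qed.

(** Splices resolutions: if [K'] resolves the kernel of [P -> V], the cone of [K' -> P] resolves
    [V]. For [r] the identity it compares the cone of a monomorphism with its cokernel. *)
Lemma short_exact_cone_qis (K P V K' : complex A) (i : chain_map K P) (p : chain_map P V)
    (r : chain_map K' K) (s : chain_map (cone (chain_cmp i r)) V) :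
  (forall n, short_exact (i n) (p n)) -> qis r ->
  (forall n, s n = p n ∘ bfst) -> qis s.
Proof.
move=> ses rq sE n; have im m := kernel_monic (proj1 (ses m)).
have pi0 m : p m ∘ i m = 0 := proj1 (proj1 (ses m)).
have toK m (t : A) (a : homset t (P m)) := @kernel_lift _ _ _ _ _ _ _ a (proj1 (ses m)).
split.
  move=> t x v dx; rewrite sE -cmpA => xv.
  have dx1 : cdiff P (n + 1) ∘ (bfst ∘ x) = - (i (n + 1 + 1) ∘ (r (n + 1 + 1) ∘ (bsnd ∘ x))).
    apply/eqP; rewrite -addr_eq0 [i _ ∘ _]cmpA.
    by have := fst_cone x; rewrite dx cmpm0 => /= <-.
  have dx2 : cdiff K' (n + 1 + 1) ∘ (bsnd ∘ x) = 0.
    by apply: oppr_inj; rewrite -snd_cone dx cmpm0 oppr0.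
  have [t1 [c1 [p' [c1e p'E]]]] := epic_cover v (proj2 (ses n)).
  have [k kE] : exists k, i (n + 1) ∘ k = bfst ∘ x ∘ c1 - cdiff P n ∘ p'.
    by apply: toK; rewrite cmpBr cmap_cdiff p'E [p _ ∘ _]cmpA xv -cmpA subrr.
  have dk : r (n + 1 + 1) ∘ (bsnd ∘ x ∘ c1) = cdiff K (n + 1) ∘ - k.
    apply: im; rewrite !cmpmN cmap_cdiff kE cmpBr cdiff0 subr0.
    by rewrite [cdiff P _ ∘ _]cmpA dx1 cmpNm opprK !cmpA.
  have dx2' : cdiff K' (n + 1 + 1) ∘ (bsnd ∘ x ∘ c1) = 0 by rewrite cmpA dx2 cmp0m.
  have [t2 [c2 [w' [c2e w'E]]]] := (rq (n + 1)).1 _ _ _ dx2' dk.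
  have dz : cdiff K (n + 1) ∘ (r (n + 1) ∘ w' + k ∘ c2) = 0.
    rewrite cmpDr -cmap_cdiff w'E [r _ ∘ _]cmpA dk cmpmN cmpNm -cmpA addNr.
    by [].
  have [t3 [c3 [w2 [k2 [c3e dw2 zE]]]]] := (rq n).2 _ _ dz.
  pose c := c1 ∘ (c2 ∘ c3).
  exists t3, c, (binl ∘ (p' ∘ (c2 ∘ c3) + i n ∘ k2) + binr ∘ (w2 - w' ∘ c3)).
  split; first by do 2?apply: epic_cmp.
  apply: bsum_mapP; rewrite ?fst_cone ?snd_cone; cmp_norm; rewrite ?addr0 ?add0r.
    have e1 : i (n + 1) ∘ ((r (n + 1) ∘ w' + k ∘ c2) ∘ c3) =
        i (n + 1) ∘ (r (n + 1) ∘ w2 + cdiff K n ∘ k2) by rewrite zE.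
    have e2 : i (n + 1) ∘ k ∘ (c2 ∘ c3) =
        (bfst ∘ x ∘ c1 - cdiff P n ∘ p') ∘ (c2 ∘ c3) by rewrite kE.
    move: e1 e2; rewrite cmpDl !cmpDr cmap_cdiff cmpBl -!cmpA => e1 e2.
    by apply: (zmod_combine2 _ e1 e2); rewrite /c; zmod.
  by rewrite dw2 sub0r opprK cmpA w'E /c -!cmpA.
move=> t v dv; have [t1 [c1 [x [c1e xE]]]] := epic_cover v (proj2 (ses (n + 1))).
have [k kE] : exists k, i (n + 1 + 1) ∘ k = cdiff P (n + 1) ∘ x.
  by apply: toK; rewrite cmap_cdiff xE cmpA dv cmp0m.
have dk : cdiff K (n + 1 + 1) ∘ k = 0.
  by apply: im; rewrite cmap_cdiff kE cdiff0 cmpm0.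
have [t2 [c2 [w [k' [c2e dw kk']]]]] := (rq (n + 1)).2 _ _ dk.
exists t2, (c1 ∘ c2), (binl ∘ (x ∘ c2 - i (n + 1) ∘ k') - binr ∘ w), 0.
split; first exact: epic_cmp.
  apply: bsum_mapP; rewrite ?fst_cone ?snd_cone; cmp_norm; rewrite ?subr0 ?sub0r.
    rewrite [cdiff P _ ∘ (x ∘ _)]cmpA -kE -cmpA kk' cmpDr cmap_cdiff.
    by zmod.
  by rewrite ?cmpmN dw ?oppr0.
rewrite sE; cmp_norm.
rewrite [p _ ∘ (i _ ∘ _)]cmpA pi0; cmp_norm.
by rewrite [p _ ∘ _]cmpA xE cmpA; zmod.
Qed.

End Resolution.

(** * Derived morphisms from acyclic objects to [Jc] as homotopy classes *)

Section DerivedHom.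
Variable A : abcat.
Variables (dim : nat -> A -> Prop) (Jc : A -> Prop).
Hypothesis rs : resolving dim Jc.

(** [P] is the cone of the identity of a complex [D] with zero differential. A chain map out of it
    amounts to an arbitrary family of maps [D (n + 1) -> V n], so the degrees of [V] can be covered
    independently. *)
Lemma disk_cover (V : complex A) :
  exists (P : complex A) (p : chain_map P V),
    termwise (dim 0) P /\ forall n, epic (p n).
Proof.
have [G [e [G0 ee Gb]]] : exists (G : int -> A) (e : forall n, homset (G n) (V (n - 1))),
    [/\ forall n, dim 0 (G n), forall n, epic (e n)
      & exists N : int, forall n, n < N -> is_zero_object (G n)].
  have [N VN] := bounded_below V.
  pose T (n : int) := {G : A & homset G (V (n - 1))}.
  pose R n (Ge : T n) := [/\ dim 0 (projT1 Ge), epic (projT2 Ge)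
    & n < N -> is_zero_object (projT1 Ge)].
  have [Ge GeP] : exists Ge : forall n, T n, forall n, R n (Ge n).
    (* Below [N] the generator has to be zero to keep [P] bounded below; it is still a cover there,
       since [V (n - 1)] vanishes. *)
    apply: dep_choice => n; case: (ltP n N) => nN.
      exists (existT _ (zob A) (0 : homset (zob A) (V (n - 1)))).
      split; [exact/(rs_zero rs)/zobP| |by move=> _; apply: zobP].
      by apply/epicP => w g _; apply/zero_from/VN; rewrite (le_lt_trans _ nN)// gerBl.
    have [y [e [y0 ee]]] := rs_gen rs (V (n - 1)).
    by exists (existT _ y e); split=> //; rewrite ltNge nN.
  exists (fun n => projT1 (Ge n)), (fun n => projT2 (Ge n)); split.
  - by move=> n; case: (GeP n).
  - by move=> n; case: (GeP n).
  - by exists N => n; case: (GeP n).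
pose eps n : homset (G (n + 1)) (V n) := cast V (addrK 1 n) ∘ e (n + 1).
have epse n : epic (eps n) by apply: epic_cmp => //; apply/iso_epic/cast_iso.
pose D := zd_complex Gb.
have [u uE] := succ_family (P := fun n => homset (G n) (V n)) (fun n => cdiff V n ∘ eps n).
have uP : forall n, u (n + 1) ∘ cdiff D n = cdiff V n ∘ u n.
  by apply: int_succ => n; rewrite uE cdiff0 cmpm0.
pose U : chain_map D V := ChainMap uP.
have hP n : U (n + 1) ∘ chain_id D (n + 1) =
    cdiff V n ∘ eps n + eps (n + 1) ∘ cdiff D (n + 1).
  by rewrite /= cmpm1 cmpm0 addr0 uE.
exists (cone (chain_id D)), (cone_desc hP); split.
  by move=> n; apply: (dim0_bsum rs (G0 n) (G0 (n + 1))).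
move=> n; apply: (@epic_cmpl _ _ _ _ _ binr).
have -> : cone_desc hP n ∘ binr = eps n.
  by rewrite /=; cmp_norm; rewrite ?add0r ?cmpm1.
exact: epse.
Qed.

(** The kernel of a disk cover satisfies a bound smaller by one, so finitely many splicings suffice
    and the complex stays bounded below. *)
Lemma dim0_resolution (V : complex A) :
  exists (V' : complex A) (s : chain_map V' V), termwise (dim 0) V' /\ qis s.
Proof.
have [b bP] := rs_bound rs.
have : termwise (dim b) V by move=> n; apply: bP.
elim: b {bP} V => [|b IH] V Vb.
  by exists V, (chain_id V); split=> //; apply: qis_id.
have [P [p [P0 pe]]] := disk_cover V.
have [K [i ip]] := kernel_complex p.
have ses n : short_exact (i n) (p n) by split.
have Kb : termwise (dim b) K by move=> n; apply: (rs_syz rs (ses n)).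
have [K' [r [K'0 rq]]] := IH K Kb.
have hP n : p (n + 1) ∘ chain_cmp i r (n + 1) =
    cdiff V n ∘ (0 : homset (K' (n + 1)) (V n)) + 0 ∘ cdiff K' (n + 1).
  by rewrite /= cmpA (proj1 (ip _)) cmpm0 !cmp0m addr0.
exists (cone (chain_cmp i r)), (cone_desc hP); split.
  by move=> n; apply: (dim0_bsum rs (P0 n) (K'0 (n + 1))).
apply: (short_exact_cone_qis ses rq) => n.
by rewrite /= cmp0m addr0.
Qed.

Variables (W J : complex A).
Hypotheses (W0 : termwise (dim 0) W) (JJ : termwise Jc J).

(** A fraction provides a quasi-isomorphism [t] out of [J], whereas [extend_qis] needs one into [W].
    Since [C] is acyclic, [K -> sh W] is a quasi-isomorphism, and [K] also projects to [sh J]: this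
    is [a] as a right fraction, up to a shift. Resolving [K] by objects of dimension 0 makes
    [extend_qis] applicable. *)
Lemma chain_dmap_full (a : homset (W : Dplus A) (J : Dplus A)) :
  exists f : chain_map W J, a = dmap f.
Proof.
have [V [f [t [tq ta]]]] := dmap_ex a.
pose C := cone t; pose j := cone_in t; pose K := cone (chain_cmp j f).
have Cac : acyclic C by apply: cone_acyclic.
have sq : qis (cone_out (chain_cmp j f)) by apply: tw_out_qis.
have gP n : (- (bsnd ∘ bfst) : homset (K (n + 1)) (J (n + 1 + 1))) ∘ cdiff K n =
    cdiff (sh J) n ∘ (- (bsnd ∘ bfst)).
  rewrite -[cdiff K n]cmpm1 cmpNm -cmpA fst_cone cmpDr snd_cone.
  by rewrite /= cmpNm cmpmN; cmp_norm; rewrite ?cmpm1; zmod.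
pose g : chain_map K (sh J) := @ChainMap _ K (sh J) (fun n => - (bsnd ∘ bfst)) gP.
have [K' [r [K'0 rq]]] := dim0_resolution K.
have srq := qis_cmp sq rq.
have [b bE] := extend_qis rs K'0 (fun n => W0 (n + 1) : dim 0 (sh W n))
  (fun n => JJ (n + 1) : Jc (sh J n)) srq (chain_cmp g r).
have [b0 b0E] := sh_full b.
have e1 : homotopic (chain_cmp (sh_map f) (cone_out (chain_cmp j f))) (chain_cmp (sh_map t) g).
  have dK n : @bfst _ (V (n + 1)) (sh J (n + 1)) ∘ @bfst _ (C (n + 1)) (sh W (n + 1)) ∘
      cdiff K n =
      cdiff V n ∘ (bfst ∘ bfst) + t (n + 1) ∘ (bsnd ∘ bfst) + f (n + 1) ∘ bsnd.
    rewrite -[cdiff K n]cmpm1 -cmpA fst_cone cmpDr fst_cone [chain_cmp j f _]/=.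
    by cmp_norm; rewrite ?cmpm1.
  exists (fun n => @bfst _ (V (n + 1)) (sh J (n + 1)) ∘
    @bfst _ (C (n + 1)) (sh W (n + 1))) => n; cbv beta; rewrite dK /=.
  by rewrite cmpmN cmpNm; zmod.
exists b0; have tm := iso_monic (dmap_iso tq); apply: tm.
rewrite ta -dmap_cmp; apply: sh_faithful.
have se := iso_epic (dmap_iso srq); apply: se.
rewrite -!dmap_cmp.
have -> : sh_map (chain_cmp t b0) = chain_cmp (sh_map t) b.
  by rewrite -b0E; apply: chain_mapP.
transitivity (dmap (chain_cmp (sh_map t) (chain_cmp g r))).
  apply: homotopic_dmap; have := homotopic_cmpr r e1.
  by congr (homotopic _ _); apply: chain_mapP => n /=; rewrite !cmpA.
apply: homotopic_dmap; have := homotopic_cmpl (sh_map t) (homotopic_sym bE).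
by congr (homotopic _ _); apply: chain_mapP => n /=; rewrite !cmpA.
Qed.

(** The null homotopy [h] of [t ∘ u] lifts [- u] to a map [e] into the acyclic [cone t]. On the cone
    of [e], which is quasi-isomorphic to the double shift of [W], the double shift of [u] becomes
    null; [qis_homotopy_epic] cancels this quasi-isomorphism after a resolution. *)
Lemma chain_dmap_faithful (f g : chain_map W J) : dmap f = dmap g -> homotopic f g.
Proof.
move=> /dmap_eq [U [t [tq /homotopic_sub [h hP]]]].
pose C := cone t; pose u := chain_sub f g.
have tu n : t (n + 1) ∘ u (n + 1) = cdiff U n ∘ h n + h (n + 1) ∘ cdiff W (n + 1).
  by rewrite -hP /= subr0 cmpBr.
have eP n : (binl ∘ h (n + 1) - binr ∘ u (n + 1 + 1)) ∘ cdiff (sh W) n =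
    cdiff C n ∘ (binl ∘ h n - binr ∘ u (n + 1)).
  have uc : u (n + 1 + 1) ∘ cdiff W (n + 1) = cdiff J (n + 1) ∘ u (n + 1).
    exact: cmap_diff.
  apply: bsum_mapP; rewrite ?fst_cone ?snd_cone /= ?cmpmN; cmp_norm.
    by have := tu n; rewrite /= cmpBr => e; apply: (zmod_combine _ e); zmod.
  by move: uc; rewrite /= cmpBl cmpBr => e; apply: (zmod_combine _ e); zmod.
pose e : chain_map (sh W) C :=
  @ChainMap _ (sh W) C (fun n => binl ∘ h n - binr ∘ u (n + 1)) eP.
pose K := cone e.
have sq : qis (cone_out e) by apply/tw_out_qis/cone_acyclic.
have [K' [r [K'0 rq]]] := dim0_resolution K.
apply/homotopic_sub/sh_homotopic_inv/sh_homotopic_inv.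
apply: (qis_homotopy_epic rs K'0 (fun n => W0 (n + 1 + 1) : dim 0 (sh (sh W) n))
  (fun n => JJ (n + 1 + 1) : Jc (sh (sh J) n)) (qis_cmp sq rq)).
have null : homotopic (chain_cmp (sh_map (sh_map u)) (cone_out e))
    (chain_zero K (sh (sh J))).
  exists (fun n => - (@bsnd _ (U (n + 1)) (sh J (n + 1)) ∘
    @bfst _ (C (n + 1)) (sh (sh W) (n + 1)))) => n.
  have dK m : @bsnd _ (U _) (sh J _) ∘ @bfst _ (C _) (sh (sh W) _) ∘ cdiff (cone e) m =
      - (cdiff J (m + 1) ∘ (bsnd ∘ bfst)) - u (m + 1 + 1) ∘ bsnd.
    rewrite -[cdiff (cone e) m]cmpm1 -cmpA fst_cone cmpDr snd_cone [e _]/=.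
    by cmp_norm; rewrite ?cmpm1 ?sub0r.
  by cbv beta; rewrite !cmpNm dK /=; rewrite ?(cmpmN, cmpNm); zmod.
have := homotopic_cmpr r null; congr (homotopic _ _).
  by apply: chain_mapP => n /=; rewrite !cmpA.
by apply: chain_mapP => n /=; rewrite !cmp0m.
Qed.

End DerivedHom.

(** * Right resolutions by objects of [Jc] *)

Section InjectiveResolution.
Variable A : abcat.
Variables (dim : nat -> A -> Prop) (Jc : A -> Prop).
Hypothesis rs : resolving dim Jc.
Hypothesis Jc_zero : forall z, is_zero_object z -> Jc z.
Hypothesis emb : forall y : A, dim 0 y ->
  exists (j c : A) (i : homset y j) (p : homset j c),
    [/\ Jc j, short_exact i p & dim 0 c].

Lemma acyclic_cone_qis (X Y : complex A) (f : chain_map X Y) : acyclic (cone f) -> qis f.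
Proof.
move=> ac n; split.
  move: n; apply: int_succ => n t x y dx fx.
  have [|t' [c [b [ce bE]]]] := ac n t (binr ∘ x - binl ∘ y).
    apply: bsum_mapP; rewrite ?fst_cone ?snd_cone; cmp_norm; rewrite ?sub0r ?subr0.
      by rewrite fx; zmod.
    by rewrite dx oppr0.
  exists t', c, (- (bsnd ∘ b)); split=> //.
  have := snd_cone b; rewrite bE; cmp_norm; rewrite ?subr0 => ->.
  by rewrite ?cmpmN.
move=> t y dy; have [|t' [c [b [ce bE]]]] := ac n t (binl ∘ y).
  apply: bsum_mapP; rewrite ?fst_cone ?snd_cone; cmp_norm; rewrite ?addr0 ?oppr0.
    exact: dy.
  by [].
exists t', c, (bsnd ∘ b), (bfst ∘ b); split=> //.
  have := snd_cone b; rewrite bE; cmp_norm => e; apply: oppr_inj.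
  by rewrite -e oppr0.
by have := fst_cone b; rewrite bE; cmp_norm => ->; zmod.
Qed.

Section Construction.
Variable W : complex A.
Hypothesis W0 : termwise (dim 0) W.

(* [st_ob] is the [n]-th term of the resolution, and [st_pr] the cokernel of
   the differential of the cone entering degree [n]. *)
Record stage (n : int) := Stage {
  st_ob : A;
  st_map : homset (W n) st_ob;
  st_quo : A;
  st_pr : homset (bsum st_ob (W (n + 1))) st_quo
}.

(** The differential of the cone of [W -> J]: [i ∘ st_pr] is at once the differential of [J] on the
    first summand and the next [st_map] on the second. *)
Definition stage_diff (n : int) (s : stage n) (j : A) (i : homset (st_quo s) j) :
    homset (bsum (st_ob s) (W (n + 1))) (bsum j (W (n + 1 + 1))) :=
  binl ∘ (i ∘ st_pr s) - binr ∘ (cdiff W (n + 1) ∘ bsnd).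

(** The factorisation [d] records that [cdiff W (n + 1) ∘ bsnd] vanishes on the kernel of [st_pr];
    it makes [W (n + 1 + 1)] inject into the next quotient. *)
Definition stage_good (N n : int) (s : stage n) : Prop :=
  [/\ dim 0 (st_quo s), Jc (st_ob s), epic (st_pr s),
      exists d, d ∘ st_pr s = cdiff W (n + 1) ∘ bsnd
    & n <= N -> is_zero_object (st_ob s)].

Definition stage_next (n : int) (s : stage n) (s' : stage (n + 1)) : Prop :=
  exists i : homset (st_quo s) (st_ob s'),
    [/\ monic i, st_map s' = i ∘ (st_pr s ∘ binr) & is_cokernel (stage_diff i) (st_pr s')].

(** The new quotient is an extension of [c], the cokernel of [i], by [W (n + 1 + 1)]. Both have
    dimension 0, hence so has the quotient, and [emb] applies to it again. *)
Lemma stage_next_ex (N n : int) (s : stage n) : N <= n -> stage_good N s ->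
  exists s', stage_good N s' /\ stage_next s s'.
Proof.
move=> nN [q0 _ pe [d dE] _].
have [j [c [i [p [Jj ses c0]]]]] := emb q0.
have im := kernel_monic (proj1 ses); have pi0 := proj1 (proj1 ses).
pose D := stage_diff i; pose r := kout D.
have rD : r ∘ D = 0 := proj1 (koutP D).
have re : epic r := cokernel_epic (koutP D).
have Dfst (t : A) (a : homset t _) : bfst ∘ (D ∘ a) = i ∘ (st_pr s ∘ a).
  by rewrite /D /stage_diff; cmp_norm; rewrite subr0.
have Dsnd (t : A) (a : homset t _) : bsnd ∘ (D ∘ a) = - (cdiff W (n + 1) ∘ (bsnd ∘ a)).
  by rewrite /D /stage_diff; cmp_norm; rewrite sub0r.
exists (Stage (i ∘ (st_pr s ∘ binr)) r); split; last first.
  by exists i; split=> //; apply: koutP.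
split=> //=; last by rewrite lezD1 ltNge nN.
  have [b bE] : exists b, b ∘ r = p ∘ bfst.
    apply: (cokernel_lift (koutP D)); rewrite -cmpA -[D]cmpm1 Dfst cmpA pi0 cmp0m.
    by [].
  have ses' : short_exact (r ∘ binr) b.
    apply: short_exactP.
    - by rewrite cmpA bE -cmpA fst_inr cmpm0.
    - apply/monicP => w g; rewrite -cmpA => /(cokernel_exact (koutP D)) [t [e [a [ee aE]]]].
      have pa0 : st_pr s ∘ a = 0.
        by apply: im; rewrite -Dfst aE cmpm0; cmp_norm.
      apply: ee; have := Dsnd _ a; rewrite aE; cmp_norm => ->.
      by rewrite cmpA -dE -cmpA pa0 cmpm0 oppr0.
    - apply: (@epic_cmpl _ _ _ _ _ r); rewrite bE; apply: epic_cmp; first by case: ses.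
      by apply: (@epic_cmpl _ _ _ _ _ binl); rewrite fst_inl; apply: epic_id.
    move=> t q bq; have [t1 [c1 [x [c1e xE]]]] := epic_cover q re.
    have px : p ∘ (bfst ∘ x) = 0 by rewrite cmpA -bE -cmpA xE cmpA bq cmp0m.
    have [y yE] := kernel_lift (proj1 ses) px.
    have [t2 [c2 [a [c2e aE]]]] := epic_cover y pe.
    exists t2, (c1 ∘ c2), (bsnd ∘ (x ∘ c2 - D ∘ a)); split; first exact: epic_cmp.
    have -> : q ∘ (c1 ∘ c2) = r ∘ (x ∘ c2 - D ∘ a).
      by rewrite cmpBr [r ∘ (D ∘ _)]cmpA rD cmp0m subr0 !cmpA xE.
    rewrite -cmpA; congr (_ ∘ _); apply: bsum_mapP; last by rewrite snd_inrK.
    by rewrite fst_inr0 cmpBr Dfst aE !cmpA yE subrr.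
  exact: (rs_ext rs ses' (W0 _) c0).
apply: (cokernel_lift (koutP D)); rewrite -cmpA -[D]cmpm1 Dsnd.
by rewrite cmpmN cdiff0 oppr0.
Qed.

Lemma dim0_Jc_resolution : exists (J : complex A) (f : chain_map W J),
  termwise Jc J /\ qis f.
Proof.
(* Stage [n] involves [W (n + 1)], which vanishes when [n + 1 < N], that is, [n <= N - 2]. *)
have [N WN] := bounded_below W; pose M := N - 2.
pose st0 n : stage n := @Stage n (zob A) 0 (zob A) 0.
have Wz (n : int) : n <= M -> is_zero_object (W (n + 1)).
  move=> nM; apply: WN; rewrite /M in nM.
  by rewrite (le_lt_trans (_ : _ <= N - 1)) ?gtrBl// -lerBrDr -addrA.
have [|||s sP] := @int_dependent_choice stage (@stage_good M) stage_next M st0.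
- move=> n nM; split=> /=; [exact/(rs_zero rs)/zobP|exact/Jc_zero/zobP| | |].
  + by apply/epicP => w g _; apply/zero_from/zobP.
  + exists 0; rewrite cmp0m; apply/esym.
    by rewrite (zero_from (cdiff W (n + 1)) (Wz n nM)) cmp0m.
  + by move=> _; apply: zobP.
- move=> n nM; exists 0; split=> /=.
  + by apply/monicP => w g _; apply/zero_to/zobP.
  + by rewrite cmp0m.
  + have nM' : n + 1 <= M by rewrite lezD1.
    have B0 : is_zero_object (bsum (zob A) (W (n + 1 + 1))).
      by apply: bsum_zero; [apply: zobP|apply: Wz].
    apply: cokernelP; first by apply/zero_to/zobP.
      by apply/epicP => w g _; apply/zero_from/zobP.
    by move=> w g _; exists 0; rewrite (zero_from g B0) cmp0m.
- exact: stage_next_ex.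
have [i iP] : exists i : forall n, homset (st_quo (s n)) (st_ob (s (n + 1))),
    forall n, [/\ monic (i n), st_map (s (n + 1)) = i n ∘ (st_pr (s n) ∘ binr)
      & is_cokernel (stage_diff (i n)) (st_pr (s (n + 1)))].
  apply: (@dep_choice int _ (fun n i => [/\ monic i,
    st_map (s (n + 1)) = i ∘ (st_pr (s n) ∘ binr)
    & is_cokernel (stage_diff i) (st_pr (s (n + 1)))])) => n.
  by case: (sP n).
have sD n (t : A) (a : homset t _) : st_pr (s (n + 1)) ∘ (stage_diff (i n) ∘ a) = 0.
  by have [_ _ [e _]] := iP n; rewrite cmpA e cmp0m.
pose d n := i n ∘ (st_pr (s n) ∘ binl).
have dd n : d (n + 1) ∘ d n = 0.
  have := congr1 (fun u => i (n + 1) ∘ u) (sD n _ binl).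
  rewrite /stage_diff; cmp_norm; rewrite ?subr0 => e; rewrite /d; cmp_norm.
  by rewrite e.
have bb : exists N : int, forall n, n < N -> is_zero_object (st_ob (s n)).
  by exists M => n nM; have [[_ _ _ _ z] _] := sP n; apply/z/ltW.
pose J := @Complex A (fun n => st_ob (s n)) d dd bb.
have fP : forall n : int, st_map (s (n + 1)) ∘ cdiff W n = cdiff J n ∘ st_map (s n).
  apply: int_succ => n; have [_ -> _] := iP (n + 1); have [_ -> _] := iP n.
  have := congr1 (fun u => i (n + 1) ∘ u) (sD n _ binr).
  rewrite /stage_diff; cmp_norm; rewrite ?cmpm1 => /subr0_eq e.
  by rewrite /= /d; cmp_norm; rewrite e.
exists J, (@ChainMap _ W J (fun n => st_map (s n)) fP); split.
  by move=> n; have [[_ ? _ _ _] _] := sP n.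
apply: acyclic_cone_qis => n t b db.
have dE m : cdiff (cone (@ChainMap _ W J (fun n => st_map (s n)) fP)) m = stage_diff (i m).
  rewrite -[LHS]cmpm1; apply: bsum_mapP; rewrite ?fst_cone ?snd_cone /stage_diff.
    have [_ e _] := iP m; rewrite /= e /d; cmp_norm; rewrite ?cmpm1 subr0.
    by rewrite -!cmpDr bsum_id cmpm1.
  by cmp_norm; rewrite ?cmpm1 sub0r.
rewrite dE in db; have [im _ _] := iP (n + 1); have [_ _ cok] := iP n.
(* A cocycle of the cone is killed by [i ∘ st_pr], hence by [st_pr] as [i] is monic; and [st_pr] is
   the cokernel of the preceding differential. *)
have h : st_pr (s (n + 1)) ∘ (b : homset t (bsum _ _)) = 0.
  apply: (monicP _).1 im _ _ _.
  have : bfst ∘ (stage_diff (i (n + 1)) ∘ (b : homset t (bsum _ _))) = 0.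
    by rewrite db cmpm0.
  by rewrite /stage_diff; cmp_norm; rewrite subr0.
have [t' [c [a [ce aE]]]] := cokernel_exact cok h.
by exists t', c, a; split; rewrite // dE.
Qed.

End Construction.

Lemma Jc_replacement (N : complex A) : exists (J : complex A)
    (a : homset (N : Dplus A) (J : Dplus A)), termwise Jc J /\ is_iso a.
Proof.
have [W [s [W0 sq]]] := dim0_resolution rs N.
have [J [f [JJ fq]]] := dim0_Jc_resolution W0.
have [g [g1 g2]] := dmap_iso sq.
exists J, (dmap f ∘ g); split=> //; apply: iso_cmp; first exact: dmap_iso.
by exists (dmap s).
Qed.

End InjectiveResolution.

(** * Vanishing of morphisms in the derived category *)

Section Vanishing.
Variable B : abcat.
Implicit Types X Y Z : complex B.

(** Vanishing of the group of morphisms, stated without a zero: the morphism sets of the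
    localization carry no group structure here. *)
Definition Dvan X Z : Prop := forall a b : homset (X : Dplus B) (Z : Dplus B), a = b.

Lemma Dvan_iso X Y Z (a : homset (X : Dplus B) (Y : Dplus B)) :
  is_iso a -> Dvan X Z -> Dvan Y Z.
Proof. by move=> /iso_epic ae XZ b c; apply: ae; apply: XZ. Qed.

Lemma Dvan_isor X Y Z (a : homset (Y : Dplus B) (Z : Dplus B)) :
  is_iso a -> Dvan X Z -> Dvan X Y.
Proof. by move=> /iso_monic am XZ b c; apply: am; apply: XZ. Qed.

Lemma Dvan_sym_iso X Y Z (a : homset (X : Dplus B) (Y : Dplus B)) :
  is_iso a -> Dvan Y Z -> Dvan X Z.
Proof. by move=> [b [ba ab]]; apply: (@Dvan_iso _ _ _ b); exists a. Qed.

Lemma Dvan_zero X Z :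
  (forall a : homset (X : Dplus B) (Z : Dplus B), a = dmap (chain_zero X Z)) -> Dvan X Z.
Proof. by move=> a0 a b; rewrite (a0 a) (a0 b). Qed.

Lemma chain_zero_cmp X Y Z (f : chain_map Y Z) :
  chain_cmp f (chain_zero X Y) = chain_zero X Z.
Proof. by apply: chain_mapP => n /=; rewrite cmpm0. Qed.

Lemma chain_cmp_zero X Y Z (f : chain_map X Y) :
  chain_cmp (chain_zero Y Z) f = chain_zero X Z.
Proof. by apply: chain_mapP => n /=; rewrite cmp0m. Qed.

Lemma Dvan_zero_complex X Z : (forall n, is_zero_object (X n)) -> Dvan X Z.
Proof.
move=> X0; apply: Dvan_zero => a; have [V [f [t [/dmap_iso/iso_monic tm ta]]]] := dmap_ex a.
apply: tm; rewrite ta -dmap_cmp chain_zero_cmp; congr dmap.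
by apply: chain_mapP => n; apply: (zero_from _ (X0 n)).
Qed.

(** Exactness of [Hom (cone i, Z) -> Hom (Y, Z) -> Hom (X, Z)]. With [a] written as [t^-1 f], the
    vanishing of [f ∘ i] becomes a null homotopy after a further quasi-isomorphism [t'], and
    [t' ∘ f] extends to the cone. *)
Lemma Dvan_cone X Y Z (i : chain_map X Y) : Dvan X Z -> Dvan (cone i) Z -> Dvan Y Z.
Proof.
move=> XZ CZ; apply: Dvan_zero => a; have [V [f [t [tq ta]]]] := dmap_ex a.
have fi0 : dmap (chain_cmp f i) = dmap (chain_zero X V).
  rewrite dmap_cmp -ta -cmpA (XZ (a ∘ dmap i) (dmap (chain_zero X Z))) -dmap_cmp.
  by rewrite chain_zero_cmp.
have [U [t' [t'q]]] := dmap_eq fi0; rewrite chain_zero_cmp => e.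
have [k kE] : exists k : chain_map (cone i) U, chain_cmp k (cone_in i) = chain_cmp t' f.
  apply: null_cone_desc; move: e; congr (homotopic _ _).
  by apply: chain_mapP => n /=; rewrite cmpA.
have [v [vt tv]] := dmap_iso (qis_cmp t'q tq).
rewrite -[a]cmp1m -vt -cmpA dmap_cmp -(cmpA (dmap t')) ta -dmap_cmp -kE dmap_cmp cmpA.
by rewrite (CZ (v ∘ dmap k) (dmap (chain_zero _ _))) -dmap_cmp chain_cmp_zero.
Qed.

Lemma Dvan_short_exact X Y C Z (i : chain_map X Y) (p : chain_map Y C) :
  (forall n, short_exact (i n) (p n)) -> Dvan X Z -> Dvan C Z -> Dvan Y Z.
Proof.
move=> ses XZ CZ.
have hP n : p (n + 1) ∘ chain_cmp i (chain_id X) (n + 1) =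
    cdiff C n ∘ (0 : homset (X (n + 1)) (C n)) + 0 ∘ cdiff X (n + 1).
  by rewrite /= cmpm1 (proj1 (proj1 (ses _))) cmpm0 cmp0m addr0.
have sq : qis (cone_desc hP).
  by apply: (short_exact_cone_qis ses (qis_id X)) => n; rewrite /= cmp0m addr0.
exact: (Dvan_cone XZ (Dvan_sym_iso (dmap_iso sq) CZ)).
Qed.

Lemma Dvan_sh X Z : Dvan (sh X) (sh Z) -> Dvan X Z.
Proof.
move=> XZ; apply: Dvan_zero => a; have [V [f [t [tq ta]]]] := dmap_ex a.
have tm := iso_monic (dmap_iso tq); apply: tm; rewrite ta -dmap_cmp chain_zero_cmp.
apply: sh_faithful; have [v [vt tv]] := dmap_iso ((sh_qis t).1 tq).
rewrite -[LHS]cmp1m -tv -cmpA (XZ (v ∘ _) (dmap (chain_zero _ _))) -dmap_cmp chain_zero_cmp.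
by congr dmap; apply: chain_mapP.
Qed.

Lemma sh_cone_qis (K P V : complex B) (i : chain_map K P) (p : chain_map P V)
    (s : chain_map (sh K) (cone p)) :
  (forall n, short_exact (i n) (p n)) ->
  (forall n, s n = binr ∘ i (n + 1)) -> qis s.
Proof.
move=> ses sE n; have im m := kernel_monic (proj1 (ses m)).
have toK m (t : B) (a : homset t (P m)) := @kernel_lift _ _ _ _ _ _ _ a (proj1 (ses m)).
split.
  move=> t k b _; rewrite sE -cmpA => kb.
  have b1 : cdiff V n ∘ (bfst ∘ b) + p (n + 1) ∘ (bsnd ∘ b) = 0.
    by rewrite -fst_cone -kb fst_inr0.
  have b2 : i (n + 1 + 1) ∘ k = - (cdiff P (n + 1) ∘ (bsnd ∘ b)).
    by rewrite -snd_cone -kb snd_inrK.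
  have [t' [c [y [ce yE]]]] := epic_cover (bfst ∘ b) (proj2 (ses n)).
  have [k' k'E] : exists k', i (n + 1) ∘ k' = bsnd ∘ b ∘ c + cdiff P n ∘ y.
    have e : (cdiff V (n) ∘ (bfst ∘ b) + p (n + 1) ∘ (bsnd ∘ b)) ∘ c = 0.
      by rewrite b1 cmp0m.
    move: e; rewrite cmpDl -!cmpA => e; apply: toK; rewrite cmpDr cmap_cdiff yE -!cmpA.
    by apply: (zmod_combine _ e); zmod.
  exists t', c, k'; split=> //; apply: im; rewrite [i _ ∘ (k ∘ c)]cmpA b2 /= cmpNm cmpmN.
  by rewrite cmap_cdiff k'E cmpDr cdiff0 addr0 cmpNm !cmpA.
move=> t b db.
have b1 : cdiff V (n + 1) ∘ (bfst ∘ b) + p (n + 1 + 1) ∘ (bsnd ∘ b) = 0.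
  by rewrite -fst_cone db cmpm0.
have b2 : cdiff P (n + 1 + 1) ∘ (bsnd ∘ b) = 0.
  by apply: oppr_inj; rewrite -snd_cone db cmpm0 oppr0.
have [t' [c [y [ce yE]]]] := epic_cover (bfst ∘ b) (proj2 (ses (n + 1))).
have [k kE] : exists k, i (n + 1 + 1) ∘ k = bsnd ∘ b ∘ c + cdiff P (n + 1) ∘ y.
  have e : (cdiff V (n + 1) ∘ (bfst ∘ b) + p (n + 1 + 1) ∘ (bsnd ∘ b)) ∘ c = 0.
    by rewrite b1 cmp0m.
  move: e; rewrite cmpDl -!cmpA => e; apply: toK; rewrite cmpDr cmap_cdiff yE -!cmpA.
  by apply: (zmod_combine _ e); zmod.
exists t', c, k, (binr ∘ y); split=> //.
  apply: im; rewrite /= cmpNm cmpmN cmap_cdiff kE cmpDr cdiff0 addr0.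
  by rewrite cmpA b2 cmp0m oppr0 cmpm0.
rewrite sE; apply: bsum_mapP; rewrite cmpDr ?fst_cone ?snd_cone; cmp_norm.
  by rewrite !add0r yE cmpA.
by rewrite kE; cmp_norm; rewrite addrK.
Qed.

Definition cohD (n : int) : functor (Dplus B) B.
Proof.
refine (@loc_lift _ (@quasi_iso B) B (coh_functor B n) _).
by move=> x y s /quasi_iso_coh; apply.
Defined.

Lemma cohD_dmap X Y (f : chain_map X Y) n : fmap (cohD n) (dmap f) = coh_map f n.
Proof. exact: loc_liftE. Qed.

End Vanishing.

(** * Complexes concentrated in one degree *)

Section Sphere.
Variable B : abcat.

(** The degree enters only through a boolean, so maps between spheres are given by cases, without
    transport along equations between integers. *)
Definition sp (M : B) (b : bool) : B := if b then M else zob B.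

Definition sp_map (M M' : B) (f : homset M M') (b : bool) : homset (sp M b) (sp M' b) :=
  match b with true => f | false => 0 end.

Fact sp_bounded (M : B) (m : int) :
  exists N : int, forall n, n < N -> is_zero_object (sp M (n == m)).
Proof. by exists m => n /lt_eqF ->; apply: zobP. Qed.

(** This is the shift [M[-m]], so morphisms from it to [Z] in the derived category form Ext^m(M,
    Z). *)
Definition sph (M : B) (m : int) : complex B := zd_complex (sp_bounded M m).

Definition sph_map (M M' : B) (f : homset M M') (m : int) : chain_map (sph M m) (sph M' m).
Proof. by exists (fun n => sp_map f (n == m)) => n; rewrite cmpm0 cmp0m. Defined.

Lemma sph_map_cmp (M M' M'' : B) (g : homset M' M'') (f : homset M M') m :
  sph_map (g ∘ f) m = chain_cmp (sph_map g m) (sph_map f m).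
Proof. by apply: chain_mapP => n /=; case: (n == m) => //=; rewrite cmp0m. Qed.

Lemma sph_map_id (M : B) m : sph_map (idm M) m = chain_id (sph M m).
Proof.
by apply: chain_mapP => n /=; case: (n == m) => //=; apply/esym/zero_to/zobP.
Qed.

Lemma sph_zero (M : B) (m n : int) : n != m -> is_zero_object (sph M m n).
Proof. by move=> /negbTE nm; rewrite /= /sp nm; apply: zobP. Qed.

Lemma zob_short_exact (i p : homset (zob B) (zob B)) : short_exact i p.
Proof.
split; last by apply/epicP => w g _; apply/zero_from/zobP.
apply: kernelP; first by apply/zero_to/zobP.
  by apply/monicP => w g _; apply/zero_to/zobP.
by move=> w g _; exists 0; rewrite cmpm0; apply/esym/zero_to/zobP.
Qed.

Lemma sph_short_exact (x y z : B) (i : homset x y) (p : homset y z) m n :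
  short_exact i p -> short_exact (sph_map i m n) (sph_map p m n).
Proof. by move=> ses /=; case: (n == m) => //=; apply: zob_short_exact. Qed.

Definition sp_cast (M : B) (b b' : bool) (e : b = b') : homset (sp M b) (sp M b') :=
  eq_rect b (fun c => homset (sp M b) (sp M c)) (idm _) b' e.

Fact sh_sph_eq (n m : int) : (n + 1 == m + 1) = (n == m).
Proof. exact: (inj_eq (addIr 1)). Qed.

Definition sh_sph (M : B) (m : int) : chain_map (sh (sph M (m + 1))) (sph M m).
Proof.
by exists (fun n => sp_cast M (sh_sph_eq n m)) => n; rewrite /= oppr0 cmpm0 cmp0m.
Defined.

Lemma sh_sph_iso (M : B) m : is_iso (dmap (sh_sph M m)).
Proof.
apply/dmap_iso/chain_iso_qis => n /=.
by case: _ / (sh_sph_eq n m); apply: is_iso_id.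
Qed.

Lemma sh_sph_natural (M M' : B) (f : homset M M') m :
  chain_cmp (sph_map f m) (sh_sph M m) = chain_cmp (sh_sph M' m) (sh_map (sph_map f (m + 1))).
Proof.
apply: chain_mapP => n /=; case: _ / (sh_sph_eq n m) => /=.
by rewrite cmpm1 cmp1m.
Qed.

(** The piece Ext^m(y, Z) -> Ext^m(x, Z) -> Ext^(m+1)(z, Z) of the long exact sequence extends from
    left to right: the cone of [y -> z] in degree [m + 1] is built from [z] in degree [m + 1] and
    [y] in degree [m], and is quasi-isomorphic to [x] in degree [m]. *)
Lemma Dvan_sph_syz (x y z : B) (i : homset x y) (p : homset y z) m (Z : complex B) :
  short_exact i p -> Dvan (sph y m) Z -> Dvan (sph z (m + 1)) Z -> Dvan (sph x m) Z.
Proof.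
move=> ses yZ zZ; pose P := sph_map p (m + 1).
have TZ : Dvan (cone P) Z.
  apply: (@Dvan_short_exact _ _ _ _ _ (cone_in P) (cone_out P)) => //.
    by move=> n; apply: bsum_short_exact.
  exact: Dvan_sym_iso (sh_sph_iso y m) yZ.
have aP n : (0 : homset (sh (sph x (m + 1)) (n + 1)) (sph z (m + 1) (n + 1))) ∘
    cdiff (sh (sph x (m + 1))) n =
    cdiff (sph z (m + 1)) n ∘ 0 + P (n + 1) ∘ sh_map (sph_map i (m + 1)) n.
  have [[pi0 _] _] := sph_short_exact (m + 1) (n + 1) ses.
  by rewrite /= in pi0 *; rewrite pi0 cmp0m cmpm0 addr0.
pose s := @tw_lift B _ (sh (sph y (m + 1))) (fun n => P (n + 1)) (cone_tau P) _
  (fun=> 0) (sh_map (sph_map i (m + 1))) aP.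
have sq : qis s.
  apply: (@sh_cone_qis _ _ _ _ (sph_map i (m + 1)) P).
    by move=> n; apply: sph_short_exact.
  by move=> n; rewrite /= cmpm0 add0r.
exact: Dvan_iso (sh_sph_iso x m) (Dvan_sym_iso (dmap_iso sq) TZ).
Qed.

Lemma Dvan_sph_ext (x y z : B) (i : homset x y) (p : homset y z) m (Z : complex B) :
  short_exact i p -> Dvan (sph x m) Z -> Dvan (sph z m) Z -> Dvan (sph y m) Z.
Proof.
move=> ses; apply: (@Dvan_short_exact _ _ _ _ _ (sph_map i m) (sph_map p m)).
by move=> n; apply: sph_short_exact.
Qed.

Lemma Dvan_retract (X Y Z : complex B) (s : chain_map X Y) (r : chain_map Y X) :
  chain_cmp r s = chain_id X -> Dvan Y Z -> Dvan X Z.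
Proof.
move=> rs YZ a b; rewrite -[a]cmpm1 -[b]cmpm1 -dmap_id -rs dmap_cmp !cmpA.
by rewrite (YZ (a ∘ dmap r) (b ∘ dmap r)).
Qed.

Lemma Dvan_sph_retract (x y : B) (s : homset x y) (r : homset y x) m (Z : complex B) :
  r ∘ s = idm x -> Dvan (sph y m) Z -> Dvan (sph x m) Z.
Proof.
move=> rs; apply: (@Dvan_retract _ _ _ (sph_map s m) (sph_map r m)).
by rewrite -sph_map_cmp rs sph_map_id.
Qed.

(* [-1 + 1] computes to [0], so this is the cohomology of [sph M 0] in degree [0]. *)
Lemma sph_coh (M : B) : exists r : homset M (cohom (coh (sph M 0) (-1))),
  is_iso r /\ coh_class (coh (sph M 0) (-1)) (idm M : homset M (sph M 0 (-1 + 1))) r.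
Proof.
have d0 : cdiff (sph M 0) (-1 + 1) ∘ (idm M : homset M (sph M 0 (-1 + 1))) = 0.
  by rewrite cmp0m.
have [r rP] := coh_class_ex (coh (sph M 0) (-1)) d0; exists r; split=> //.
apply: monic_epic_iso.
  apply/monicP => w g rg0; have := coh_class_cmp g rP; rewrite rg0.
  move=> /coh_class_zero [t [c [y [ce]]]]; rewrite cmp0m cmp1m => /esym e.
  by apply: ce; rewrite cmp0m.
apply: epic_covers; have [t [c [x [ce xP]]]] := coh_class_cover (idm (cohom (coh (sph M 0) (-1)))).
exists t, c, (x : homset t M); split=> //; rewrite cmp1m in xP.
apply: (coh_class_fun _ xP); have := coh_class_cmp (x : homset t M) rP.
by rewrite cmp1m.
Qed.

Definition sph_coh_iso (M : B) : homset M (cohom (coh (sph M 0) (-1))) :=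
  sval (cid (sph_coh M)).
Lemma sph_coh_isoP (M : B) : is_iso (sph_coh_iso M).
Proof. exact: (proj1 (svalP (cid (sph_coh M)))). Qed.
Lemma sph_coh_class (M : B) :
  coh_class (coh (sph M 0) (-1)) (idm M : homset M (sph M 0 (-1 + 1))) (sph_coh_iso M).
Proof. exact: (proj2 (svalP (cid (sph_coh M)))). Qed.

Lemma sph_coh_natural (M M' : B) (f : homset M M') :
  coh_map (sph_map f 0) (-1) ∘ sph_coh_iso M = sph_coh_iso M' ∘ f.
Proof.
apply: (coh_class_fun (coh_mapP _ (sph_coh_class M))).
have e : sph_map f 0 (-1 + 1) ∘ (idm M : homset M (sph M 0 (-1 + 1))) = f by exact: cmpm1.
by rewrite e; have := coh_class_cmp f (sph_coh_class M'); rewrite cmp1m.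
Qed.

Lemma sph_dmap_factor (M N x : B) (i : homset M N) (f : homset M x)
    (v : homset (sph N 0 : Dplus B) (sph x 0 : Dplus B)) :
  dmap (sph_map f 0) = v ∘ dmap (sph_map i 0) -> exists g, g ∘ i = f.
Proof.
move=> /(congr1 (fmap (cohD B (-1)))); rewrite fmapM !cohD_dmap => e.
have [r [r1 r2]] := sph_coh_isoP x.
exists (r ∘ (fmap (cohD B (-1)) v ∘ sph_coh_iso N)).
rewrite -!cmpA -sph_coh_natural (cmpA (fmap _ _)) -e sph_coh_natural.
by rewrite cmpA r1 cmp1m.
Qed.

Lemma sph_dmap_inj (M x : B) (f g : homset M x) :
  dmap (sph_map f 0) = dmap (sph_map g 0) -> f = g.
Proof.
move=> /(congr1 (fmap (cohD B (-1)))); rewrite !cohD_dmap => e.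
have rm := iso_monic (sph_coh_isoP x); apply: rm.
by rewrite -!sph_coh_natural e.
Qed.

(** The cone of [i] is quasi-isomorphic to [Y] in degree 1, so its connecting map followed by [f]
    vanishes. By [null_cone_out], [f] factors through [i] in the derived category, and cohomology in
    degree 0 returns the factorisation to objects. *)
Lemma sph_extend (M N Y x : B) (i : homset M N) (p : homset N Y) (f : homset M x) :
  short_exact i p -> Dvan (sph Y 1) (sph x 0) -> exists g, g ∘ i = f.
Proof.
move=> ses Yx; pose ic := sph_map i (0 + 1); pose T := cone ic.
pose w := chain_cmp (sph_map f 0) (sh_sph M 0).
have hP n : sph_map p (0 + 1) (n + 1) ∘ chain_cmp ic (chain_id _) (n + 1) =
    cdiff (sph Y (0 + 1)) n ∘ (0 : homset (sph M (0 + 1) (n + 1)) (sph Y (0 + 1) n)) +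
    0 ∘ cdiff (sph M (0 + 1)) (n + 1).
  have [[pi0 _] _] := sph_short_exact (0 + 1) (n + 1) ses.
  by rewrite /= in pi0 *; rewrite cmpm1 pi0 cmp0m cmpm0 addr0.
have sq : qis (cone_desc hP).
  apply: (short_exact_cone_qis (i := ic) (p := sph_map p (0 + 1)) _ (qis_id _)).
    by move=> n; apply: sph_short_exact.
  by move=> n; rewrite /= cmp0m addr0.
have TeT : chain_cmp ic (chain_id _) = ic by apply: chain_mapP => n /=; rewrite cmpm1.
have Tx : Dvan T (sph x 0).
  by rewrite /T -TeT; apply: Dvan_sym_iso (dmap_iso sq) Yx.
have := Tx (dmap (chain_cmp w (cone_out ic))) (dmap (chain_zero _ _)).
move=> /dmap_eq [U [t [tq]]]; rewrite chain_zero_cmp => e.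
have [y ty] : exists y : chain_map (sh (sph N (0 + 1))) U,
    homotopic (chain_cmp t w) (chain_cmp y (sh_map ic)).
  apply: null_cone_out; move: e; congr (homotopic _ _).
  by apply: chain_mapP => n; rewrite [LHS]cmpA.
have [v [vt tv]] := dmap_iso tq.
have [u [uM Mu]] := sh_sph_iso N 0.
apply: (@sph_dmap_factor _ _ _ _ _ (v ∘ dmap y ∘ u)).
have Me := iso_epic (sh_sph_iso M 0); apply: Me.
rewrite -[LHS]dmap_cmp -/w -!cmpA -[dmap _ ∘ dmap (sh_sph M 0)]dmap_cmp (sh_sph_natural i 0).
rewrite [dmap (chain_cmp (sh_sph N 0) _)]dmap_cmp (cmpA u) uM cmp1m -[LHS]cmp1m -vt.
by rewrite -cmpA -dmap_cmp (homotopic_dmap ty) dmap_cmp.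
Qed.

End Sphere.

(** * Consequences of an equivalence on complexes of injectives *)

Section Transport.
Variables (A B : abcat) (F : additive_functor A B).

Local Notation CF := (complex_fob F).
Local Notation Cf := (complex_fmap F).
Definition inj_complex (I : complex A) : Prop := termwise (@injective_object A) I.

(* What an equivalence [RF] says about complexes of injectives. *)
Record inj_equivalence : Prop := InjEquivalence {
  ie_full : forall I J, inj_complex I -> inj_complex J ->
    forall b : homset (CF I : Dplus B) (CF J : Dplus B),
    exists g : chain_map I J, b = dmap (Cf g);
  ie_faithful : forall I J, inj_complex I -> inj_complex J ->
    forall g g' : chain_map I J, dmap (Cf g) = dmap (Cf g') -> homotopic g g';
  ie_ess : forall N : complex B, exists (I : complex A)
    (a : homset (N : Dplus B) (CF I : Dplus B)), inj_complex I /\ is_iso a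
}.

Hypothesis ie : inj_equivalence.

Definition vanishes_above (p : int) (J : complex A) : Prop :=
  forall k, p < k -> is_zero_object (J k).

(* [dimB q M] says that [Ext^m(M, F j) = 0] for [m > q] and [j] injective. *)
Definition dimB (q : nat) (M : B) : Prop :=
  forall (m : int) (J : complex A), q%:Z < m -> inj_complex J -> vanishes_above 0 J ->
  Dvan (sph M m) (CF J).

(** Closed under isomorphism, so that every zero object of [B] belongs to it, as [Jc_replacement]
    requires. *)
Definition JcB (x : B) : Prop :=
  exists (j : A) (u : homset x (F j)), injective_object j /\ is_iso u.

Lemma inj_zero (z : A) : is_zero_object z -> injective_object z.
Proof. by move=> z0 x y m _ f; exists 0; rewrite cmp0m; apply/esym/zero_to. Qed.

Lemma inj_sph (j : A) m : injective_object j -> inj_complex (sph j m).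
Proof. by move=> jI n /=; case: (n == m) => //; apply/inj_zero/zobP. Qed.

Lemma chain_iso_dmap (X Y : complex B) (f : chain_map X Y) :
  (forall n, is_iso (f n)) -> is_iso (dmap f).
Proof. by move=> /chain_iso_qis/dmap_iso. Qed.

(** [F] sends the chosen zero object to a zero object that need not be the chosen one, so [F] of a
    sphere is a sphere only up to this isomorphism. *)
Definition fsp (j : A) (b : bool) : homset (F (sp j b)) (sp (F j) b) :=
  match b with true => idm (F j) | false => 0 end.

Lemma zero_iso (C : abcat) (x y : C) (f : homset x y) :
  is_zero_object x -> is_zero_object y -> is_iso f.
Proof.
by move=> x0 y0; exists 0; rewrite cmp0m cmpm0 !((zero_id _).1 _).
Qed.

Lemma fsp_iso (j : A) b : is_iso (fsp j b).
Proof.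
case: b; first exact: is_iso_id.
by apply: zero_iso; [apply/fob_zero/zobP|apply: zobP].
Qed.

Definition fsph (j : A) m : chain_map (CF (sph j m)) (sph (F j) m).
Proof. by exists (fun n => fsp j (n == m)) => n; rewrite /= fmap0 cmpm0 cmp0m. Defined.

Lemma fsph_iso (j : A) m : is_iso (dmap (fsph j m)).
Proof. by apply: chain_iso_dmap => n; apply: fsp_iso. Qed.

Lemma fsph_natural (j k : A) (g : homset j k) m :
  chain_cmp (sph_map (fmap F g) m) (fsph j m) = chain_cmp (fsph k m) (Cf (sph_map g m)).
Proof.
apply: chain_mapP => n /=; case: (n == m) => /=; first by rewrite cmpm1 cmp1m.
by rewrite !cmp0m.
Qed.

Lemma sph_chain (j k : A) (g : chain_map (sph j 0) (sph k 0)) :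
  g = sph_map (g 0 : homset j k) 0.
Proof.
apply: chain_mapP => n; case: (n =P 0) => [-> //|/eqP n0].
have z := sph_zero j n0; by rewrite (zero_from (g n) z) (zero_from (sph_map _ 0 n) z).
Qed.

Lemma inj_full (j k : A) : injective_object j -> injective_object k ->
  forall f : homset (F j) (F k), exists g : homset j k, f = fmap F g.
Proof.
move=> jI kI f; have [v [vk kv]] := fsph_iso k 0.
have [g gE] := ie_full ie (inj_sph jI) (inj_sph kI)
  (v ∘ dmap (sph_map f 0) ∘ dmap (fsph j 0)).
exists (g 0 : homset j k); apply: sph_dmap_inj.
have je := iso_epic (fsph_iso j 0); apply: je.
rewrite -[RHS]dmap_cmp fsph_natural -sph_chain dmap_cmp -gE !cmpA kv cmp1m.
by [].
Qed.

Lemma inj_faithful (j k : A) : injective_object j -> injective_object k ->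
  forall g g' : homset j k, fmap F g = fmap F g' -> g = g'.
Proof.
move=> jI kI g g' gg'.
have e : dmap (Cf (sph_map g 0)) = dmap (Cf (sph_map g' 0)).
  congr dmap; apply: chain_mapP => n /=; case: (n == 0) => //=.
have [h hP] := ie_faithful ie (inj_sph jI) (inj_sph kI) e.
have := hP (-1); rewrite [cdiff _ _]/= cmp0m [cdiff _ _]/= cmpm0 addr0.
exact: subr0_eq.
Qed.

(** The source of all vanishing for [dimB]: by fullness every morphism is a chain map of complexes
    of injectives, and in each degree its source or its target is zero. *)
Lemma Dvan_inj (I J : complex A) : inj_complex I -> inj_complex J ->
  (forall n, is_zero_object (I n) \/ is_zero_object (J n)) -> Dvan (CF I) (CF J).
Proof.
move=> II JI z a b; have [g ->] := ie_full ie II JI a; have [g' ->] := ie_full ie II JI b.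
congr dmap; apply: chain_mapP => n /=; congr fmap.
by case: (z n) => z0; [rewrite (zero_from (g n) z0) (zero_from (g' n) z0)
  |rewrite (zero_to (g n) z0) (zero_to (g' n) z0)].
Qed.

Lemma dimB_mono q x : dimB q x -> dimB q.+1 x.
Proof. by move=> qx m J qm; apply: qx; apply: lt_trans qm; rewrite ltz_nat. Qed.

Lemma dimB_zero z : is_zero_object z -> dimB 0 z.
Proof.
move=> z0 m J _ _ _; apply: Dvan_zero_complex => n /=.
by case: (n == m) => //; apply: zobP.
Qed.

Lemma dimB_ext (x y z : B) (i : homset x y) (p : homset y z) :
  short_exact i p -> dimB 0 x -> dimB 0 z -> dimB 0 y.
Proof. by move=> ses x0 z0 m J m0 JI Jv; apply: (Dvan_sph_ext ses); [apply: x0|apply: z0]. Qed.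

Lemma dimB_syz q (x y z : B) (i : homset x y) (p : homset y z) :
  short_exact i p -> dimB 0 y -> dimB q.+1 z -> dimB q x.
Proof.
move=> ses y0 zq m J qm JI Jv; apply: (Dvan_sph_syz ses).
  by apply: y0 => //; apply: le_lt_trans qm.
by apply: zq => //; rewrite -addn1 PoszD ltrD2r.
Qed.

Lemma dimB_retract q (x y : B) (s : homset x y) (r : homset y x) :
  r ∘ s = idm x -> dimB q y -> dimB q x.
Proof. by move=> rs yq m J qm JI Jv; apply: (Dvan_sph_retract rs); apply: yq. Qed.

Lemma dimB_inj (j : A) : injective_object j -> dimB 0 (F j).
Proof.
move=> jI m J m0 JI Jv; apply: Dvan_iso (fsph_iso j m) _.
apply: Dvan_inj => //; first exact: inj_sph.
move=> n; case: (n =P m) => [->|/eqP nm]; first by right; apply: Jv.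
by left; apply: sph_zero.
Qed.

Lemma dimB_sub x : JcB x -> dimB 0 x.
Proof. by move=> [j [u [jI [v [vu _]]]]]; apply: dimB_retract vu (dimB_inj jI). Qed.

Lemma dimB_inj_ext (x y z j : B) (i : homset x y) (p : homset y z) (f : homset x j) :
  short_exact i p -> dimB 0 z -> JcB j -> exists g, g ∘ i = f.
Proof.
move=> ses z0 [k [u [kI [v [vu uv]]]]].
have [w [wf fw]] := fsph_iso k 0.
have zx : Dvan (sph z 1) (sph (F k) 0).
  apply: (@Dvan_isor _ _ _ (CF (sph k 0)) w); first by exists (dmap (fsph k 0)).
  by apply: z0 => // [|n n0]; [apply: inj_sph|apply: sph_zero; rewrite gt_eqF].
have [g gE] := sph_extend (u ∘ f) ses zx.
by exists (v ∘ g); rewrite -cmpA gE cmpA vu cmp1m.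
Qed.

Lemma sh_inj (J : complex A) : inj_complex J -> inj_complex (sh J).
Proof. by move=> JI n; apply: JI. Qed.

(** Trades one degree of the sphere for one shift of [J]. The map [c] identifies the differentials
    [- F d] and [F (- d)]. *)
Lemma Dvan_sh_sph (M : B) m (J : complex A) :
  Dvan (sph M m) (CF (sh J)) -> Dvan (sph M (m + 1)) (CF J).
Proof.
move=> MJ; apply: Dvan_sh; apply: (Dvan_sym_iso (sh_sph_iso M m)).
have cP n : idm (F (J (n + 1 + 1))) ∘ cdiff (sh (CF J)) n =
    cdiff (CF (sh J)) n ∘ idm (F (J (n + 1))).
  rewrite cmp1m cmpm1 /=; apply: (addrI (fmap F (cdiff J (n + 1)))).
  by rewrite subrr -fmapD subrr fmap0.
pose c : chain_map (sh (CF J)) (CF (sh J)) :=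
  @ChainMap _ (sh (CF J)) (CF (sh J)) (fun n => idm (F (J (n + 1)))) cP.
by apply: (Dvan_isor (a := dmap c)) => //; apply: chain_iso_dmap => n; apply: is_iso_id.
Qed.

Lemma Dvan_sh_iter (M : B) (r s : nat) (J : complex A) :
  Dvan (sph M r%:Z) (CF (iter s (@sh A) J)) -> Dvan (sph M (r + s)%N%:Z) (CF J).
Proof.
elim: s J => [|s IH] J; first by rewrite addn0.
rewrite iterSr => /IH; rewrite addnS -[(_ + s).+1]addn1 PoszD.
exact: Dvan_sh_sph.
Qed.

Lemma iter_sh_inj s (J : complex A) : inj_complex J -> inj_complex (iter s (@sh A) J).
Proof. by elim: s => //= s IH JI; apply/sh_inj/IH. Qed.

Lemma iter_sh_vanishes s p (J : complex A) :
  vanishes_above p J -> vanishes_above (p - s%:Z) (iter s (@sh A) J).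
Proof.
elim: s => [|s IH] Jp; first by rewrite subr0.
by move=> k pk; apply: (IH Jp); rewrite -ltrBlDr -addrA -opprD -PoszD addn1.
Qed.

Section Family.
Variable G : nat -> B.

Definition family_ob (n : int) : B := if n is Posz k then G k else zob B.

Fact family_bounded : exists N : int, forall n, n < N -> is_zero_object (family_ob n).
Proof. by exists 0 => -[k|k]; rewrite ?ltz_nat// => _; apply: zobP. Qed.

Definition family_complex : complex B := zd_complex family_bounded.

Definition family_in (r : nat) (n : int) : homset (sp (G r) (n == r)) (family_ob n) :=
  match @eqP _ n r%:Z in reflect _ b return homset (sp (G r) b) (family_ob n) with
  | ReflectT e => eq_rect r%:Z (fun k => homset (G r) (family_ob k)) (idm (G r)) n (esym e)
  | ReflectF _ => 0
  end.

Definition family_out (r : nat) (n : int) : homset (family_ob n) (sp (G r) (n == r)) :=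
  match @eqP _ n r%:Z in reflect _ b return homset (family_ob n) (sp (G r) b) with
  | ReflectT e => eq_rect r%:Z (fun k => homset (family_ob k) (G r)) (idm (G r)) n (esym e)
  | ReflectF _ => 0
  end.

Lemma family_retract (r : nat) : exists (s : chain_map (sph (G r) r) family_complex)
  (p : chain_map family_complex (sph (G r) r)), chain_cmp p s = chain_id _.
Proof.
have sP n : family_in r (n + 1) ∘ cdiff (sph (G r) r) n = cdiff family_complex n ∘ family_in r n.
  by rewrite cmpm0 cmp0m.
have pP n : family_out r (n + 1) ∘ cdiff family_complex n = cdiff (sph (G r) r) n ∘ family_out r n.
  by rewrite cmpm0 cmp0m.
exists (@ChainMap _ (sph (G r) r) family_complex (family_in r) sP).
exists (@ChainMap _ family_complex (sph (G r) r) (family_out r) pP).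
apply: chain_mapP => n /=; rewrite /family_in /family_out.
case: eqP => [e|ne]; last by rewrite cmp0m; apply/esym/zero_to/zobP.
by case: _ / (esym e) => /=; rewrite cmp1m.
Qed.

End Family.

(* If [dimB] were unbounded, a zero-differential complex made of ever worse
   objects would not be represented by a bounded-below complex of injectives. *)
Lemma dimB_bounded : exists n, forall x, dimB n x.
Proof.
apply: contrapT => /forallNP unb.
have bad (r : nat) : exists MJ : B * complex A, exists s : nat,
    [/\ (r < s)%N, inj_complex MJ.2, vanishes_above 0 MJ.2
      & ~ Dvan (sph MJ.1 (r + s)%N%:Z) (CF MJ.2)].
  (* A failure in degree [m > r + r] is split as [m = r + s] with [s > r]: [r] becomes the degree of
     [M] in the family, [s] the number of shifts applied to [J]. *)
  have /existsNP[M /existsNP[m /existsNP[J]]] := unb (r + r)%N.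
  move=> /not_implyP[rm /not_implyP[JI /not_implyP[Jv nMJ]]].
  exists (M, J), (`|m|%N - r)%N; have m0 : 0 <= m by apply/ltW/le_lt_trans/rm.
  have mE : m = `|m|%N%:Z by rewrite gez0_abs.
  have rrm : (r + r < `|m|)%N by rewrite -ltz_nat -mE.
  by split=> //=; [lia|rewrite subnKC -?mE//; lia].
have [MJ /(_ _)/cid-/all_sig[s sP]] := choice bad.
have [I [a [II ai]]] := ie_ess ie (family_complex (fun r => (MJ r).1)).
have [L IL] := bounded_below I.
(* After [s r] shifts, [J] vanishes above [- s r], and [- s r < - r < L]: it lives strictly below
   the degrees in which [I] can be nonzero. *)
pose r := `|L|%N.+1; have [rs JI Jv] := sP r; apply.
apply: Dvan_sh_iter.
have [u [p pu]] := family_retract (fun r => (MJ r).1) r.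
apply: (Dvan_retract pu); apply: (Dvan_sym_iso ai).
apply: Dvan_inj => //; first exact: iter_sh_inj.
move=> n; case: (ltP n L) => nL; [by left; apply: IL|right].
apply: (iter_sh_vanishes (s := s r) Jv); rewrite sub0r (lt_le_trans _ nL)//.
by rewrite /r in rs *; lia.
Qed.

End Transport.

(** * Generators of [B] and embeddings into objects [F j] *)

Section TransportGenerators.
Variables (A B : abcat) (F : additive_functor A B).
Hypothesis ie : inj_equivalence F.

Local Notation CF := (complex_fob F).
Local Notation Cf := (complex_fmap F).
Local Notation H0 := (fmap (cohD B (-1))).

Lemma coh_zero (X : complex B) n (H : cohomology X n) :
  is_zero_object (X (n + 1)) -> is_zero_object (cohom H).
Proof.
move=> X0; apply/zero_id; apply: (@coh_class_ext _ _ _ H) => t x a xa.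
rewrite cmp1m cmp0m; apply: (coh_class_fun xa).
rewrite (zero_to x X0) -[0](cmpm0 _ (cdiff X n)); exact: coh_class_bound.
Qed.

Lemma zero_coh_exact (X : complex B) n (H : cohomology X n) :
  is_zero_object (cohom H) -> exact (cdiff X n) (cdiff X (n + 1)).
Proof.
move=> H0 t x /(coh_class_ex H) [a xa]; apply: (@coh_class_zero _ _ _ H).
by rewrite -(zero_to a H0).
Qed.

Section Generator.
Variables (M : B) (I : complex A) (a : homset (sph M 0 : Dplus B) (CF I : Dplus B)).
Hypotheses (II : inj_complex I) (ai : is_iso a).

Lemma gen_exact n : 0 <= n -> exact (cdiff (CF I) n) (cdiff (CF I) (n + 1)).
Proof.
move=> n0; apply: (@zero_coh_exact _ _ (coh (CF I) n)).
have [v [va av]] := fmap_iso (cohD B n) ai.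
have z : is_zero_object (cohom (coh (sph M 0) n)).
  by apply/coh_zero/sph_zero; rewrite gt_eqF// ltzD1.
have e : fmap (cohD B n) a = 0 := zero_from _ z.
by apply/zero_id; rewrite -[idm _]av e cmp0m.
Qed.

Lemma gen_dim : dimB F 0 (ker (cdiff (CF I) 0)).
Proof.
apply: (@dim0_cocycles _ (dimB F) (CF I) 0 (@dimB_syz _ _ F) (dimB_bounded ie)) => //.
- by move=> n; apply: dimB_inj.
- exact: gen_exact.
Qed.

Lemma gen_epi : exists p : homset (ker (cdiff (CF I) 0)) M, epic p /\
  coh_class (coh (CF I) (-1)) (kin (cdiff (CF I) 0)) (H0 a ∘ (sph_coh_iso M ∘ p)).
Proof.
have [v [va av]] := fmap_iso (cohD B (-1)) ai.
have [r [r1 r2]] := sph_coh_isoP M.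
have [c cP] : exists c, coh_class (coh (CF I) (-1)) (kin (cdiff (CF I) 0)) c.
  by apply: coh_class_ex; case: (kinP (cdiff (CF I) 0)).
exists (r ∘ (v ∘ c)); rewrite (cmpA (sph_coh_iso M)) r2 cmp1m cmpA av cmp1m.
split=> //; apply: epic_cmp; first by apply: iso_epic; exists (sph_coh_iso M).
apply: epic_cmp; first by apply: iso_epic; exists (H0 a).
have [t [e [x [ee xe]]]] := coh_class_cover (idm (cohom (coh (CF I) (-1)))).
have dx : cdiff (CF I) 0 ∘ (x : homset t (CF I 0)) = 0 := coh_class_cocycle xe.
have [y yx] := kernel_lift (kinP _) dx.
apply: epic_covers; exists t, e, y; split=> //; rewrite cmp1m in xe.
by apply: (coh_class_fun _ xe); rewrite -yx; apply: coh_class_cmp.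
Qed.

End Generator.

(** Ties [p] to [a], so that epimorphisms chosen separately at two vertices are compatible with any
    chain map representing an arrow; this is [gen_natural]. *)
Definition gen_spec (M : B) (I : complex A) (a : homset (sph M 0 : Dplus B) (CF I : Dplus B))
    (p : homset (ker (cdiff (CF I) 0)) M) : Prop :=
  coh_class (coh (CF I) (-1)) (kin (cdiff (CF I) 0)) (H0 a ∘ (sph_coh_iso M ∘ p)).

Lemma gen_natural (M M' : B) (f : homset M M') I I' a a' p p' (g : chain_map I I')
    (z : homset (ker (cdiff (CF I) 0)) (ker (cdiff (CF I') 0))) :
  @gen_spec M I a p -> @gen_spec M' I' a' p' -> is_iso a' ->
  dmap (Cf g) ∘ a = a' ∘ dmap (sph_map f 0) ->
  kin (cdiff (CF I') 0) ∘ z = fmap F (g 0) ∘ kin (cdiff (CF I) 0) ->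
  f ∘ p = p' ∘ z.
Proof.
move=> pP p'P a'i ga zE.
have m1 := iso_monic (fmap_iso (cohD B (-1)) a'i); have m2 := iso_monic (sph_coh_isoP M').
apply: m2; apply: m1.
have e1 := coh_mapP (Cf g) pP; have e2 := coh_class_cmp z p'P.
rewrite -!cmpA in e2; rewrite zE in e2.
rewrite -(coh_class_fun e1 e2) -cohD_dmap (cmpA (H0 (dmap (Cf g)))) -fmapM ga fmapM.
by rewrite cohD_dmap (cmpA (sph_coh_iso M')) -sph_coh_natural -!cmpA.
Qed.

Lemma dimB_gen (x : B) : exists (y : B) (e : homset y x), dimB F 0 y /\ epic e.
Proof.
have [I [a [II ai]]] := ie_ess ie (sph x 0).
have [p [pe _]] := gen_epi ai.
by exists (ker (cdiff (CF I) 0)), p; split=> //; apply: (@gen_dim x I a).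
Qed.

Lemma resolvingB : resolving (dimB F) (JcB F).
Proof.
split.
- exact: dimB_mono.
- exact: dimB_zero.
- exact: dimB_ext.
- exact: dimB_syz.
- exact: dimB_bounded.
- exact: dimB_gen.
- by move=> x y z j i p f ses z0 jJ; apply: (dimB_inj_ext f ses z0 jJ).
- exact: dimB_sub.
Qed.

(** By [chain_dmap_full] the isomorphism from [y] to [F I] is a chain map. Its degree 0 part [z]
    into the 0-cocycles is split by the map [r] of [gen_epi], so [f0] is monic, and its cokernel is
    an extension of the 1-cocycles by [ker r], both of dimension 0. *)
Lemma dimB_embed (y : B) : dimB F 0 y -> exists (j : A) (c : B) (i : homset y (F j))
  (p : homset (F j) c), [/\ injective_object j, short_exact i p & dimB F 0 c].
Proof.
move=> y0; have [I [a [II ai]]] := ie_ess ie (sph y 0).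
have sph0 : termwise (dimB F 0) (sph y 0).
  by move=> n /=; case: (n == 0) => //; apply/dimB_zero/zobP.
have CFJ : termwise (JcB F) (CF I).
  by move=> n; exists (I n), (idm _); split; [apply: II|apply: is_iso_id].
have [f fE] := chain_dmap_full resolvingB sph0 CFJ a.
have fi : is_iso (coh_map f (-1)).
  by rewrite -cohD_dmap -fE; exact: (fmap_iso (cohD B (-1)) ai).
pose X := CF I; pose d0 := cdiff X 0; pose d1 := cdiff X (0 + 1).
have ex0 : exact d0 d1 by apply: (gen_exact (n := 0) ai).
have Z0 : dimB F 0 (ker d0) := gen_dim II ai.
have Z1 : dimB F 0 (ker d1).
  apply: (@dim0_cocycles _ (dimB F) X 0 (@dimB_syz _ _ F) (dimB_bounded ie)) => //.
  - by move=> n; apply: dimB_inj.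
  - by move=> n; apply: (gen_exact ai).
pose f0 : homset y (X 0) := f 0.
have df0 : d0 ∘ f0 = 0.
  by have := cmap_diff f 0; rewrite cmpm0 => /esym.
have [z zE] := kernel_lift (kinP d0) df0.
have [r [re rP]] := gen_epi ai.
have rz : r ∘ z = idm y.
  have m1 := iso_monic (fmap_iso (cohD B (-1)) ai); have m2 := iso_monic (sph_coh_isoP y).
  apply: m2; apply: m1; rewrite cmpm1.
  have e1 := coh_class_cmp z rP; rewrite zE -!cmpA in e1.
  apply: (coh_class_fun e1); rewrite fE cohD_dmap.
  have := coh_mapP f (sph_coh_class y).
  by rewrite -[f (-1 + 1) ∘ _]/(f0 ∘ idm y) cmpm1.
have km := kernel_monic (kinP d0).
have f0m : monic f0.
  apply/monicP => w g; rewrite -zE -cmpA => e.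
  have zg : z ∘ g = 0 by apply: km; rewrite e cmpm0.
  by rewrite -[g]cmp1m -rz -cmpA zg cmpm0.
exists (I 0), (coker f0), f0, (kout f0); split; [exact: II|exact: kout_short_exact|].
have [e [eE [ek ee]]] := image_short_exact ex0.
have b0 : dimB F 0 (ker r).
  by apply: (@dimB_syz _ _ F 0 _ _ _ (kin r) r) Z0 (dimB_mono y0); split=> //; apply: kinP.
have [q qE] : exists q, q ∘ kout f0 = e.
  apply: (cokernel_lift (koutP f0)).
  have km1 := kernel_monic (kinP d1); apply: km1.
  by rewrite cmpA eE cmpm0.
have kf0 : kout f0 ∘ f0 = 0 := proj1 (koutP f0).
have ses : short_exact (kout f0 ∘ (kin d0 ∘ kin r)) q.
  apply: short_exactP.
  - by rewrite cmpA qE cmpA (proj1 ek) cmp0m.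
  - apply/monicP => w g; rewrite -!cmpA => /(cokernel_exact (koutP f0)) [t [c [x [ce xE]]]].
    apply: ce; rewrite cmp0m; have rm := kernel_monic (kinP r); apply: rm; rewrite cmpm0.
    have zx : z ∘ x = kin r ∘ (g ∘ c).
      by apply: km; rewrite cmpA zE xE !cmpA.
    have x0 : x = 0.
      by rewrite -[x]cmp1m -rz -cmpA zx cmpA (proj1 (kinP r)) cmp0m.
    by rewrite -zx x0 cmpm0.
  - by apply: (@epic_cmpl _ _ _ _ _ (kout f0)); rewrite qE.
  move=> t b qb; have [t' [c [x [ce xE]]]] := epic_cover b (cokernel_epic (koutP f0)).
  have ex : e ∘ x = 0 by rewrite -qE -cmpA xE cmpA qb cmp0m.
  have [w wE] := kernel_lift ek ex.
  have rw : r ∘ (w - z ∘ (r ∘ w)) = 0 by rewrite cmpBr (cmpA r z) rz cmp1m subrr.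
  have [v vE] := kernel_lift (kinP r) rw.
  exists t', c, v; split=> //.
  rewrite -!cmpA vE cmpBr wE (cmpA (kin d0)) zE cmpBr xE.
  by rewrite (cmpA (kout f0)) kf0 cmp0m subr0.
exact: (dimB_ext ses b0 Z1).
Qed.

End TransportGenerators.

(** * Representations of the quiver *)

Lemma coker_comp_short_exact (B : abcat) (y u v c n x : B) (i : homset y u) (p : homset u c)
    (m : homset u v) (w : homset v n) (k : homset v x) :
  short_exact i p -> short_exact m w -> is_cokernel (m ∘ i) k ->
  exists (a : homset c x) (b : homset x n), short_exact a b.
Proof.
move=> ip mw kP; have mm := kernel_monic (proj1 mw); have [pi0 _] := proj1 ip.
have ke := cokernel_epic kP; have ki0 : k ∘ (m ∘ i) = 0 := proj1 kP.
have wm0 : w ∘ m = 0 := proj1 (proj1 mw).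
have [a aE] : exists a, a ∘ p = k ∘ m.
  by apply: (cokernel_lift (short_exact_cokernel ip)); rewrite -cmpA.
have [b bE] : exists b, b ∘ k = w.
  by apply: (cokernel_lift kP); rewrite cmpA wm0 cmp0m.
exists a, b; apply: short_exactP.
- by have pe := proj2 ip; apply: pe; rewrite -cmpA aE cmpA bE wm0 cmp0m.
- apply/monicP => t g ag; have [t1 [c1 [h [c1e hE]]]] := epic_cover g (proj2 ip).
  have kmh : k ∘ (m ∘ h) = 0 by rewrite cmpA -aE -cmpA hE cmpA ag cmp0m.
  have [t2 [c2 [l [c2e lE]]]] := cokernel_exact kP kmh.
  have lE' : i ∘ l = h ∘ c2 by apply: mm; rewrite !cmpA.
  have ce := epic_cmp c1e c2e; apply: ce.
  by rewrite cmp0m cmpA -hE -cmpA -lE' cmpA pi0 cmp0m.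
- by apply: (@epic_cmpl _ _ _ _ _ k); rewrite bE; case: mw.
move=> t g bg; have [t1 [c1 [h [c1e hE]]]] := epic_cover g ke.
have wh : w ∘ h = 0 by rewrite -bE -cmpA hE cmpA bg cmp0m.
have [l lE] := kernel_lift (proj1 mw) wh.
by exists t1, c1, (p ∘ l); split=> //; rewrite cmpA aE -cmpA lE.
Qed.

Lemma injective_retract (A : preadditive) (x y : A) (s : homset x y) (r : homset y x) :
  r ∘ s = idm x -> injective_object y -> injective_object x.
Proof.
move=> rs yI u v m mm f; have [g gE] := yI u v m mm (s ∘ f).
by exists (r ∘ g); rewrite -cmpA gE cmpA rs cmp1m.
Qed.

Section QuiverInjectives.
Variables (Q : finite_quiver) (A : abcat).
Local Notation C := (path_category Q).
Local Notation QA := (functor_preadditive C A).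
Implicit Types (I J : QA).

(** Embed each [J i] in an injective [K i]. Injectivity extends the arrows of [J] to the [K i],
    which form a representation because no relation has to be checked. [J] is a retract of it, hence
    [J i] one of [K i]. *)
Lemma injective_pointwise J : enough_injectives A -> injective_object J ->
  forall i : C, injective_object (J i).
Proof.
move=> hA JI.
have [K KP] : exists K : forall i : C, {k : A & homset (J i) k},
    forall i, injective_object (projT1 (K i)) /\ monic (projT2 (K i)).
  apply: (@dep_choice C (fun i => {k : A & homset (J i) k})
    (fun i K => injective_object (projT1 K) /\ monic (projT2 K))) => i.
  by have [k [m [kI mm]]] := hA (J i); exists (existT _ k m).
have [e eE] : exists e : forall a : arrow Q,
      homset (projT1 (K (qtail a))) (projT1 (K (qhead a))),
    forall a, e a ∘ projT2 (K (qtail a)) =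
      projT2 (K (qhead a)) ∘ fmap J (arrow_path a).
  apply: (@dep_choice _ _ (fun a e => e ∘ projT2 (K (qtail a)) =
      projT2 (K (qhead a)) ∘ fmap J (arrow_path a))) => a.
  by have [KI _] := KP (qhead a); have [_ Km] := KP (qtail a); apply: KI.
pose o (i : vertex Q) : A := projT1 (K i).
have mP a : (projT2 (K (qhead a)) : homset _ (o _)) ∘ fmap J (arrow_path a) =
    fmap (@quiver_rep Q A o e) (arrow_path a) ∘ projT2 (K (qtail a)).
  by rewrite (@quiver_rep_arrow Q A o e) eE.
pose m : homset J (@quiver_rep Q A o e : QA) :=
  @quiver_nat Q A J (@quiver_rep Q A o e) (fun i => projT2 (K i)) mP.
have mm : monic m by apply: monic_pointwise => i; case: (KP i).
have [r rm] := JI _ _ m mm (idm J).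
move=> i; apply: (@injective_retract _ _ _ (app m i) (app r i)); last by case: (KP i).
exact: (app_eq rm i).
Qed.

(* Every extension of a representation by an injective one splits. *)
Lemma injective_cocycle J I (c : forall a : arrow Q, homset (I (qtail a)) (J (qhead a))) :
  injective_object J ->
  exists f : forall i : C, homset (I i) (J i), forall a,
    c a = fmap J (arrow_path a) ∘ f (qtail a) - f (qhead a) ∘ fmap I (arrow_path a).
Proof.
move=> JI; pose o (i : C) : A := bsum (J i) (I i).
pose e (a : arrow Q) : homset (o (qtail a)) (o (qhead a)) :=
  binl ∘ (fmap J (arrow_path a) ∘ bfst + c a ∘ bsnd) +
  binr ∘ (fmap I (arrow_path a) ∘ bsnd).
have mP a : @binl _ (J (qhead a)) (I (qhead a)) ∘ fmap J (arrow_path a) =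
    fmap (@quiver_rep Q A o e) (arrow_path a) ∘ @binl _ (J (qtail a)) (I (qtail a)).
  by rewrite (@quiver_rep_arrow Q A o e) /e; cmp_norm; rewrite ?addr0 ?cmpm1.
pose m : homset J (@quiver_rep Q A o e : QA) :=
  @quiver_nat Q A J (@quiver_rep Q A o e) (fun i => @binl _ (J i) (I i)) mP.
have mm : monic m.
  apply: monic_pointwise => i; apply: (@monic_cmpr _ _ _ _ bfst) => /=.
  by rewrite fst_inl => w g h; rewrite !cmp1m.
have [r rm] := JI _ _ m mm (idm J).
have rl i : app r i ∘ @binl _ (J i) (I i) = idm (J i) := app_eq rm i.
(* The retraction is the identity on the summand [J]; its naturality, read on the summand [I], is
   the required equation. *)
exists (fun i => app r i ∘ @binr _ (J i) (I i)) => a.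
have := naturality r (arrow_path a); rewrite (@quiver_rep_arrow Q A o e) => nat.
have : app r (qhead a) ∘ e a ∘ @binr _ (J (qtail a)) (I (qtail a)) =
  fmap J (arrow_path a) ∘ app r (qtail a) ∘ @binr _ (J (qtail a)) (I (qtail a)).
  by rewrite nat.
rewrite /e; cmp_norm; rewrite ?add0r ?cmpm1 cmpA rl cmp1m => <-.
by rewrite addrK.
Qed.

End QuiverInjectives.

Section QuiverTransport.
Variables (Q : finite_quiver) (A B : abcat) (F : additive_functor A B).
Local Notation C := (path_category Q).
Local Notation QA := (functor_preadditive C A).
Local Notation QB := (functor_preadditive C B).
Local Notation FQ := (induced_functor C F).
Hypotheses (ie : inj_equivalence F) (hA : enough_injectives A) (hQ : enough_injectives QA).

Definition dimQ (q : nat) (M : QB) : Prop := forall i : C, dimB F q (M i).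
Definition JcQ (x : QB) : Prop :=
  exists (j : QA) (u : homset x (FQ j)), injective_object j /\ is_iso u.

Let rsB := resolvingB ie.

Lemma JcB_inj (j : A) : injective_object j -> JcB F (F j).
Proof. by move=> jI; exists j, (idm _); split=> //; apply: is_iso_id. Qed.

(** Arrows of [y] extend to the [F j] and lift to [A] by fullness on injectives. The resulting [I]
    is injective at each vertex but need not be an injective representation, hence the second
    embedding in [dimQ_embed]. *)
Lemma dimQ_embed_pointwise (y : QB) : dimQ 0 y ->
  exists (I : QA) (i : homset y (FQ I)), (forall k : C, injective_object (I k)) /\
    forall k, exists (c : B) (p : homset (F (I k)) c), short_exact (app i k) p /\ dimB F 0 c.
Proof.
move=> y0.
have [I IP] : exists I : forall k : C, {j : A & homset (y k) (F j)}, forall k,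
    injective_object (projT1 (I k)) /\
    exists c (p : homset (F (projT1 (I k))) c), short_exact (projT2 (I k)) p /\ dimB F 0 c.
  apply: (@dep_choice C (fun k => {j : A & homset (y k) (F j)})
    (fun k I => injective_object (projT1 I) /\
      exists c (p : homset (F (projT1 I)) c), short_exact (projT2 I) p /\ dimB F 0 c)) => k.
  have [j [c [i [p [jI ses c0]]]]] := dimB_embed ie (y0 k).
  by exists (existT _ j i); split=> //; exists c, p.
have [g gE] : exists g : forall a : arrow Q,
      homset (projT1 (I (qtail a))) (projT1 (I (qhead a))),
    forall a, fmap F (g a) ∘ projT2 (I (qtail a)) =
      projT2 (I (qhead a)) ∘ fmap y (arrow_path a).
  apply: (@dep_choice _ _ (fun a g => fmap F g ∘ projT2 (I (qtail a)) =
      projT2 (I (qhead a)) ∘ fmap y (arrow_path a))) => a.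
  have [tI [c [p [ses c0]]]] := IP (qtail a); have [hI _] := IP (qhead a).
  have [g gE] := rs_inj rsB (projT2 (I (qhead a)) ∘ fmap y (arrow_path a)) ses c0 (JcB_inj hI).
  by have [f fE] := inj_full ie tI hI g; exists f; rewrite -fE.
pose o (k : vertex Q) : A := projT1 (I k).
pose R : QA := @quiver_rep Q A o g.
have iP a : (projT2 (I (qhead a)) : homset _ (F (o _))) ∘ fmap y (arrow_path a) =
    fmap (FQ R) (arrow_path a) ∘ projT2 (I (qtail a)).
  rewrite -[fmap (FQ R) _]/(fmap F (fmap (@quiver_rep Q A o g) (arrow_path a))).
  by rewrite (@quiver_rep_arrow Q A o g) gE.
exists R, (@quiver_nat Q B y (FQ R) (fun k => projT2 (I k)) iP).
by split=> k; case: (IP k).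
Qed.

(** [I] is embedded by [m] in an injective representation [J]. At each vertex [m] splits, since
    [I k] is injective, so [F m] stays monic and its cokernel is a retract of [F (J k)]. The
    cokernel of [j] is an extension of that one by [c], hence of dimension 0. *)
Lemma dimQ_embed (y : QB) : dimQ 0 y -> exists (j c : QB) (i : homset y j) (p : homset j c),
  [/\ JcQ j, short_exact i p & dimQ 0 c].
Proof.
move=> y0; have [I [i [II iP]]] := dimQ_embed_pointwise y0.
have [J [m [JI mm]]] := hQ I.
have JpI := injective_pointwise hA JI.
have mpm := pointwise_monic mm.
have sm k : exists s, s ∘ app m k = idm (I k) by apply: II; apply: mpm.
pose j := fmap FQ m ∘ i.
have jm : monic j.
  apply: monic_pointwise => k; have [c [p [ses _]]] := iP k.
  have im := kernel_monic (proj1 ses); have [s sE] := sm k.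
  apply/monicP => w g jg; apply: ((monicP _).1 im).
  transitivity (fmap F s ∘ (fmap F (app m k) ∘ (app i k ∘ g))).
    by rewrite cmpA -fmapM sE fmap1 cmp1m.
  have e : fmap F (app m k) ∘ (app i k ∘ g) = 0 by rewrite cmpA; exact: jg.
  by rewrite e cmpm0.
exists (FQ J), (coker j), j, (kout j); split.
- by exists J, (idm _); split=> //; apply: is_iso_id.
- exact: kout_short_exact.
move=> k; have [c [p [ses c0]]] := iP k; have [s sE] := sm k.
have Fsm : fmap F s ∘ fmap F (app m k) = idm _ by rewrite -fmapM sE fmap1.
have Fmm : monic (fmap F (app m k)).
  by apply: (@monic_cmpr _ _ _ _ (fmap F s)); rewrite Fsm => w g h; rewrite !cmp1m.
have ws := kout_short_exact Fmm.
set w := kout (fmap F (app m k)) in ws.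
have kc : is_cokernel (fmap F (app m k) ∘ app i k) (app (kout j) k).
  have := short_exact_pointwise (kout_short_exact jm) k.
  exact: short_exact_cokernel.
have [a [b ab]] := coker_comp_short_exact ses ws kc.
apply: (dimB_ext ab c0).
have [t tE] : exists t, t ∘ w = idm _ - fmap F (app m k) ∘ fmap F s.
  apply: (cokernel_lift (short_exact_cokernel ws)).
  by rewrite cmpBl cmp1m -cmpA Fsm cmpm1 subrr.
apply: (@dimB_retract _ _ _ 0 _ _ t w); last exact: dimB_inj (JpI k).
have we := proj2 ws; apply: we; rewrite -cmpA tE cmpBr cmpm1 cmpA.
by rewrite (proj1 (proj1 ws)) cmp0m subr0 cmp1m.
Qed.

(** Vertexwise extensions [g] fail to commute with the arrows by a defect [del], which factors
    through [Y]. This cocycle lives in [B], while [J] is injective in [Q(A)]: embedding [Y] in some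
    [F I] and lifting by fullness moves the cocycle to [A], where [injective_cocycle] splits it. The
    splitting [phi] corrects [g]. *)
Lemma dimQ_inj_ext (M N Y x : QB) (i : homset M N) (p : homset N Y) (f : homset M x) :
  short_exact i p -> dimQ 0 Y -> JcQ x -> exists g, g ∘ i = f.
Proof.
move=> ses Y0 [J [u [JI [v [vu uv]]]]]; pose f' := u ∘ f.
suff [g gE] : exists g, g ∘ i = f' by exists (v ∘ g); rewrite -cmpA gE cmpA vu cmp1m.
have JpI := injective_pointwise hA JI.
have sesk := short_exact_pointwise ses.
have [g gE] : exists g : forall k : C, homset (N k) (F (J k)),
    forall k, g k ∘ app i k = app f' k.
  apply: (@dep_choice C _ (fun k g => g ∘ app i k = app f' k)) => k.
  exact: (rs_inj rsB _ (sesk k) (Y0 k) (JcB_inj (JpI k))).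
have [I [j [II jP]]] := dimQ_embed_pointwise Y0.
pose del a := g (qhead a) ∘ fmap N (arrow_path a) - fmap F (fmap J (arrow_path a)) ∘ g (qtail a).
have [c cE] : exists c : forall a : arrow Q, homset (I (qtail a)) (J (qhead a)),
    forall a, fmap F (c a) ∘ (app j (qtail a) ∘ app p (qtail a)) = del a.
  apply: (@dep_choice _ _ (fun a c =>
    fmap F c ∘ (app j (qtail a) ∘ app p (qtail a)) = del a)) => a.
  have [h hE] : exists h, h ∘ app p (qtail a) = del a.
    apply: (cokernel_lift (short_exact_cokernel (sesk (qtail a)))).
    rewrite /del cmpBl -!cmpA gE -(naturality i) cmpA gE.
    by rewrite [X in X - _](naturality f') subrr.
  have [c0 [q [jq c00]]] := jP (qtail a).
  have [l lE] := rs_inj rsB h jq c00 (JcB_inj (JpI (qhead a))).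
  have [c cE] := inj_full ie (II (qtail a)) (JpI (qhead a)) l.
  by exists c; rewrite -cE cmpA lE hE.
have [phi phiE] := injective_cocycle c JI.
pose g' k := g k + fmap F (phi k) ∘ (app j k ∘ app p k).
have g'P a : g' (qhead a) ∘ fmap N (arrow_path a) =
    fmap (FQ J) (arrow_path a) ∘ g' (qtail a).
  rewrite /g' cmpDl cmpDr -!cmpA (naturality p) (cmpA (app j _)) (naturality j).
  have := cE a; rewrite phiE /del fmapD.
  have -> : fmap F (- (phi (qhead a) ∘ fmap I (arrow_path a))) =
      - (fmap F (phi (qhead a)) ∘ fmap F (fmap I (arrow_path a))).
    apply: (addrI (fmap F (phi (qhead a) ∘ fmap I (arrow_path a)))).
    by rewrite -fmapD !subrr fmap0 -fmapM subrr.
  rewrite fmapM cmpDl cmpNm -!cmpA => e.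
  by apply: (zmod_combine _ (esym e)); zmod.
exists (@quiver_nat Q B N (FQ J) g' g'P); apply: nat_transP => k /=.
by rewrite /g' cmpDl gE -!cmpA (proj1 (proj1 (sesk k))) !cmpm0 addr0.
Qed.

(** Each arrow of [M] is a morphism between the [F I] in [D^+(B)], hence comes from a chain map,
    which acts on 0-cocycles. These chain maps are chosen arrow by arrow without any coherence,
    which suffices because the path category is free. *)
Lemma dimQ_gen (M : QB) : exists (y : QB) (e : homset y M), dimQ 0 y /\ epic e.
Proof.
pose T (k : C) := {I : complex A & (homset (sph (M k) 0 : Dplus B) (complex_fob F I : Dplus B) *
  homset (ker (cdiff (complex_fob F I) 0)) (M k))%type}.
have [G GP] : exists G : forall k, T k, forall k, [/\ inj_complex (projT1 (G k)),
    is_iso (projT2 (G k)).1, epic (projT2 (G k)).2 & gen_spec (projT2 (G k)).1 (projT2 (G k)).2].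
  apply: (@dep_choice C T (fun k G => [/\ inj_complex (projT1 G),
    is_iso (projT2 G).1, epic (projT2 G).2 & gen_spec (projT2 G).1 (projT2 G).2])) => k.
  have [I [a [II ai]]] := ie_ess ie (sph (M k) 0); have [p [pe pP]] := gen_epi ai.
  by exists (existT _ I (a, p)).
pose I k := projT1 (G k); pose a k := (projT2 (G k)).1; pose p k := (projT2 (G k)).2.
pose Z k := ker (cdiff (complex_fob F (I k)) 0).
have [z zE] : exists z : forall e : arrow Q, homset (Z (qtail e)) (Z (qhead e)),
    forall e, fmap M (arrow_path e) ∘ p (qtail e) = p (qhead e) ∘ z e.
  apply: (@dep_choice _ _ (fun e z =>
    fmap M (arrow_path e) ∘ p (qtail e) = p (qhead e) ∘ z)) => e.
  have [tI [v [va av]] _ tP] := GP (qtail e); have [hI hi _ hP] := GP (qhead e).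
  have [g gE] := ie_full ie tI hI (a (qhead e) ∘ dmap (sph_map (fmap M (arrow_path e)) 0) ∘ v).
  have dg : cdiff (complex_fob F (I (qhead e))) 0 ∘
      (fmap F (g 0) ∘ kin (cdiff (complex_fob F (I (qtail e))) 0)) = 0.
    rewrite cmpA -(cmap_diff (complex_fmap F g)) -cmpA.
    by rewrite (proj1 (kinP (cdiff (complex_fob F (I (qtail e))) 0))) cmpm0.
  have [z zE] := kernel_lift (kinP _) dg; exists z.
  apply: (gen_natural (g := g) tP hP hi) zE.
  by rewrite -gE -!cmpA va cmpm1.
have eP e : p (qhead e) ∘ fmap (@quiver_rep Q B Z z) (arrow_path e) =
    fmap M (arrow_path e) ∘ p (qtail e).
  by rewrite (@quiver_rep_arrow Q B Z z) zE.
exists (@quiver_rep Q B Z z), (@quiver_nat Q B (@quiver_rep Q B Z z) M p eP); split.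
  by move=> k; have [kI ki _ _] := GP k; apply: (gen_dim ie kI ki).
by apply: epic_pointwise => k; case: (GP k).
Qed.

Lemma resolvingQ : resolving dimQ JcQ.
Proof.
split.
- by move=> q x xq k; apply: dimB_mono.
- move=> z z0 k; apply: dimB_zero; apply/zero_id.
  exact: (app_eq ((zero_id z).1 z0) k).
- move=> x y z i p /short_exact_pointwise ses x0 z0 k; exact: dimB_ext (ses k) (x0 k) (z0 k).
- move=> q x y z i p /short_exact_pointwise ses y0 z0 k.
  exact: dimB_syz (ses k) (y0 k) (z0 k).
- by have [n nP] := dimB_bounded ie; exists n => x k; apply: nP.
- exact: dimQ_gen.
- by move=> x y z j i p f ses z0 jJ; apply: dimQ_inj_ext f ses z0 jJ.
move=> x [j [u [jI [v [vu uv]]]]] k.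
apply: (dimB_retract (s := app u k) (r := app v k)); first exact: (app_eq vu k).
by apply: dimB_inj => //; apply: injective_pointwise.
Qed.

Lemma FQ_full (I J : QA) : injective_object I -> injective_object J ->
  forall f : homset (FQ I) (FQ J), exists g : homset I J, f = fmap FQ g.
Proof.
move=> II JI f.
have [g gE] : exists g : forall k : C, homset (I k) (J k), forall k, app f k = fmap F (g k).
  apply: (@dep_choice C _ (fun k g => app f k = fmap F g)) => k.
  by apply: (inj_full ie); apply: injective_pointwise.
have gP a : g (qhead a) ∘ fmap I (arrow_path a) = fmap J (arrow_path a) ∘ g (qtail a).
  apply: (inj_faithful ie); try exact: injective_pointwise.
  by rewrite !fmapM -!gE; apply: (naturality f).
by exists (@quiver_nat Q A I J g gP); apply: nat_transP => k; apply: gE.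
Qed.

Lemma FQ_faithful (I J : QA) : injective_object I -> injective_object J ->
  forall g g' : homset I J, fmap FQ g = fmap FQ g' -> g = g'.
Proof.
move=> II JI g g' gg'; apply: nat_transP => k.
by apply: (inj_faithful ie); try exact: injective_pointwise; exact: (app_eq gg' k).
Qed.

End QuiverTransport.

(** * Derived equivalences *)

Section Equivalences.
Variables (C D : category) (G : functor C D).

Lemma equivalence_faithful : is_equivalence G ->
  forall (x y : C) (a b : homset x y), fmap G a = fmap G b -> a = b.
Proof.
move=> [H [[u ui] _]] x y a b e.
have um := iso_monic (ui y); apply: um.
have n (c : homset x y) : u y ∘ c = fmap H (fmap G c) ∘ u x := naturality u c.
by rewrite !n e.
Qed.

Lemma equivalence_full : is_equivalence G ->
  forall (x y : C) (b : homset (G x) (G y)), exists a, fmap G a = b.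
Proof.
move=> [H [[u ui] [v vi]]] x y b.
have Hf (c c' : homset (G x) (G y)) : fmap H c = fmap H c' -> c = c'.
  move=> e; have ve := iso_epic (vi (G x)); apply: ve.
  have n (d : homset (G x) (G y)) : v (G y) ∘ fmap G (fmap H d) = d ∘ v (G x) := naturality v d.
  by rewrite -!n e.
have [w [wu uw]] := ui y; have ux := iso_epic (ui x).
exists (w ∘ (fmap H b ∘ u x)); apply: Hf; apply: ux.
have n (c : homset x y) : u y ∘ c = fmap H (fmap G c) ∘ u x := naturality u c.
by rewrite -n cmpA uw cmp1m.
Qed.

Lemma equivalence_ess : is_equivalence G ->
  forall d : D, exists (x : C) (a : homset (G x) d), is_iso a.
Proof. by move=> [H [_ [v vi]]] d; exists (H d), (v d); apply: vi. Qed.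

Variable P : C -> Prop.
Hypothesis PC : forall x : C, exists (y : C) (a : homset x y), P y /\ is_iso a.
Hypothesis PG : forall x y : C, P x -> P y ->
  forall b : homset (G x) (G y), exists a, fmap G a = b.
Hypothesis PF : forall x y : C, P x -> P y ->
  forall a b : homset x y, fmap G a = fmap G b -> a = b.
Hypothesis PD : forall d : D, exists (x : C) (a : homset (G x) d), is_iso a.

Let full (x y : C) (b : homset (G x) (G y)) : exists a, fmap G a = b.
Proof.
have [x' [s [Px' [s' [s1 s2]]]]] := PC x; have [y' [t [Py' [t' [t1 t2]]]]] := PC y.
have [a aE] := PG Px' Py' (fmap G t ∘ b ∘ fmap G s').
exists (t' ∘ a ∘ s); rewrite !fmapM aE !cmpA -fmapM t1 fmap1 cmp1m.
by rewrite -cmpA -fmapM s1 fmap1 cmpm1.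
Qed.

Let faithful (x y : C) (a b : homset x y) : fmap G a = fmap G b -> a = b.
Proof.
move=> e; have [x' [s [Px' [s' [s1 s2]]]]] := PC x; have [y' [t [Py' ti]]] := PC y.
have [t' [t1 t2]] := ti.
have sm : epic s' by apply: iso_epic; exists s.
apply: sm; have tm := iso_monic ti; apply: tm.
by apply: PF => //; rewrite !fmapM e.
Qed.

(** Full faithfulness, known on [P], has been carried to all objects along the isomorphisms of [PC];
    a quasi-inverse is then made of chosen preimages, functorial by faithfulness. *)
Lemma equivalence_criterion : is_equivalence G.
Proof.
have [X XP] : exists X : forall d : D, {x : C & homset (G x) d}, forall d, is_iso (projT2 (X d)).
  apply: (@dep_choice D (fun d => {x : C & homset (G x) d}) (fun d X => is_iso (projT2 X))) => d.
  by have [x [a ai]] := PD d; exists (existT _ x a).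
pose e d := projT2 (X d).
have [e' e'P] : exists e' : forall d, homset d (G (projT1 (X d))),
    forall d, e' d ∘ e d = idm _ /\ e d ∘ e' d = idm _.
  apply: (@dep_choice D _ (fun d e' => e' ∘ e d = idm _ /\ e d ∘ e' = idm _)) => d.
  by have [f [f1 f2]] := XP d; exists f.
(* A single choice for all morphisms of [D], each packed with its endpoints. *)
have [m mE] : exists m : forall c : {xy : D * D & homset xy.1 xy.2},
    homset (projT1 (X (projT1 c).1)) (projT1 (X (projT1 c).2)),
    forall c, fmap G (m c) = e' _ ∘ (projT2 c ∘ e _).
  by apply: (@dep_choice {xy : D * D & homset xy.1 xy.2}
    (fun c => homset (projT1 (X (projT1 c).1)) (projT1 (X (projT1 c).2)))
    (fun c m => fmap G m = e' _ ∘ (projT2 c ∘ e _))) => c; apply: full.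
pose hm (x y : D) (f : homset x y) : homset (projT1 (X x)) (projT1 (X y)) :=
  m (existT (fun xy : D * D => homset xy.1 xy.2) (x, y) f).
have hmE x y f : fmap G (@hm x y f) = e' y ∘ (f ∘ e x).
  exact: (mE (existT (fun xy : D * D => homset xy.1 xy.2) (x, y) f)).
have h1 x : hm x x (idm x) = idm _.
  by apply: faithful; rewrite hmE cmp1m fmap1; case: (e'P x).
have hM x y z (g : homset y z) (f : homset x y) : hm x z (g ∘ f) = hm y z g ∘ hm x y f.
  apply: faithful; rewrite fmapM !hmE -!cmpA (cmpA (e y)).
  by case: (e'P y) => _ ->; rewrite cmp1m.
pose H := @Functor D C (fun d => projT1 (X d)) hm h1 hM; exists H; split.
  have [u uE] : exists u : forall x : C, homset x (H (G x)), forall x, fmap G (u x) = e' (G x).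
    by apply: (@dep_choice C _ (fun x u => fmap G u = e' (G x))) => x; apply: full.
  have uP x y (f : homset x y) : u y ∘ fmap (id_functor C) f = fmap (fcomp H G) f ∘ u x.
    apply: faithful; rewrite !fmapM uE [fmap G (fmap (fcomp H G) f)]hmE uE.
    by rewrite -!cmpA; case: (e'P (G x)) => _ ->; rewrite cmpm1.
  exists (@NatTrans C C (id_functor C) (fcomp H G) u uP) => x /=.
  have [v vE] := full (e (G x)); exists v.
  by have [l r] := e'P (G x); split; apply: faithful; rewrite fmapM uE vE fmap1.
have vP x y (f : homset x y) : e y ∘ fmap (fcomp G H) f = fmap (id_functor D) f ∘ e x.
  by rewrite [fmap (fcomp G H) f]hmE (cmpA (e y)); case: (e'P y) => _ ->; rewrite cmp1m.
by exists (@NatTrans D D (fcomp G H) (id_functor D) e vP) => y /=; apply: XP.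
Qed.

End Equivalences.

(** * Derived functors computed on injectives *)

Section InjectiveModel.
Variables (A : abcat) (hA : enough_injectives A).

(** With every object of dimension 0, the resolving formalism specialises to classical injective
    resolutions. *)
Lemma resolving_injective : resolving (fun _ (_ : A) => True) (@injective_object A).
Proof.
split=> //; first by exists 0%N.
  by move=> x; exists x, (idm x); split=> //; apply: epic_id.
by move=> x y z j i p f [ip _] _ jI; apply: jI; apply: kernel_monic ip.
Qed.

Lemma injective_replacement (X : complex A) : exists (I : complex A)
    (a : homset (X : Dplus A) (I : Dplus A)), inj_complex I /\ is_iso a.
Proof.
apply: (Jc_replacement resolving_injective) => [z|y _]; first exact: inj_zero.
have [j [i [jI im]]] := hA y; exists j, (coker i), i, (kout i); split=> //.
exact: kout_short_exact.
Qed.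

Lemma injective_dmap_full (X I : complex A) : inj_complex I ->
  forall a : homset (X : Dplus A) (I : Dplus A), exists f : chain_map X I, a = dmap f.
Proof. by move=> II a; apply: (chain_dmap_full resolving_injective). Qed.

Lemma injective_dmap_faithful (X I : complex A) : inj_complex I ->
  forall f g : chain_map X I, dmap f = dmap g -> homotopic f g.
Proof. by move=> II f g; apply: (chain_dmap_faithful resolving_injective). Qed.

End InjectiveModel.

Section RightDerived.
Variables (A B : abcat) (F : additive_functor A B) (RF : right_derived F).
Hypothesis hA : enough_injectives A.
Local Notation CF := (complex_fob F).
Local Notation Cf := (complex_fmap F).

Lemma rd_natural (X Y : complex A) (f : chain_map X Y) :
  rd_unit RF Y ∘ dmap (Cf f) = fmap RF (dmap f) ∘ rd_unit RF X.
Proof. exact: (naturality (rd_unit RF) (f : homset (X : complex_category A) Y)). Qed.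

Lemma rd_ess_injective (N : complex B) :
  (exists (X : Dplus A) (a : homset (RF X) (N : Dplus B)), is_iso a) ->
  exists (I : complex A) (a : homset (N : Dplus B) (CF I : Dplus B)), inj_complex I /\ is_iso a.
Proof.
move=> [X [a [b [ba ab]]]]; have [I [c [II ci]]] := injective_replacement hA X.
have [v [vr rv]] := rd_injective RF II.
exists I, (v ∘ (fmap RF c ∘ b)); split=> //; apply: iso_cmp; first by exists (rd_unit RF I).
by apply: iso_cmp; [apply: fmap_iso|exists a].
Qed.

Lemma inj_equivalence_of_derived : is_equivalence RF -> inj_equivalence F.
Proof.
move=> eq; split.
- move=> I J II JI b; have [v [vr rv]] := rd_injective RF II.
  have [a aE] := equivalence_full eq (rd_unit RF J ∘ b ∘ v).
  have [g gE] := injective_dmap_full JI a; exists g.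
  have Jm := iso_monic (rd_injective RF JI); apply: Jm.
  by rewrite rd_natural -gE aE -!cmpA vr cmpm1.
- move=> I J II JI g g' e; apply: injective_dmap_faithful => //.
  apply: (equivalence_faithful eq).
  have Ie := iso_epic (rd_injective RF II); apply: Ie.
  by rewrite -!rd_natural e.
- by move=> N; apply: rd_ess_injective; apply: equivalence_ess.
Qed.

Variables (dim : nat -> B -> Prop).
Hypothesis rs : resolving dim (JcB F).
Hypothesis emb : forall y : B, dim 0 y ->
  exists (j c : B) (i : homset y j) (p : homset j c),
    [/\ JcB F j, short_exact i p & dim 0 c].
Hypothesis Ffull : forall i j : A, injective_object i -> injective_object j ->
  forall f : homset (F i) (F j), exists g, f = fmap F g.
Hypothesis Ffaithful : forall i j : A, injective_object i -> injective_object j ->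
  forall g g' : homset i j, fmap F g = fmap F g' -> g = g'.

Let CFJ (I : complex A) : inj_complex I -> termwise (JcB F) (CF I).
Proof. by move=> II n; exists (I n), (idm _); split; [apply: II|apply: is_iso_id]. Qed.

Lemma chain_map_lift (I J : complex A) (f : chain_map (CF I) (CF J)) :
  inj_complex I -> inj_complex J -> exists g : chain_map I J, f = Cf g.
Proof.
move=> II JI.
have [g gE] : exists g : forall n, homset (I n) (J n), forall n, f n = fmap F (g n).
  apply: (@dep_choice int _ (fun n g => f n = fmap F g)) => n.
  by apply: Ffull; [apply: II|apply: JI].
have gP n : g (n + 1) ∘ cdiff I n = cdiff J n ∘ g n.
  by apply: Ffaithful; [apply: II|apply: JI|rewrite !fmapM -!gE; apply: (cmap_diff f)].
by exists (ChainMap gP); apply: chain_mapP.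
Qed.

Lemma homotopic_lift (I J : complex A) (g g' : chain_map I J) :
  inj_complex I -> inj_complex J -> homotopic (Cf g) (Cf g') -> homotopic g g'.
Proof.
move=> II JI [h hP].
have [k kE] : exists k : forall n : int, homset (I (n + 1)) (J n), forall n, h n = fmap F (k n).
  apply: (@dep_choice int _ (fun n k => h n = fmap F k)) => n.
  by apply: Ffull; [apply: II|apply: JI].
exists k => n; apply: Ffaithful; [exact: II|exact: JI|].
rewrite [RHS]fmapD !fmapM -!kE -(hP n) /=; apply: (addIr (fmap F (g' (n + 1)))).
by rewrite -fmapD !subrK.
Qed.

Lemma Jc_lift (J : complex B) : termwise (JcB F) J -> exists (I : complex A)
  (u : chain_map J (CF I)), inj_complex I /\ forall n, is_iso (u n).
Proof.
move=> JJ.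
have [I IP] : exists I : forall n, {i : A & homset (J n) (F i)},
    forall n, injective_object (projT1 (I n)) /\ is_iso (projT2 (I n)).
  apply: (@dep_choice int (fun n => {i : A & homset (J n) (F i)})
    (fun n I => injective_object (projT1 I) /\ is_iso (projT2 I))) => n.
  by have [i [u [iI ui]]] := JJ n; exists (existT _ i u).
have [d dE] : exists d : forall n : int, homset (projT1 (I n)) (projT1 (I (n + 1))),
    forall n, projT2 (I (n + 1)) ∘ cdiff J n = fmap F (d n) ∘ projT2 (I n).
  apply: (@dep_choice int _ (fun n d =>
    projT2 (I (n + 1)) ∘ cdiff J n = fmap F d ∘ projT2 (I n))) => n.
  have [nI [v [vu uv]]] := IP n; have [sI _] := IP (n + 1).
  have [d dE] := Ffull nI sI (projT2 (I (n + 1)) ∘ cdiff J n ∘ v).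
  by exists d; rewrite -dE -!cmpA vu cmpm1.
have dd n : d (n + 1) ∘ d n = 0.
  have [nI /iso_epic ue] := IP n; have [sI _] := IP (n + 1 + 1).
  apply: (Ffaithful nI sI); apply: ue.
  by rewrite fmapM -cmpA -dE cmpA -dE -cmpA cdiffK fmap0 cmpm0 cmp0m.
(* Where [J n] vanishes, the identity of [I n] and zero have the same image under [F], so they agree
   by faithfulness. *)
have bb : exists N : int, forall n, n < N -> is_zero_object (projT1 (I n)).
  have [N JN] := bounded_below J; exists N => n nN; apply/zero_id.
  have [nI [v [vu uv]]] := IP n; apply: (Ffaithful nI nI).
  by rewrite fmap1 fmap0 -uv (zero_to v (JN n nN)) cmpm0.
exists (@Complex A (fun n => projT1 (I n)) d dd bb).
by exists (@ChainMap B J (CF (@Complex A _ d dd bb)) (fun n => projT2 (I n)) dE);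
  split=> n; case: (IP n).
Qed.

(** [rd_unit] identifies [RF] with termwise [F] on complexes of injectives. Derived morphisms
    between the complexes [F I] are chain maps up to homotopy, and both lift to [A] term by term;
    every complex over [B] is replaced by one with terms [F j], whose differentials lift as well. *)
Lemma derived_equivalence : is_equivalence RF.
Proof.
apply: (@equivalence_criterion _ _ RF (fun X : Dplus A => inj_complex (X : complex A))).
- exact: injective_replacement.
- move=> I J II JI b; have [v [vr rv]] := rd_injective RF JI.
  have [f fE] := chain_dmap_full rs (fun n => rs_sub rs (CFJ II n)) (CFJ JI)
    (v ∘ b ∘ rd_unit RF I).
  have [g gE] := chain_map_lift f II JI; exists (dmap g).
  have Ie := iso_epic (rd_injective RF II); apply: Ie.
  by rewrite -rd_natural -gE -fE !cmpA rv cmp1m.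
- move=> I J II JI a b e.
  have [g gE] := injective_dmap_full JI a; have [g' g'E] := injective_dmap_full JI b.
  rewrite gE g'E in e *; apply: homotopic_dmap; apply: homotopic_lift => //.
  apply: (chain_dmap_faithful rs (fun n => rs_sub rs (CFJ II n)) (CFJ JI)).
  have Jm := iso_monic (rd_injective RF JI); apply: Jm.
  by rewrite !rd_natural e.
move=> N.
have Jz z : is_zero_object z -> JcB F z.
  move=> z0; exists (zob A), 0; split; first exact/inj_zero/zobP.
  by apply: zero_iso => //; apply/fob_zero/zobP.
have [J [a [JJ [a' [a'a aa']]]]] := Jc_replacement rs Jz emb N.
have [I [u [II ui]]] := Jc_lift JJ.
have [w [wu uw]] := dmap_iso (chain_iso_qis ui).
have [v [vr rv]] := rd_injective RF II.
exists I, (a' ∘ (w ∘ v)); apply: iso_cmp; first by exists a.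
by apply: iso_cmp; [exists (dmap u)|exists (rd_unit RF I)].
Qed.

End RightDerived.

Theorem theorem24 (A B : preadditive) (hA : is_abelian A) (hB : is_abelian B)
    (hAinj : enough_injectives A)
    (F : additive_functor A B) (hF : left_exact F)
    (Q : finite_quiver)
    (hQinj : enough_injectives (functor_preadditive (path_category Q) A))
    (RF : right_derived F) (hRF : is_equivalence RF)
    (RFQ : right_derived (induced_functor (path_category Q) F)) :
  is_equivalence RFQ.
Proof.
pose A' := AbCat hA; pose B' := AbCat hB.
have ie : @inj_equivalence A' B' F.
  exact: (@inj_equivalence_of_derived A' B' F RF hAinj hRF).
apply: (@derived_equivalence (fun_abcat (path_category Q) A') (fun_abcat (path_category Q) B')
  _ RFQ hQinj (@dimQ Q A' B' F) (@resolvingQ Q A' B' F ie hAinj)).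
- exact: (@dimQ_embed Q A' B' F ie hAinj hQinj).
- exact: (@FQ_full Q A' B' F ie hAinj).
- exact: (@FQ_faithful Q A' B' F ie hAinj).
Qed.
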